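(* Let $\theta\in\mathbb{R}$. The inclusion $\mathcal{A}(S^4_\theta)\hookrightarrow\mathcal{A}(S^7_{\theta'})$ is a not-cleft faithfully flat $\mathcal{A}(SU(2))$-Hopf–Galois extension.
   Context: Let $\lambda=e^{2\pi i\theta}$, $\mu=\sqrt\lambda=e^{\pi i\theta}$. $\mathcal{A}(S^7_{\theta'})$ is the unital complex $*$-algebra generated by $z^1,\dots,z^4$ and $\bar z^i=(z^i)^*$, with relations $z^iz^j=\lambda'^{ij}z^jz^i$, $\bar z^iz^j=\lambda'^{ji}z^j\bar z^i$, $\bar z^i\bar z^j=\lambda'^{ij}\bar z^j\bar z^i$ and $\sum_iz^i\bar z^i=1$, where $\lambda'^{ij}=1$ for $i,j\in\{1,2\}$ or $i,j\in\{3,4\}$, $\lambda'^{ij}=\mu$ for $i\in\{1,2\},j\in\{3,4\}$, $\lambda'^{ij}=\bar\mu$ for $i\in\{3,4\},j\in\{1,2\}$. $\mathcal{A}(SU(2))$ is the commutative unital complex $*$-algebra generated by $w^1,\bar w^1,w^2,\bar w^2$ with $w^1\bar w^1+w^2\bar w^2=1$; it is a Hopf algebra for which $\begin{pmatrix}w^1&w^2\\-\bar w^2&\bar w^1\end{pmatrix}$ is a matrix corepresentation ($\Delta(w_{ab})=\sum_cw_{ac}\otimes w_{cb}$, $\epsilon(w_{ab})=\delta_{ab}$), with antipode $S(w^1)=\bar w^1$, $S(w^2)=-w^2$. It coacts on $\mathcal{A}(S^7_{\theta'})$ by the $*$-algebra map $\Delta_R:\mathcal{A}(S^7_{\theta'})\to\mathcal{A}(S^7_{\theta'})\otimes\mathcal{A}(SU(2))$,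 $$\Delta_R:(z^1,z^2,z^3,z^4)\mapsto(z^1,z^2,z^3,z^4)\otimes\begin{pmatrix}w^1&w^2&0&0\\-\bar w^2&\bar w^1&0&0\\0&0&w^1&w^2\\0&0&-\bar w^2&\bar w^1\end{pmatrix}.$$ The algebra of coinvariants $\{p:\Delta_R(p)=p\otimes1\}$ is $\mathcal{A}(S^4_\theta)$, the $*$-subalgebra generated by $\alpha=2(z^1\bar z^3+z^2\bar z^4)$, $\beta=2(-z^1z^4+z^2z^3)$, $x=z^1\bar z^1+z^2\bar z^2-z^3\bar z^3-z^4\bar z^4$ (with relations $\alpha\beta=\lambda\beta\alpha$, $\alpha\beta^*=\bar\lambda\beta^*\alpha$, $\alpha,\beta$ normal, $x=x^*$ central, $\alpha\alpha^*+\beta\beta^*+x^2=1$). Definitions. Let $H$ be a Hopf algebra, $P$ a right $H$-comodule algebra with coaction $\Delta_R(p)=p_{(0)}\otimes p_{(1)}$, and $B=\{p\in P:\Delta_R(p)=p\otimes1\}$. The inclusion $B\hookrightarrow P$ is an ($H$-)Hopf–Galois extension if the canonical map $\chi:P\otimes_BP\to P\otimes H$, $p'\otimes_Bp\mapsto p'p_{(0)}\otimes p_{(1)}$, is bijective. It is faithfully flat if $P$ is faithfully flat as a right $B$-module (the functor $P\otimes_B\cdot$ on left $B$-modules is exact and faithful). It is cleft if there exists a unital, convolution-invertible, right $H$-colinear map $\phi:H\to P$; not-cleft means no such map exists. *)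

(* Defs.v *)
From HB Require Import structures.
From mathcomp Require Import all_boot all_order all_algebra generic_quotient.
From mathcomp Require Import boolp classical_sets reals trigo complex.

Set Implicit Arguments.
Unset Strict Implicit.
Unset Printing Implicit Defensive.

Import Order.TTheory GRing.Theory Num.Theory.
Local Open Scope ring_scope.
Local Open Scope quotient_scope.

HB.mixin Record isStarAlgebra (C : numClosedFieldType) A of GRing.Algebra C A := {
  star : A -> A;
  starD : {morph star : x y / x + y};
  starZ : forall (c : C) (x : A), star (c *: x) = c^* *: star x;
  starM : forall x y : A, star (x * y) = star y * star x;
  starK : involutive star
}.

#[short(type="starAlgType")]
HB.structure Definition StarAlgebra (C : numClosedFieldType) :=
  {A of GRing.Algebra C A & isStarAlgebra C A}.

Lemma star1 (C : numClosedFieldType) (A : starAlgType C) : star (1 : A) = 1.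
Proof. by rewrite -[LHS]mul1r -[X in X * _]starK -starM mul1r starK. Qed.

Lemma star0 (C : numClosedFieldType) (A : starAlgType C) : star (0 : A) = 0.
Proof. by apply: (addIr (star 0)); rewrite -starD !add0r. Qed.

Lemma starN (C : numClosedFieldType) (A : starAlgType C) :
  {morph @star C A : x / - x}.
Proof. by move=> x; apply: (addIr (star x)); rewrite -starD !addNr star0. Qed.

Section RegularStar.
Variable C : numClosedFieldType.

HB.instance Definition _ :=
  isStarAlgebra.Build C C^o
    (fun x y : C => rmorphD Num.conj x y) (fun x y : C => rmorphM Num.conj x y)
    (fun x y : C => etrans (rmorphM Num.conj x y) (mulrC _ _))
    (@conjCK C).

End RegularStar.

(******************************************************************************)
(* Tensor product of a right module M and a left module N over a set S of     *)
(* scalars, as the abelian group generated by the symbols m ⊗ n subject to    *)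
(* biadditivity and balancedness; only the two actions enter.                 *)
(******************************************************************************)

Section BalancedTensor.
Variables (S : Type) (M N : zmodType) (ra : M -> S -> M) (la : S -> N -> N).

Inductive tens_expr :=
  TPure of M & N | TZero | TAdd of tens_expr & tens_expr | TOpp of tens_expr.

Inductive tens_cong : tens_expr -> tens_expr -> Prop :=
  | TC_refl x : tens_cong x x
  | TC_sym x y : tens_cong x y -> tens_cong y x
  | TC_trans x y z : tens_cong x y -> tens_cong y z -> tens_cong x z
  | TC_add x x' y y' : tens_cong x x' -> tens_cong y y' ->
      tens_cong (TAdd x y) (TAdd x' y')
  | TC_opp x x' : tens_cong x x' -> tens_cong (TOpp x) (TOpp x')
  | TC_addA x y z : tens_cong (TAdd x (TAdd y z)) (TAdd (TAdd x y) z)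
  | TC_addC x y : tens_cong (TAdd x y) (TAdd y x)
  | TC_add0 x : tens_cong (TAdd TZero x) x
  | TC_addN x : tens_cong (TAdd (TOpp x) x) TZero
  | TC_Dl m m' n : tens_cong (TPure (m + m') n) (TAdd (TPure m n) (TPure m' n))
  | TC_Dr m n n' : tens_cong (TPure m (n + n')) (TAdd (TPure m n) (TPure m n'))
  | TC_bal m s n : tens_cong (TPure (ra m s) n) (TPure m (la s n)).

HB.instance Definition _ := gen_eqMixin tens_expr.
HB.instance Definition _ := gen_choiceMixin tens_expr.

Lemma tens_equiv : equiv_class_of (fun x y => `[< tens_cong x y >]).
Proof.
split=> [x|x y|y x z].
- exact/asboolP/TC_refl.
- by apply/asboolP/asboolP => /TC_sym.
- by move=> /asboolP xy /asboolP yz; apply/asboolP/TC_trans; first exact: xy.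
Qed.

Canonical tens_equiv_rel := EquivRelPack tens_equiv.

Definition tens := {eq_quot tens_equiv_rel}.
HB.instance Definition _ := Choice.on tens.

Let toT (x : tens_expr) : tens := \pi_tens x.

Lemma tens_eqP (x y : tens_expr) : tens_cong x y -> toT x = toT y.
Proof. by move=> xy; apply/eqmodP/asboolP. Qed.

Lemma tens_reprP (x : tens_expr) : tens_cong (repr (toT x)) x.
Proof.
have /eqmodP/asboolP // : \pi_tens (repr (toT x)) = \pi_tens x.
by rewrite reprK.
Qed.

Definition tens_zero : tens := toT TZero.
Definition tens_add (x y : tens) : tens := toT (TAdd (repr x) (repr y)).
Definition tens_opp (x : tens) : tens := toT (TOpp (repr x)).

Lemma tens_addE x y : tens_add (toT x) (toT y) = toT (TAdd x y).
Proof. by apply/tens_eqP/TC_add; exact: tens_reprP. Qed.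
Lemma tens_oppE x : tens_opp (toT x) = toT (TOpp x).
Proof. by apply/tens_eqP/TC_opp; exact: tens_reprP. Qed.

Lemma tens_toTP (P : tens -> Prop) : (forall x, P (toT x)) -> forall x, P x.
Proof. by move=> H x; rewrite -[x]reprK; exact: H. Qed.

Fact tens_addA : associative tens_add.
Proof.
elim/tens_toTP=> x; elim/tens_toTP=> y; elim/tens_toTP=> z.
rewrite !tens_addE; exact/tens_eqP/TC_addA.
Qed.
Fact tens_addC : commutative tens_add.
Proof.
elim/tens_toTP=> x; elim/tens_toTP=> y.
rewrite !tens_addE; exact/tens_eqP/TC_addC.
Qed.
Fact tens_add0 : left_id tens_zero tens_add.
Proof. elim/tens_toTP=> x; rewrite !tens_addE; exact/tens_eqP/TC_add0. Qed.
Fact tens_addN : left_inverse tens_zero tens_opp tens_add.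
Proof.
elim/tens_toTP=> x; rewrite tens_oppE tens_addE; exact/tens_eqP/TC_addN.
Qed.

HB.instance Definition _ :=
  GRing.isZmodule.Build tens tens_addA tens_addC tens_add0 tens_addN.

Definition tpure (m : M) (n : N) : tens := toT (TPure m n).

Lemma tpureDl m m' n : tpure (m + m') n = tpure m n + tpure m' n.
Proof. by rewrite [RHS]tens_addE; apply/tens_eqP/TC_Dl. Qed.
Lemma tpureDr m n n' : tpure m (n + n') = tpure m n + tpure m n'.
Proof. by rewrite [RHS]tens_addE; apply/tens_eqP/TC_Dr. Qed.
Lemma tpure_bal m s n : tpure (ra m s) n = tpure m (la s n).
Proof. exact/tens_eqP/TC_bal. Qed.
Lemma tpure0l n : tpure 0 n = 0.
Proof. by apply: (addIr (tpure 0 n)); rewrite -tpureDl !add0r. Qed.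
Lemma tpure0r m : tpure m 0 = 0.
Proof. by apply: (addIr (tpure m 0)); rewrite -tpureDr !add0r. Qed.
Lemma tpureNl m n : tpure (- m) n = - tpure m n.
Proof. by apply: (addIr (tpure m n)); rewrite -tpureDl !addNr tpure0l. Qed.
Lemma tpureNr m n : tpure m (- n) = - tpure m n.
Proof. by apply: (addIr (tpure m n)); rewrite -tpureDr !addNr tpure0r. Qed.

Lemma tens_ind (P : tens -> Prop) :
  (forall m n, P (tpure m n)) -> (forall x y, P x -> P y -> P (x + y)) ->
  forall x, P x.
Proof.
move=> Pp PD; elim/tens_toTP=> x.
suff [] : P (toT x) /\ P (- toT x) by [].
elim: x => [m n||x [Px PNx] y [Py PNy]|x [Px PNx]].
- by rewrite -[toT _]/(tpure m n) -tpureNl.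
- by rewrite -[toT _]/(0 : tens) oppr0 -(tpure0l 0).
- by rewrite -tens_addE opprD; split; apply: PD.
- by rewrite -tens_oppE opprK.
Qed.

Section Lift.
Variable V : zmodType.

Record balanced (f : M -> N -> V) : Prop := Balanced {
  balancedDl : forall n m m', f (m + m') n = f m n + f m' n;
  balancedDr : forall m n n', f m (n + n') = f m n + f m n';
  balancedA : forall m s n, f (ra m s) n = f m (la s n)
}.

Fixpoint tens_eval (f : M -> N -> V) (x : tens_expr) : V :=
  match x with
  | TPure m n => f m n
  | TZero => 0
  | TAdd x y => tens_eval f x + tens_eval f y
  | TOpp x => - tens_eval f x
  end.

(* The additive map m ⊗ n |-> f m n; meaningful when f is balanced. *)
Definition tlift (f : M -> N -> V) (x : tens) : V := tens_eval f (repr x).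

Variable f : M -> N -> V.
Hypothesis bf : balanced f.

Lemma tens_evalP x y : tens_cong x y -> tens_eval f x = tens_eval f y.
Proof.
case: bf => Dl Dr Ba.
elim=> /=.
- by [].
- by [].
- by move=> ? ? ? _ -> _ ->.
- by move=> ? ? ? ? _ -> _ ->.
- by move=> ? ? _ ->.
- by move=> *; rewrite addrA.
- by move=> *; rewrite addrC.
- by move=> *; rewrite add0r.
- by move=> *; rewrite addNr.
- by move=> *; rewrite Dl.
- by move=> *; rewrite Dr.
- by move=> *; rewrite Ba.
Qed.

Lemma tlift_toT x : tlift f (toT x) = tens_eval f x.
Proof. exact/tens_evalP/tens_reprP. Qed.

Lemma tliftE m n : tlift f (tpure m n) = f m n.
Proof. exact: tlift_toT. Qed.

Lemma tliftD : {morph tlift f : x y / x + y}.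
Proof.
elim/tens_toTP=> x; elim/tens_toTP=> y.
by rewrite [X in tlift f X]tens_addE !tlift_toT.
Qed.

End Lift.

Lemma tens_ext (V : zmodType) (g h : tens -> V) :
  {morph g : x y / x + y} -> {morph h : x y / x + y} ->
  (forall m n, g (tpure m n) = h (tpure m n)) -> g =1 h.
Proof.
by move=> gD hD E; elim/tens_ind=> [//|x y Ex Ey]; rewrite gD hD Ex Ey.
Qed.

End BalancedTensor.

(******************************************************************************)
(* Tensor product over a field.                                               *)
(******************************************************************************)

Definition ctens (C : fieldType) (M N : lmodType C) :=
  tens (fun (m : M) (c : C) => c *: m) (fun (c : C) (n : N) => c *: n).

Arguments ctens {C} (M N)%_type.
Notation "M ⊗ N" := (ctens M N) (at level 40, left associativity) : type_scope.

Definition pure (C : fieldType) (M N : lmodType C) (m : M) (n : N) : M ⊗ N :=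
  tpure _ _ m n.
Notation "m ⊗ n" := (pure m n) (at level 40, left associativity) : ring_scope.

Section FieldTensor.
Variable C : fieldType.

HB.instance Definition _ (M N : lmodType C) := GRing.Zmodule.on (M ⊗ N)%type.

Section Module.
Variables M N : lmodType C.

Lemma pureDl (m m' : M) (n : N) : (m + m') ⊗ n = m ⊗ n + m' ⊗ n.
Proof. exact: tpureDl. Qed.
Lemma pureDr (m : M) (n n' : N) : m ⊗ (n + n') = m ⊗ n + m ⊗ n'.
Proof. exact: tpureDr. Qed.
Lemma pure0l (n : N) : (0 : M) ⊗ n = 0. Proof. exact: tpure0l. Qed.
Lemma pure0r (m : M) : m ⊗ (0 : N) = 0. Proof. exact: tpure0r. Qed.
Lemma pureNl (m : M) (n : N) : (- m) ⊗ n = - (m ⊗ n).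
Proof. exact: tpureNl. Qed.
Lemma pureNr (m : M) (n : N) : m ⊗ (- n) = - (m ⊗ n).
Proof. exact: tpureNr. Qed.

Lemma pureZ c (m : M) (n : N) : (c *: m) ⊗ n = m ⊗ (c *: n).
Proof. exact: tpure_bal. Qed.

Definition ctens_scale (c : C) (x : M ⊗ N) : M ⊗ N :=
  tlift (fun m n => (c *: m) ⊗ n) x.

Lemma ctens_scale_bal c :
  balanced (fun (m : M) (c : C) => c *: m) (fun (c : C) (n : N) => c *: n)
    (fun m n => (c *: m) ⊗ n).
Proof.
split=> [n m m'|m n n'|m s n]; first by rewrite scalerDr pureDl.
- by rewrite pureDr.
- by rewrite scalerA mulrC -scalerA pureZ.
Qed.

Lemma ctens_scaleE c m n : ctens_scale c (m ⊗ n) = (c *: m) ⊗ n.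
Proof. exact: (tliftE (ctens_scale_bal c)). Qed.
Lemma ctens_scaleDr : right_distributive ctens_scale +%R.
Proof. by move=> c; exact: (tliftD (ctens_scale_bal c)). Qed.

Fact ctens_scaleA a b x :
  ctens_scale a (ctens_scale b x) = ctens_scale (a * b) x.
Proof.
elim/tens_ind: x => [m n|x y IHx IHy]; last by rewrite !ctens_scaleDr IHx IHy.
by rewrite !ctens_scaleE scalerA.
Qed.
Fact ctens_scale1 : left_id 1 ctens_scale.
Proof.
elim/tens_ind=> [m n|x y IHx IHy]; last by rewrite !ctens_scaleDr IHx IHy.
by rewrite ctens_scaleE scale1r.
Qed.
Fact ctens_scaleDl x : {morph ctens_scale^~ x : a b / a + b}.
Proof.
move=> a b; elim/tens_ind: x => [m n|x y IHx IHy].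
  by rewrite !ctens_scaleE scalerDl pureDl.
by rewrite !ctens_scaleDr IHx IHy addrACA.
Qed.

HB.instance Definition _ := GRing.Zmodule_isLmodule.Build C (M ⊗ N)%type
  ctens_scaleA ctens_scale1 ctens_scaleDr ctens_scaleDl.

Lemma pureZl c (m : M) (n : N) : (c *: m) ⊗ n = c *: (m ⊗ n).
Proof. by rewrite [RHS]ctens_scaleE. Qed.
Lemma pureZr c (m : M) (n : N) : m ⊗ (c *: n) = c *: (m ⊗ n).
Proof. by rewrite -pureZ pureZl. Qed.

Lemma ctens_ind (P : M ⊗ N -> Prop) :
  (forall m n, P (m ⊗ n)) -> (forall x y, P x -> P y -> P (x + y)) ->
  forall x, P x.
Proof. exact: tens_ind. Qed.

End Module.

Section Bilinear.
Variables M N V : lmodType C.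

Record bilin (f : M -> N -> V) : Prop := Bilin {
  bilinl : forall n, linear (f^~ n);
  bilinr : forall m, linear (f m)
}.

Variable f : M -> N -> V.
Hypothesis bf : bilin f.

Lemma bilin_balanced :
  balanced (fun (m : M) (c : C) => c *: m) (fun (c : C) (n : N) => c *: n) f.
Proof.
case: bf => fl fr.
have f0 m : f m 0 = 0 by have := fr m (-1) 0 0; rewrite scaler0 addr0 scaleN1r addNr.
have f0' n : f 0 n = 0
  by have := fl n (-1) 0 0; rewrite /= scaler0 addr0 scaleN1r addNr.
split=> [n m m'|m n n'|m s n].
- by have := fl n 1 m m'; rewrite /= !scale1r.
- by have := fr m 1 n n'; rewrite !scale1r.
- have := fl n s m 0; have := fr m s n 0.
  by rewrite /= f0 f0' !addr0 => -> ->.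
Qed.

Lemma ctliftE m n : tlift f (m ⊗ n) = f m n.
Proof. exact: (tliftE bilin_balanced). Qed.

Lemma ctlift_linear : linear (tlift f : M ⊗ N -> V).
Proof.
move=> c x y; rewrite (tliftD bilin_balanced); congr (_ + _).
elim/ctens_ind: x => [m n|x x' IHx IHy].
  rewrite -pureZl !ctliftE; case: bf => fl fr.
  have f0' : f 0 n = 0
    by have := fl n (-1) 0 0; rewrite /= scaler0 addr0 scaleN1r addNr.
  by have := fl n c m 0; rewrite /= f0' !addr0.
by rewrite scalerDr !(tliftD bilin_balanced) IHx IHy scalerDr.
Qed.

End Bilinear.

Section Functional.
Variable A : algType C.

Let sub_no1 (W : set A) :=
  (forall c x y, W x -> W y -> W (c *: x + y)) /\ ~ W 1.

(* A linear functional on a nonzero algebra that does not kill the unit; it is *)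
(* only used to see that tensor products of nonzero algebras are nonzero.      *)
Lemma unit_functional : exists f : A -> C^o, linear f /\ f 1 = 1.
Proof.
have [|W [[Wlin W1] Wmax]] := @Zorn_bigcup A sub_no1.
  move=> F FP Ftot; split=> [c x y [X FX Xx] [Y FY Yy]|[X FX X1]].
    have [XY|YX] := Ftot _ _ FX FY.
      by exists Y => //; apply: (FP _ FY).1 => //; exact: XY.
    by exists X => //; apply: (FP _ FX).1 => //; exact: YX.
  exact: (FP _ FX).2 X1.
have W0 : W 0.
  apply: contrapT => nW0.
  have We x : ~ W x by move=> Wx; apply: nW0; rewrite -(addNr x) -scaleN1r; exact: Wlin.
  apply: (Wmax [set 0]%classic).
    split=> [x /We//|sub]; apply: nW0; exact: sub.
  split=> [c x y /= -> ->|/= /eqP]; first by rewrite scaler0 addr0.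
  by rewrite oner_eq0.
have WZ c x : W x -> W (c *: x) by move=> Wx; rewrite -[_ *: _]addr0; exact: Wlin.
have WD x y : W x -> W y -> W (x + y) by rewrite -{2}[x]scale1r; exact: Wlin.
have WN x : W x -> W (- x) by rewrite -scaleN1r; exact: WZ.
have dec a : exists c : C, W (a - c *: 1).
  apply: contrapT => na.
  have nWa : ~ W a by move=> Wa; apply: na; exists 0; rewrite scale0r subr0.
  apply: (Wmax [set x | exists c w, W w /\ x = w + c *: a]%classic).
    split=> [x Wx|sub]; first by exists 0, x; rewrite scale0r addr0.
    by apply/nWa/sub; exists 1, 0; rewrite scale1r add0r.
  split=> [c x y [d [w [Ww ->]]] [e [v [Wv ->]]]|[c [w [Ww E]]]].
    exists (c * d + e), (c *: w + v); split; first exact: Wlin.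
    by rewrite scalerDr scalerDl scalerA addrACA.
  have [c0|c0] := eqVneq c 0; first by apply: W1; rewrite E c0 scale0r addr0.
  apply: na; exists c^-1; rewrite E scalerDr scalerA mulVf // scale1r opprD addrCA.
  by rewrite subrr addr0; apply/WN/WZ.
have uniq a c d : W (a - c *: 1) -> W (a - d *: 1) -> c = d.
  move=> Wc Wd; apply: contrapT => /eqP cd; apply: W1.
  have -> : 1 = (d - c)^-1 *: ((a - c *: 1) - (a - d *: 1)) :> A.
    rewrite opprB [X in _ *: X]addrC addrA subrK -scalerBl scalerA mulVf ?scale1r //.
    by rewrite subr_eq0 eq_sym.
  exact/WZ/WD/WN.
have [f fP] := choice dec; exists f; split=> [c x y|].
  apply: (uniq (c *: x + y)); first exact: fP.
  rewrite scalerDl opprD addrACA -scalerA -scalerBr; apply: Wlin; exact: fP.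
by apply: (uniq 1); [exact: fP | rewrite scale1r subrr].
Qed.

End Functional.

Section Algebra.
Variables A B : algType C.

Definition ctens_mul (x y : A ⊗ B) : A ⊗ B :=
  tlift (fun a b => tlift (fun a' b' => (a * a') ⊗ (b * b')) y) x.

Let mul1_bilin (a : A) (b : B) :
  bilin (fun (a' : A) (b' : B) => (a * a') ⊗ (b * b')).
Proof.
split=> [b' c a1 a2|a' c b1 b2].
  by rewrite mulrDr -scalerAr pureDl pureZl.
by rewrite mulrDr -scalerAr pureDr pureZr.
Qed.

Let mul2_bilin (y : A ⊗ B) : bilin (fun (a : A) (b : B) =>
  tlift (fun a' b' => (a * a') ⊗ (b * b')) y : A ⊗ B).
Proof.
split=> [b c a1 a2|a c b1 b2]; elim/ctens_ind: y => [a' b'|y y' IHy IHy'].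
- by rewrite !(ctliftE (mul1_bilin _ _)) mulrDl -scalerAl pureDl pureZl.
- rewrite !(tliftD (bilin_balanced (mul1_bilin _ _))) IHy IHy'.
  by rewrite scalerDr addrACA.
- by rewrite !(ctliftE (mul1_bilin _ _)) mulrDl -scalerAl pureDr pureZr.
- rewrite !(tliftD (bilin_balanced (mul1_bilin _ _))) IHy IHy'.
  by rewrite scalerDr addrACA.
Qed.

Let mulE a b a' b' :
  ctens_mul (a ⊗ b) (a' ⊗ b') = (a * a') ⊗ (b * b').
Proof. by rewrite /ctens_mul (ctliftE (mul2_bilin _)) (ctliftE (mul1_bilin _ _)). Qed.

Fact ctens_mulDl : left_distributive ctens_mul +%R.
Proof. by move=> x y z; exact: (tliftD (bilin_balanced (mul2_bilin z))). Qed.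

Fact ctens_mulDr : right_distributive ctens_mul +%R.
Proof.
move=> x y z; elim/ctens_ind: x => [a b|x x' IHx IHx'].
  rewrite /ctens_mul !(ctliftE (mul2_bilin _)).
  exact: (tliftD (bilin_balanced (mul1_bilin a b))).
by rewrite !ctens_mulDl IHx IHx' addrACA.
Qed.

Fact ctens_mulA : associative ctens_mul.
Proof.
move=> x y z; elim/ctens_ind: x => [a b|x x' IHx IHx'].
  elim/ctens_ind: y => [a' b'|y y' IHy IHy'].
    elim/ctens_ind: z => [a'' b''|z z' IHz IHz'].
      by rewrite !mulE !mulrA.
    by rewrite !ctens_mulDr IHz IHz'.
  by rewrite !(ctens_mulDr, ctens_mulDl) IHy IHy'.
by rewrite !ctens_mulDl IHx IHx'.
Qed.

Fact ctens_mul1l : left_id (1 ⊗ 1) ctens_mul.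
Proof.
elim/ctens_ind=> [a b|x y IHx IHy]; first by rewrite mulE !mul1r.
by rewrite ctens_mulDr IHx IHy.
Qed.
Fact ctens_mul1r : right_id (1 ⊗ 1) ctens_mul.
Proof.
elim/ctens_ind=> [a b|x y IHx IHy]; first by rewrite mulE !mulr1.
by rewrite ctens_mulDl IHx IHy.
Qed.

Fact ctens_1neq0 : (1 : A) ⊗ (1 : B) != 0.
Proof.
have [f [flin f1]] := unit_functional A.
have [g [glin g1]] := unit_functional B.
have bfg : bilin (fun a b => f a * g b : C^o).
  split=> [b c a a'|a c b b'] /=.
    by rewrite flin mulrDl -scalerAl.
  by rewrite glin mulrDr -scalerAr.
apply/eqP => /(congr1 (tlift (fun a b => f a * g b : C^o))).
rewrite (ctliftE bfg) f1 g1 mulr1 -(pure0l _ (1 : B)) (ctliftE bfg).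
have := flin (-1) 0 0; rewrite scaler0 addr0 scaleN1r addNr => ->.
by rewrite mul0r => /eqP; rewrite oner_eq0.
Qed.

HB.instance Definition _ := GRing.Zmodule_isNzRing.Build (A ⊗ B)%type
  ctens_mulA ctens_mul1l ctens_mul1r ctens_mulDl ctens_mulDr ctens_1neq0.

Lemma pure1 : (1 : A) ⊗ (1 : B) = 1. Proof. by []. Qed.

Lemma pureM (a a' : A) (b b' : B) :
  (a ⊗ b) * (a' ⊗ b') = (a * a') ⊗ (b * b').
Proof. exact: mulE. Qed.

Fact ctens_scaleAl c (x y : A ⊗ B) : c *: (x * y) = (c *: x) * y.
Proof.
elim/ctens_ind: x => [a b|x x' IHx IHx'].
  elim/ctens_ind: y => [a' b'|y y' IHy IHy'].
    by rewrite pureM -!pureZl pureM scalerAl.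
  by rewrite !mulrDr scalerDr IHy IHy'.
by rewrite scalerDr !mulrDl scalerDr IHx IHx'.
Qed.
Fact ctens_scaleAr c (x y : A ⊗ B) : c *: (x * y) = x * (c *: y).
Proof.
elim/ctens_ind: x => [a b|x x' IHx IHx'].
  elim/ctens_ind: y => [a' b'|y y' IHy IHy'].
    by rewrite pureM -!pureZl pureM scalerAr.
  by rewrite scalerDr !mulrDr scalerDr IHy IHy'.
by rewrite !mulrDl scalerDr IHx IHx'.
Qed.

HB.instance Definition _ :=
  GRing.Lmodule_isLalgebra.Build C (A ⊗ B)%type ctens_scaleAl.
HB.instance Definition _ :=
  GRing.Lalgebra_isAlgebra.Build C (A ⊗ B)%type ctens_scaleAr.

Lemma ctens_mulC :
  commutative (@GRing.mul A) -> commutative (@GRing.mul B) ->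
  commutative (@GRing.mul (A ⊗ B)%type).
Proof.
move=> cA cB x y; elim/ctens_ind: x => [a b|x x' IHx IHx'].
  elim/ctens_ind: y => [a' b'|y y' IHy IHy']; first by rewrite !pureM cA cB.
  by rewrite mulrDl mulrDr IHy IHy'.
by rewrite mulrDl mulrDr IHx IHx'.
Qed.

End Algebra.

End FieldTensor.

Section StarTensor.
Variables (C : numClosedFieldType) (A B : starAlgType C).

Definition ctens_star (x : A ⊗ B) : A ⊗ B :=
  tlift (fun a b => star a ⊗ star b) x.

Let star_bal : balanced (fun (m : A) (c : C) => c *: m)
  (fun (c : C) (n : B) => c *: n) (fun a b => star a ⊗ star b).
Proof.
split=> [n m m'|m n n'|m s n].
- by rewrite starD pureDl.
- by rewrite starD pureDr.
- by rewrite !starZ pureZ.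
Qed.

Let starE a b : ctens_star (a ⊗ b) = star a ⊗ star b.
Proof. exact: (tliftE star_bal). Qed.

Fact ctens_starD : {morph ctens_star : x y / x + y}.
Proof. exact: (tliftD star_bal). Qed.

Fact ctens_starZ c x : ctens_star (c *: x) = c^* *: ctens_star x.
Proof.
elim/ctens_ind: x => [a b|x y IHx IHy].
  by rewrite -pureZl !starE starZ pureZl.
by rewrite scalerDr !ctens_starD scalerDr IHx IHy.
Qed.

Fact ctens_starM x y : ctens_star (x * y) = ctens_star y * ctens_star x.
Proof.
elim/ctens_ind: x => [a b|x x' IHx IHx'].
  elim/ctens_ind: y => [a' b'|y y' IHy IHy'].
    by rewrite !(pureM, starE, starM).
  by rewrite mulrDr !ctens_starD mulrDl IHy IHy'.
by rewrite mulrDl !ctens_starD mulrDr IHx IHx'.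
Qed.

Fact ctens_starK : involutive ctens_star.
Proof.
elim/ctens_ind=> [a b|x y IHx IHy]; first by rewrite !starE !starK.
by rewrite !ctens_starD IHx IHy.
Qed.

HB.instance Definition _ := isStarAlgebra.Build C (A ⊗ B)%type
  ctens_starD ctens_starZ ctens_starM ctens_starK.

Lemma pure_star (a : A) (b : B) : star (a ⊗ b) = star a ⊗ star b.
Proof. exact: starE. Qed.

End StarTensor.

Section AlgebraMaps.
Variable C : fieldType.

Lemma lin_mapD (V W : lmodType C) (f : V -> W) :
  linear f -> {morph f : x y / x + y}.
Proof. by move=> fl x y; rewrite -[x in LHS]scale1r fl scale1r. Qed.

Lemma lin_map0 (V W : lmodType C) (f : V -> W) : linear f -> f 0 = 0.
Proof. by move=> fl; rewrite -(addNr 0) -scaleN1r fl scaleN1r addNr. Qed.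

Lemma lin_mapZ (V W : lmodType C) (f : V -> W) c x :
  linear f -> f (c *: x) = c *: f x.
Proof. by move=> fl; rewrite -[_ *: x]addr0 fl lin_map0 // addr0. Qed.

Lemma tlift_monoid (A B D : algType C) (f : A -> B -> D) :
  bilin f -> f 1 1 = 1 ->
  (forall a a' b b', f (a * a') (b * b') = f a b * f a' b') ->
  monoid_morphism (tlift f : A ⊗ B -> D).
Proof.
move=> bf f1 fM; split=> [|x y]; first by rewrite -pure1 (ctliftE bf).
have fD := tliftD (bilin_balanced bf).
elim/ctens_ind: x => [a b|x x' IHx IHx'].
  elim/ctens_ind: y => [a' b'|y y' IHy IHy'].
    by rewrite pureM !(ctliftE bf) fM.
  by rewrite mulrDr !fD mulrDr IHy IHy'.
by rewrite mulrDl !fD mulrDl IHx IHx'.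
Qed.

Definition ctens_map (M M' N N' : lmodType C) (f : M -> M') (g : N -> N')
    (x : M ⊗ N) : M' ⊗ N' :=
  tlift (fun m n => f m ⊗ g n) x.

Definition ctens_assoc (L M N : lmodType C) (x : (L ⊗ M) ⊗ N) : L ⊗ (M ⊗ N) :=
  tlift (fun y n => tlift (fun l m => l ⊗ (m ⊗ n)) y) x.

Section Map.
Variables (M M' N N' : lmodType C) (f : M -> M') (g : N -> N').
Hypotheses (fl : linear f) (gl : linear g).

Lemma ctens_map_bilin : bilin (fun m n => f m ⊗ g n).
Proof.
split=> [n c m m'|m c n n'] /=; first by rewrite fl pureDl pureZl.
by rewrite gl pureDr pureZr.
Qed.

Lemma ctens_mapE m n : ctens_map f g (m ⊗ n) = f m ⊗ g n.
Proof. exact: (ctliftE ctens_map_bilin). Qed.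

Lemma ctens_map_linear : linear (ctens_map f g).
Proof. exact: (ctlift_linear ctens_map_bilin). Qed.

End Map.

Lemma ctens_map_monoid (A A' B B' : algType C) (f : A -> A') (g : B -> B') :
  linear f -> linear g -> monoid_morphism f -> monoid_morphism g ->
  monoid_morphism (ctens_map f g).
Proof.
move=> fl gl [f1 fM] [g1 gM]; apply: tlift_monoid; first exact: ctens_map_bilin.
  by rewrite f1 g1.
by move=> *; rewrite fM gM pureM.
Qed.

Section Assoc.
Variables (L M N : lmodType C).

Lemma assoc_bilin1 (n : N) : bilin (fun (l : L) (m : M) => l ⊗ (m ⊗ n)).
Proof.
split=> [m c l l'|l c m m'] /=; first by rewrite pureDl pureZl.
by rewrite pureDl pureZl pureDr pureZr.
Qed.

Lemma assoc_bilin2 : bilin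
  (fun (y : L ⊗ M) (n : N) => tlift (fun l m => l ⊗ (m ⊗ n)) y : L ⊗ (M ⊗ N)).
Proof.
split=> [n|y c n n']; first exact/ctlift_linear/assoc_bilin1.
have D k := tliftD (bilin_balanced (assoc_bilin1 k)).
elim/ctens_ind: y => [l m|y y' IHy IHy'].
  by rewrite !(ctliftE (assoc_bilin1 _)) pureDr pureZr pureDr pureZr.
by rewrite !D IHy IHy' scalerDr addrACA.
Qed.

Lemma ctens_assocE (l : L) (m : M) (n : N) :
  ctens_assoc ((l ⊗ m) ⊗ n) = l ⊗ (m ⊗ n).
Proof. by rewrite /ctens_assoc (ctliftE assoc_bilin2) (ctliftE (assoc_bilin1 _)). Qed.

Lemma ctens_assoc_linear : linear (@ctens_assoc L M N).
Proof. exact/ctlift_linear/assoc_bilin2. Qed.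

End Assoc.

Lemma ctens_assoc_monoid (A B D : algType C) :
  monoid_morphism (@ctens_assoc A B D).
Proof.
apply: tlift_monoid; first exact: assoc_bilin2.
  by rewrite -pure1 (ctliftE (@assoc_bilin1 _ _ _ _)).
move=> x y b b'; have D' k := tliftD (bilin_balanced (@assoc_bilin1 A B D k)).
elim/ctens_ind: x => [a m|x x' IHx IHx'].
  elim/ctens_ind: y => [a' m'|y y' IHy IHy'].
    by rewrite !(pureM, ctliftE (@assoc_bilin1 _ _ _ _)).
  by rewrite mulrDr !D' mulrDr IHy IHy'.
by rewrite mulrDl !D' mulrDl IHx IHx'.
Qed.

Lemma comp_linear (U V W : lmodType C) (g : V -> W) (f : U -> V) :
  linear g -> linear f -> linear (g \o f).
Proof. by move=> gl fl c x y /=; rewrite fl gl. Qed.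

Lemma comp_monoid (A B D : algType C) (g : B -> D) (f : A -> B) :
  monoid_morphism g -> monoid_morphism f -> monoid_morphism (g \o f).
Proof.
by move=> [g1 gM] [f1 fM]; split=> [|x y] /=; [rewrite f1 g1|rewrite fM gM].
Qed.

Lemma lrmorph_linear (A B : algType C) (f : {lrmorphism A -> B}) : linear f.
Proof. by move=> c x y; rewrite linearP. Qed.

Lemma lrmorph_monoid (A B : algType C) (f : {lrmorphism A -> B}) :
  monoid_morphism f.
Proof. by split=> [|x y]; [rewrite rmorph1|rewrite rmorphM]. Qed.

End AlgebraMaps.

(******************************************************************************)
(* Hopf algebras, comodule algebras, Hopf-Galois and cleft extensions.        *)
(******************************************************************************)

Record hopf_algebra (C : fieldType) (H : algType C) := HopfAlgebra {
  comul : {lrmorphism H -> H ⊗ H};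
  counit : {lrmorphism H -> C^o};
  antipode : {linear H -> H};
  comulA : forall h : H,
    ctens_assoc (ctens_map comul idfun (comul h)) =
    ctens_map idfun comul (comul h);
  comul1l : forall h : H, tlift (fun a b => counit a *: b) (comul h) = h;
  comul1r : forall h : H, tlift (fun a b => counit b *: a) (comul h) = h;
  antipodel : forall h : H,
    tlift (fun a b => antipode a * b) (comul h) = counit h *: 1;
  antipoder : forall h : H,
    tlift (fun a b => a * antipode b) (comul h) = counit h *: 1
}.

Record comodule_algebra (C : fieldType) (H : algType C) (hH : hopf_algebra H)
    (P : algType C) := ComoduleAlgebra {
  coact : {lrmorphism P -> P ⊗ H};
  coactA : forall p : P,
    ctens_assoc (ctens_map coact idfun (coact p)) =
    ctens_map idfun (comul hH) (coact p);
  coact1 : forall p : P, tlift (fun q h => counit hH h *: q) (coact p) = p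
}.

Section Extension.
Variables (B P : nzRingType) (iota : {rmorphism B -> P}).

(* P ⊗_B N, for P seen as a right B-module through iota. *)
Definition ext_tens (N : lmodType B) :=
  tens (fun (p : P) (b : B) => p * iota b) (fun (b : B) (n : N) => b *: n).
HB.instance Definition _ (N : lmodType B) := GRing.Zmodule.on (ext_tens N).

Definition ext_tens_map (N N' : lmodType B) (f : {linear N -> N'})
    (x : ext_tens N) : ext_tens N' :=
  tlift (fun p n => tpure _ _ p (f n)) x.

Lemma ext_tens_map_balanced (N N' : lmodType B) (f : {linear N -> N'}) :
  balanced (fun (p : P) (b : B) => p * iota b) (fun (b : B) (n : N) => b *: n)
    (fun p n => tpure _ _ p (f n) : ext_tens N').
Proof.
split=> [n p p'|p n n'|p b n]; first exact: tpureDl.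
  by rewrite linearD; exact: tpureDr.
by rewrite linearZ; exact: tpure_bal.
Qed.

Definition exact_at (U V W : zmodType) (f : U -> V) (g : V -> W) : Prop :=
  forall v, g v = 0 <-> exists u, f u = v.

Definition faithfully_flat : Prop :=
  (forall (N1 N2 N3 : lmodType B)
     (f : {linear N1 -> N2}) (g : {linear N2 -> N3}),
     exact_at f g -> exact_at (ext_tens_map f) (ext_tens_map g)) /\
  (forall (N1 N2 : lmodType B) (f g : {linear N1 -> N2}),
     ext_tens_map f =1 ext_tens_map g -> f =1 g).

(* P ⊗_B P *)
Definition ext_square :=
  tens (fun (p : P) (b : B) => p * iota b) (fun (b : B) (p : P) => iota b * p).
HB.instance Definition _ := GRing.Zmodule.on ext_square.

End Extension.

Section HopfGalois.
Variables (C : fieldType) (H : algType C) (hH : hopf_algebra H) (P : algType C).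
Variable rho : comodule_algebra hH P.

(* p' ⊗_B p |-> p' p_(0) ⊗ p_(1), well defined when iota takes its values in   *)
(* the coinvariants; see canonical_map_balanced.                               *)
Definition canonical_map (B : nzRingType) (iota : {rmorphism B -> P})
    (x : ext_square iota) : P ⊗ H :=
  tlift (fun p' p => ctens_map ( *%R p') idfun (coact rho p)) x.

Lemma canonical_map_balanced (B : nzRingType) (iota : {rmorphism B -> P}) :
  (forall b, coact rho (iota b) = iota b ⊗ 1) ->
  balanced (fun (p : P) (b : B) => p * iota b) (fun (b : B) (p : P) => iota b * p)
    (fun p' p => ctens_map ( *%R p') idfun (coact rho p)).
Proof.
move=> co; have ml (p : P) : linear ( *%R p : P -> P).
  by move=> c x y; rewrite mulrDr scalerAr.
have il : linear (idfun : H -> H) by [].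
have D (p : P) := lin_mapD (ctens_map_linear (ml p) il).
split=> [p q q'|q p p'|q b p]; last 1 first.
- have -> : coact rho (iota b * p) = (iota b ⊗ 1) * coact rho p.
    by rewrite -co; exact: rmorphM.
  elim/ctens_ind: (coact rho p) => [p0 h|x y IHx IHy].
    by rewrite pureM mul1r !(ctens_mapE (ml _) il) mulrA.
  by rewrite mulrDr !D IHx IHy.
- elim/ctens_ind: (coact rho p) => [p0 h|x y IHx IHy].
    by rewrite !(ctens_mapE (ml _) il) mulrDl pureDl.
  by rewrite !D IHx IHy addrACA.
- by rewrite linearD D.
Qed.

Definition hopf_galois (B : nzRingType) (iota : {rmorphism B -> P}) : Prop :=
  [/\ injective iota,
      forall p : P, (exists b, iota b = p) <-> coact rho p = p ⊗ 1 &
      bijective (@canonical_map B iota)].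

Definition convolution (f g : H -> P) (h : H) : P :=
  tlift (fun a b => f a * g b) (comul hH h).

Definition cleft : Prop :=
  exists phi : {linear H -> P},
    [/\ phi 1 = 1,
        exists psi : {linear H -> P}, forall h : H,
          convolution phi psi h = counit hH h *: 1 /\
          convolution psi phi h = counit hH h *: 1 &
        forall h : H, coact rho (phi h) = ctens_map phi idfun (comul hH h)].

End HopfGalois.

(******************************************************************************)
(* *-algebras given by generators and relations: expressions in the           *)
(* generators, modulo the least congruence containing the relations and the   *)
(* axioms of unital *-algebras.                                               *)
(******************************************************************************)

Section Presentation.
Variables (C : numClosedFieldType) (I : Type).

Inductive star_expr :=
  | EGen of I
  | EConst of C
  | EAdd of star_expr & star_expr
  | EMul of star_expr & star_expr
  | EStar of star_expr.

Section Congruence.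
Variable rel : star_expr -> star_expr -> Prop.

Inductive star_cong : star_expr -> star_expr -> Prop :=
  | SC_rel x y : rel x y -> star_cong x y
  | SC_refl x : star_cong x x
  | SC_sym x y : star_cong x y -> star_cong y x
  | SC_trans x y z : star_cong x y -> star_cong y z -> star_cong x z
  | SC_add x x' y y' : star_cong x x' -> star_cong y y' ->
      star_cong (EAdd x y) (EAdd x' y')
  | SC_mul x x' y y' : star_cong x x' -> star_cong y y' ->
      star_cong (EMul x y) (EMul x' y')
  | SC_star x x' : star_cong x x' -> star_cong (EStar x) (EStar x')
  | SC_addA x y z : star_cong (EAdd x (EAdd y z)) (EAdd (EAdd x y) z)
  | SC_addC x y : star_cong (EAdd x y) (EAdd y x)
  | SC_add0 x : star_cong (EAdd (EConst 0) x) x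
  | SC_addN x : star_cong (EAdd (EMul (EConst (-1)) x) x) (EConst 0)
  | SC_mulA x y z : star_cong (EMul x (EMul y z)) (EMul (EMul x y) z)
  | SC_mul1l x : star_cong (EMul (EConst 1) x) x
  | SC_mul1r x : star_cong (EMul x (EConst 1)) x
  | SC_mulDl x y z :
      star_cong (EMul (EAdd x y) z) (EAdd (EMul x z) (EMul y z))
  | SC_mulDr x y z :
      star_cong (EMul x (EAdd y z)) (EAdd (EMul x y) (EMul x z))
  | SC_constD a b : star_cong (EConst (a + b)) (EAdd (EConst a) (EConst b))
  | SC_constM a b : star_cong (EConst (a * b)) (EMul (EConst a) (EConst b))
  | SC_constC a x : star_cong (EMul (EConst a) x) (EMul x (EConst a))
  | SC_starC a : star_cong (EStar (EConst a)) (EConst a^* )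
  | SC_starD x y : star_cong (EStar (EAdd x y)) (EAdd (EStar x) (EStar y))
  | SC_starM x y : star_cong (EStar (EMul x y)) (EMul (EStar y) (EStar x))
  | SC_starK x : star_cong (EStar (EStar x)) x.

End Congruence.

Fixpoint star_eval (A : starAlgType C) (v : I -> A) (x : star_expr) : A :=
  match x with
  | EGen i => v i
  | EConst c => c%:A
  | EAdd x y => star_eval v x + star_eval v y
  | EMul x y => star_eval v x * star_eval v y
  | EStar x => star (star_eval v x)
  end.

Definition satisfies (rel : star_expr -> star_expr -> Prop) (A : starAlgType C)
    (v : I -> A) : Prop :=
  forall x y, rel x y -> star_eval v x = star_eval v y.

Lemma star_evalP rel (A : starAlgType C) (v : I -> A) : satisfies rel v ->
  forall x y, star_cong rel x y -> star_eval v x = star_eval v y.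
Proof.
move=> sv x y; elim=> /=.
- exact: sv.
- by [].
- by [].
- by move=> ? ? ? _ -> _ ->.
- by move=> ? ? ? ? _ -> _ ->.
- by move=> ? ? ? ? _ -> _ ->.
- by move=> ? ? _ ->.
- by move=> *; rewrite addrA.
- by move=> *; rewrite addrC.
- by move=> *; rewrite scale0r add0r.
- by move=> *; rewrite scaleN1r mulN1r addNr scale0r.
- by move=> *; rewrite mulrA.
- by move=> *; rewrite scale1r mul1r.
- by move=> *; rewrite scale1r mulr1.
- by move=> *; rewrite mulrDl.
- by move=> *; rewrite mulrDr.
- by move=> *; rewrite scalerDl.
- by move=> *; rewrite -scalerAl mul1r scalerA.
- by move=> *; rewrite -scalerAl mul1r -scalerAr mulr1.
- by move=> *; rewrite starZ star1.
- by move=> *; rewrite starD.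
- by move=> *; rewrite starM.
- by move=> *; rewrite starK.
Qed.

Record star_presentation := StarPresentation {
  pres_rel :> star_expr -> star_expr -> Prop;
  pres_neq0 : ~ star_cong pres_rel (EConst 1) (EConst 0)
}.

Lemma satisfies_neq0 rel (v : I -> C^o) :
  satisfies rel v -> ~ star_cong rel (EConst 1) (EConst 0).
Proof.
move=> sv /(star_evalP sv) /= /eqP.
by rewrite scale0r scale1r oner_eq0.
Qed.

Variable pr : star_presentation.

HB.instance Definition _ := gen_eqMixin star_expr.
HB.instance Definition _ := gen_choiceMixin star_expr.

Lemma pres_quot_equiv : equiv_class_of (fun x y => `[< star_cong pr x y >]).
Proof.
split=> [x|x y|y x z].
- exact/asboolP/SC_refl.
- by apply/asboolP/asboolP => /SC_sym.
- by move=> /asboolP xy /asboolP yz; apply/asboolP/SC_trans; first exact: xy.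
Qed.

Canonical pres_quot_equiv_rel := EquivRelPack pres_quot_equiv.

Definition pres_quot := {eq_quot pres_quot_equiv_rel}.
HB.instance Definition _ := Choice.on pres_quot.

Let toQ (x : star_expr) : pres_quot := \pi_pres_quot x.

Lemma pres_quot_eqP (x y : star_expr) : star_cong pr x y -> toQ x = toQ y.
Proof. by move=> xy; apply/eqmodP/asboolP. Qed.

Lemma pres_quot_reprP (x : star_expr) : star_cong pr (repr (toQ x)) x.
Proof.
have /eqmodP/asboolP // : \pi_pres_quot (repr (toQ x)) = \pi_pres_quot x.
by rewrite reprK.
Qed.

Lemma toQP (P : pres_quot -> Prop) : (forall x, P (toQ x)) -> forall x, P x.
Proof. by move=> H x; rewrite -[x]reprK; exact: H. Qed.

Definition pres_add (x y : pres_quot) := toQ (EAdd (repr x) (repr y)).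
Definition pres_opp (x : pres_quot) := toQ (EMul (EConst (-1)) (repr x)).
Definition pres_mul (x y : pres_quot) := toQ (EMul (repr x) (repr y)).
Definition pres_scale (c : C) (x : pres_quot) := toQ (EMul (EConst c) (repr x)).
Definition pres_star (x : pres_quot) := toQ (EStar (repr x)).

Let addE x y : pres_add (toQ x) (toQ y) = toQ (EAdd x y).
Proof. by apply/pres_quot_eqP/SC_add; exact: pres_quot_reprP. Qed.
Let mulE x y : pres_mul (toQ x) (toQ y) = toQ (EMul x y).
Proof. by apply/pres_quot_eqP/SC_mul; exact: pres_quot_reprP. Qed.
Let oppE x : pres_opp (toQ x) = toQ (EMul (EConst (-1)) x).
Proof. by apply/pres_quot_eqP/SC_mul; [exact: SC_refl|exact: pres_quot_reprP]. Qed.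
Let scaleE c x : pres_scale c (toQ x) = toQ (EMul (EConst c) x).
Proof. by apply/pres_quot_eqP/SC_mul; [exact: SC_refl|exact: pres_quot_reprP]. Qed.
Let starE x : pres_star (toQ x) = toQ (EStar x).
Proof. by apply/pres_quot_eqP/SC_star; exact: pres_quot_reprP. Qed.

Fact pres_addA : associative pres_add.
Proof.
elim/toQP=> x; elim/toQP=> y; elim/toQP=> z.
rewrite !addE; exact/pres_quot_eqP/SC_addA.
Qed.
Fact pres_addC : commutative pres_add.
Proof. elim/toQP=> x; elim/toQP=> y; rewrite !addE; exact/pres_quot_eqP/SC_addC. Qed.
Fact pres_add0 : left_id (toQ (EConst 0)) pres_add.
Proof. elim/toQP=> x; rewrite !addE; exact/pres_quot_eqP/SC_add0. Qed.
Fact pres_addN : left_inverse (toQ (EConst 0)) pres_opp pres_add.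
Proof. elim/toQP=> x; rewrite oppE addE; exact/pres_quot_eqP/SC_addN. Qed.

HB.instance Definition _ :=
  GRing.isZmodule.Build pres_quot pres_addA pres_addC pres_add0 pres_addN.

Let addE' x y : toQ x + toQ y = toQ (EAdd x y). Proof. exact: addE. Qed.

Fact pres_mulA : associative pres_mul.
Proof.
elim/toQP=> x; elim/toQP=> y; elim/toQP=> z.
rewrite !mulE; exact/pres_quot_eqP/SC_mulA.
Qed.
Fact pres_mul1l : left_id (toQ (EConst 1)) pres_mul.
Proof. elim/toQP=> x; rewrite mulE; exact/pres_quot_eqP/SC_mul1l. Qed.
Fact pres_mul1r : right_id (toQ (EConst 1)) pres_mul.
Proof. elim/toQP=> x; rewrite mulE; exact/pres_quot_eqP/SC_mul1r. Qed.
Fact pres_mulDl : left_distributive pres_mul +%R.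
Proof.
elim/toQP=> x; elim/toQP=> y; elim/toQP=> z.
by rewrite !(addE', mulE); exact/pres_quot_eqP/SC_mulDl.
Qed.
Fact pres_mulDr : right_distributive pres_mul +%R.
Proof.
elim/toQP=> x; elim/toQP=> y; elim/toQP=> z.
by rewrite !(addE', mulE); exact/pres_quot_eqP/SC_mulDr.
Qed.
Fact pres_1neq0 : toQ (EConst 1) != 0.
Proof.
apply/eqP => E; apply: (pres_neq0 (s := pr)).
by have /eqmodP/asboolP : \pi_pres_quot (EConst 1) = \pi_pres_quot (EConst 0).
Qed.

HB.instance Definition _ := GRing.Zmodule_isNzRing.Build pres_quot
  pres_mulA pres_mul1l pres_mul1r pres_mulDl pres_mulDr pres_1neq0.

Let mulE' x y : toQ x * toQ y = toQ (EMul x y). Proof. exact: mulE. Qed.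

Fact pres_scaleA a b x :
  pres_scale a (pres_scale b x) = pres_scale (a * b) x.
Proof.
elim/toQP: x => x; rewrite !scaleE -!mulE' mulrA; congr (_ * _).
by rewrite mulE'; apply/pres_quot_eqP/SC_sym/SC_constM.
Qed.
Fact pres_scale1 : left_id 1 pres_scale.
Proof. by elim/toQP=> x; rewrite scaleE -mulE' [LHS]mul1r. Qed.
Fact pres_scaleDr : right_distributive pres_scale +%R.
Proof.
move=> c; elim/toQP=> x; elim/toQP=> y.
by rewrite addE' !scaleE -!mulE' -addE' mulrDr.
Qed.
Fact pres_scaleDl x : {morph pres_scale^~ x : a b / a + b}.
Proof.
move=> a b; elim/toQP: x => x; rewrite !scaleE -!mulE' -mulrDl; congr (_ * _).
by rewrite addE'; exact/pres_quot_eqP/SC_constD.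
Qed.

HB.instance Definition _ := GRing.Zmodule_isLmodule.Build C pres_quot
  pres_scaleA pres_scale1 pres_scaleDr pres_scaleDl.

Let scaleE' c x : c *: toQ x = toQ (EConst c) * toQ x.
Proof. by rewrite mulE'; exact: scaleE. Qed.

Fact pres_scaleAl c (x y : pres_quot) : c *: (x * y) = (c *: x) * y.
Proof.
by elim/toQP: x => x; elim/toQP: y => y; rewrite mulE' !scaleE' -mulE' mulrA.
Qed.
HB.instance Definition _ :=
  GRing.Lmodule_isLalgebra.Build C pres_quot pres_scaleAl.

Fact pres_scaleAr c (x y : pres_quot) : c *: (x * y) = x * (c *: y).
Proof.
elim/toQP: x => x; elim/toQP: y => y; rewrite mulE' !scaleE' -mulE' !mulrA.
congr (_ * _); rewrite !mulE'; exact/pres_quot_eqP/SC_constC.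
Qed.
HB.instance Definition _ :=
  GRing.Lalgebra_isAlgebra.Build C pres_quot pres_scaleAr.

Fact pres_starD : {morph pres_star : x y / x + y}.
Proof.
elim/toQP=> x; elim/toQP=> y; rewrite addE' !starE addE'.
exact/pres_quot_eqP/SC_starD.
Qed.
Fact pres_starM x y : pres_star (x * y) = pres_star y * pres_star x.
Proof.
elim/toQP: x => x; elim/toQP: y => y; rewrite mulE' !starE mulE'.
exact/pres_quot_eqP/SC_starM.
Qed.
Fact pres_starZ c x : pres_star (c *: x) = c^* *: pres_star x.
Proof.
elim/toQP: x => x; rewrite scaleE' pres_starM !starE scaleE'.
rewrite (pres_quot_eqP (SC_starC _ _)) !mulE'.
exact/pres_quot_eqP/SC_sym/SC_constC.
Qed.
Fact pres_starK : involutive pres_star.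
Proof. elim/toQP=> x; rewrite !starE; exact/pres_quot_eqP/SC_starK. Qed.

HB.instance Definition _ := isStarAlgebra.Build C pres_quot
  pres_starD pres_starZ pres_starM pres_starK.

Let gen' (i : I) : pres_quot := toQ (EGen i).

Let evalE' x : star_eval gen' x = toQ x.
Proof.
elim: x => [i|c|x IHx y IHy|x IHx y IHy|x IHx] //=.
- by rewrite scaleE' mulr1.
- by rewrite IHx IHy addE'.
- by rewrite IHx IHy mulE'.
- by rewrite IHx; exact: starE.
Qed.

Let ind' (P : pres_quot -> Prop) :
  (forall i, P (gen' i)) -> (forall c, P c%:A) ->
  (forall x y, P x -> P y -> P (x + y)) ->
  (forall x y, P x -> P y -> P (x * y)) ->
  (forall x, P x -> P (star x)) -> forall x, P x.
Proof.
move=> Pg Pc PD PM PS; elim/toQP=> x; rewrite -evalE'.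
by elim: x => //= *; [exact: PD|exact: PM|exact: PS].
Qed.

Let lift' (A : starAlgType C) (v : I -> A) (x : pres_quot) : A :=
  star_eval v (repr x).

Section Lift'.
Variables (A : starAlgType C) (v : I -> A).
Hypothesis sv : satisfies pr v.

Let liftE x : lift' v (toQ x) = star_eval v x.
Proof. exact/(star_evalP sv)/pres_quot_reprP. Qed.

Let lift_linear : linear (lift' v).
Proof.
move=> c; elim/toQP=> x; elim/toQP=> y.
by rewrite scaleE' mulE' addE' !liftE /= -scalerAl mul1r.
Qed.

Let lift_monoid : monoid_morphism (lift' v).
Proof.
split=> [|]; first by rewrite liftE /= scale1r.
by elim/toQP=> x; elim/toQP=> y; rewrite mulE' !liftE.
Qed.

Let lift_star x : lift' v (star x) = star (lift' v x).
Proof. by elim/toQP: x => x; rewrite [star _]starE !liftE. Qed.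

Fact pres_quot_lift : [/\ forall i, lift' v (gen' i) = v i, linear (lift' v),
  monoid_morphism (lift' v) & forall x, lift' v (star x) = star (lift' v x)].
Proof.
by split; [move=> i; exact: liftE|exact: lift_linear|exact: lift_monoid|
           exact: lift_star].
Qed.

End Lift'.

(* Bundled, and opaque below, to keep unification from looking inside. *)
Definition presented : starAlgType C := pres_quot.

Definition pres_class (x : star_expr) : presented := toQ x.
Definition pres_gen (i : I) : presented := pres_class (EGen i).

Lemma pres_evalE x : star_eval pres_gen x = pres_class x.
Proof. exact: evalE'. Qed.

Lemma pres_classP (x : presented) : exists y, x = pres_class y.
Proof. by exists (repr (x : pres_quot)); rewrite /pres_class /toQ reprK. Qed.

Lemma pres_satisfies : satisfies pr pres_gen.
Proof. by move=> x y xy; rewrite !pres_evalE; exact/pres_quot_eqP/SC_rel. Qed.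

Lemma presented_ind (P : presented -> Prop) :
  (forall i, P (pres_gen i)) -> (forall c, P c%:A) ->
  (forall x y, P x -> P y -> P (x + y)) ->
  (forall x y, P x -> P y -> P (x * y)) ->
  (forall x, P x -> P (star x)) -> forall x, P x.
Proof. exact: ind'. Qed.

Section Lift.
Variable A : starAlgType C.

(* The *-morphism sending the i-th generator to v i; meaningful when v         *)
(* satisfies the relations.                                                    *)
Definition pres_lift (v : I -> A) (x : presented) : A := lift' v x.

Variable v : I -> A.
Hypothesis sv : satisfies pr v.

Lemma pres_lift_gen i : pres_lift v (pres_gen i) = v i.
Proof. by have [+ _ _ _] := pres_quot_lift sv; exact. Qed.

Lemma pres_lift_linear : linear (pres_lift v).
Proof. by have [_ + _ _] := pres_quot_lift sv; exact. Qed.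

Lemma pres_lift_monoid : monoid_morphism (pres_lift v).
Proof. by have [_ _ + _] := pres_quot_lift sv; exact. Qed.

Lemma pres_lift_star x : pres_lift v (star x) = star (pres_lift v x).
Proof. by have [_ _ _ +] := pres_quot_lift sv; exact. Qed.

End Lift.

Lemma presented_ext (A : algType C) (f g : presented -> A) :
  linear f -> linear g -> monoid_morphism f -> monoid_morphism g ->
  (forall i, f (pres_gen i) = g (pres_gen i)) ->
  (forall i, f (star (pres_gen i)) = g (star (pres_gen i))) -> f =1 g.
Proof.
move=> fl gl [f1 fM] [g1 gM] fg fgs x.
suff [] : f x = g x /\ f (star x) = g (star x) by [].
elim/presented_ind: x => [i|c|x y [Ex Esx] [Ey Esy]|x y [Ex Esx] [Ey Esy]|x [Ex Esx]].
- by split.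
- by rewrite starZ star1 !lin_mapZ // f1 g1.
- by rewrite starD !lin_mapD // Ex Ey Esx Esy.
- by rewrite starM !fM !gM Ex Ey Esx Esy.
- by rewrite starK.
Qed.

End Presentation.

#[global] Opaque presented.

Section PureSums.
Variables (C : fieldType) (M N : lmodType C).

Lemma pure_suml (J : finType) (F : J -> M) (n : N) :
  (\sum_j F j) ⊗ n = \sum_j F j ⊗ n.
Proof.
by apply: (big_morph (fun m => m ⊗ n)) => [m m'|]; [exact: pureDl|exact: pure0l].
Qed.

Lemma pure_sumr (J : finType) (m : M) (F : J -> N) :
  m ⊗ (\sum_j F j) = \sum_j m ⊗ F j.
Proof.
by apply: (big_morph (fun n => m ⊗ n)) => [n n'|]; [exact: pureDr|exact: pure0r].
Qed.

Lemma lin_map_sum (V : lmodType C) (f : M -> V) (J : finType) (F : J -> M) :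
  linear f -> f (\sum_j F j) = \sum_j f (F j).
Proof. by move=> fl; apply: big_morph; [exact: lin_mapD|exact: lin_map0]. Qed.

End PureSums.

Lemma star_sum (C : numClosedFieldType) (A : starAlgType C) (J : finType)
  (F : J -> A) : star (\sum_j F j) = \sum_j star (F j).
Proof. by apply: big_morph; [exact: starD|exact: star0]. Qed.

(******************************************************************************)
(* The Hopf algebra A(SU(2)).                                                 *)
(******************************************************************************)

Section SU2.
Variable C : numClosedFieldType.

Variant SU2_rel : star_expr C 'I_2 -> star_expr C 'I_2 -> Prop :=
  | SU2_comm x y : SU2_rel (EMul x y) (EMul y x)
  | SU2_unit :
      SU2_rel (EAdd (EMul (EGen _ 0) (EStar (EGen _ 0)))
                    (EMul (EGen _ 1) (EStar (EGen _ 1))))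
              (EConst _ 1).

Lemma SU2_satisfies (A : starAlgType C) (v : 'I_2 -> A) :
  commutative (@GRing.mul A) -> \sum_b v b * star (v b) = 1 ->
  satisfies SU2_rel v.
Proof.
move=> cA v1 _ _ [x y|] /=; first exact: cA.
by rewrite scale1r -v1 big_ord_recl big_ord1; congr (_ + v _ * star (v _)); apply/val_inj.
Qed.

Fact SU2_neq0 : ~ star_cong SU2_rel (EConst _ 1) (EConst _ 0).
Proof.
apply: (@satisfies_neq0 _ _ _ (fun b => (b == 0)%:R)).
apply: SU2_satisfies; first by move=> x y; exact: mulrC.
rewrite big_ord_recl big_ord1 /= mul1r mul0r addr0; exact: rmorph1.
Qed.

Definition SU2_pres := StarPresentation SU2_neq0.
Definition SU2 : starAlgType C := presented SU2_pres.

(* w 0 and w 1 are the generators w^1 and w^2. *)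
Definition w (b : 'I_2) : SU2 := pres_gen _ b.

Definition SU2_mx : 'M[SU2]_2 := \matrix_(a, b)
  if a == 0 then w b else if b == 0 then - star (w 1) else star (w 0).
Local Notation U := SU2_mx.

Lemma SU2_mulC : commutative (@GRing.mul SU2).
Proof.
move=> x y; have [a ->] := pres_classP x; have [b ->] := pres_classP y.
by have := @pres_satisfies _ _ SU2_pres _ _ (SU2_comm a b); rewrite /= !pres_evalE.
Qed.

Lemma SU2_sum : \sum_b w b * star (w b) = 1.
Proof.
have /= := @pres_satisfies _ _ SU2_pres _ _ SU2_unit.
rewrite scale1r => <-; rewrite big_ord_recl big_ord1.
by congr (_ + w _ * star (w _)); apply/val_inj.
Qed.

Lemma U0 b : U 0 b = w b. Proof. by rewrite mxE. Qed.
Lemma U10 : U 1 0 = - star (w 1). Proof. by rewrite mxE. Qed.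
Lemma U11 : U 1 1 = star (w 0). Proof. by rewrite mxE. Qed.

Lemma ord2P (P : 'I_2 -> Prop) : P 0 -> P 1 -> forall a, P a.
Proof.
move=> P0 P1 [[|[|a]] // i].
  by have -> : Ordinal i = 0 by apply/val_inj.
by have -> : Ordinal i = 1 by apply/val_inj.
Qed.

Lemma sum2 (V : zmodType) (F : 'I_2 -> V) : \sum_b F b = F 0 + F 1.
Proof.
by rewrite big_ord_recl big_ord1; congr (_ + F _); apply/val_inj.
Qed.

Lemma SU2_mx_unitary a d : \sum_b U a b * star (U d b) = (a == d)%:R.
Proof.
have E := SU2_sum; move: E; rewrite !sum2 => E.
elim/ord2P: a; elim/ord2P: d; rewrite ?U0 ?U10 ?U11 ?starN ?starK //=.
- by rewrite mulrN (SU2_mulC (w 1)) addNr.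
- by rewrite mulNr SU2_mulC addNr.
- by rewrite mulrNN -E addrC SU2_mulC [X in _ + X]SU2_mulC.
Qed.

Let comul_gen (b : 'I_2) : (SU2 ⊗ SU2)%type := \sum_c U 0 c ⊗ U c b.

Definition SU2_comul : SU2 -> SU2 ⊗ SU2 := pres_lift comul_gen.

Let comul_sat : satisfies SU2_pres comul_gen.
Proof.
apply: SU2_satisfies; first by apply: ctens_mulC; exact: SU2_mulC.
under eq_bigr => b _.
  rewrite star_sum mulr_suml; under eq_bigr => c _.
    by rewrite mulr_sumr; under eq_bigr => d _ do rewrite pure_star pureM; over.
  over.
rewrite exchange_big /=; under eq_bigr => c _.
  rewrite exchange_big /=; under eq_bigr => d _.
    by rewrite -pure_sumr SU2_mx_unitary; over.
  rewrite (bigD1 c) //= eqxx big1 ?addr0; last first.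
    by move=> d; rewrite eq_sym => /negPf ->; exact: pure0r.
  over.
by rewrite -pure_suml SU2_mx_unitary.
Qed.

HB.instance Definition _ := GRing.isLinear.Build C SU2 (SU2 ⊗ SU2)%type _
  SU2_comul (pres_lift_linear comul_sat).
HB.instance Definition _ := GRing.isMonoidMorphism.Build SU2 (SU2 ⊗ SU2)%type
  SU2_comul (pres_lift_monoid comul_sat).

Lemma SU2_comul_linear : linear SU2_comul.
Proof. exact: (pres_lift_linear comul_sat). Qed.
Lemma SU2_comul_monoid : monoid_morphism SU2_comul.
Proof. exact: (pres_lift_monoid comul_sat). Qed.

Lemma SU2_comul_star h : SU2_comul (star h) = star (SU2_comul h).
Proof. exact: (pres_lift_star comul_sat). Qed.

Lemma SU2_comulE a b : SU2_comul (U a b) = \sum_c U a c ⊗ U c b.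
Proof.
have E b' : SU2_comul (w b') = \sum_c U 0 c ⊗ U c b'.
  exact: (pres_lift_gen comul_sat).
elim/ord2P: a; first by rewrite U0 E.
elim/ord2P: b; rewrite ?U10 ?U11 ?linearN /= SU2_comul_star E !sum2 starD.
  rewrite !pure_star !U0 !U11 U10 starK opprD addrC.
  by rewrite pureNl pureNr.
rewrite !pure_star !U0 !U10 !U11 starN starK addrC pureNl pureNr.
by [].
Qed.

Definition SU2_counit : SU2 -> C^o := pres_lift (fun b => (b == 0)%:R : C^o).

Let counit_sat :
  satisfies SU2_pres (fun b => (b == 0)%:R : C^o).
Proof.
apply: SU2_satisfies; first by move=> x y; exact: mulrC.
rewrite sum2 /= mul1r mul0r addr0; exact: rmorph1.
Qed.

HB.instance Definition _ := GRing.isLinear.Build C SU2 C^o _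
  SU2_counit (pres_lift_linear counit_sat).
HB.instance Definition _ := GRing.isMonoidMorphism.Build SU2 C^o
  SU2_counit (pres_lift_monoid counit_sat).

Lemma SU2_counit_star h : SU2_counit (star h) = (SU2_counit h)^*.
Proof. exact: (pres_lift_star counit_sat). Qed.

Lemma SU2_counitE a b : SU2_counit (U a b) = (a == b)%:R.
Proof.
have E b' : SU2_counit (w b') = (b' == 0)%:R.
  exact: (pres_lift_gen counit_sat).
elim/ord2P: a; first by rewrite U0 E eq_sym.
elim/ord2P: b; rewrite ?U10 ?U11 ?linearN /= SU2_counit_star E ?rmorph0 ?oppr0 //.
exact: rmorph1.
Qed.

Definition SU2_antipode : SU2 -> SU2 :=
  pres_lift (fun b => if b == 0 then star (w 0) else - w 1).

Let antipode_sat : satisfies SU2_pres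
  (fun b => if b == 0 then star (w 0) else - w 1).
Proof.
apply: SU2_satisfies; first exact: SU2_mulC.
by rewrite sum2 /= starK starN mulrNN SU2_mulC -SU2_sum sum2.
Qed.

HB.instance Definition _ := GRing.isLinear.Build C SU2 SU2 _
  SU2_antipode (pres_lift_linear antipode_sat).
HB.instance Definition _ := GRing.isMonoidMorphism.Build SU2 SU2
  SU2_antipode (pres_lift_monoid antipode_sat).

Lemma SU2_antipode_star h : SU2_antipode (star h) = star (SU2_antipode h).
Proof. exact: (pres_lift_star antipode_sat). Qed.

Lemma SU2_antipodeE a b : SU2_antipode (U a b) = star (U b a).
Proof.
have E b' : SU2_antipode (w b') = if b' == 0 then star (w 0) else - w 1.
  exact: (pres_lift_gen antipode_sat).
elim/ord2P: a; elim/ord2P: b; rewrite ?(U0, U10, U11) ?linearN /=.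
- by rewrite E.
- by rewrite E starN starK.
- by rewrite SU2_antipode_star E /= starN opprK.
- by rewrite SU2_antipode_star E.
Qed.

(* A linear multiplicative map out of A(SU(2)) is determined by the matrix. *)
Lemma SU2_ext (A : algType C) (f g : SU2 -> A) :
  linear f -> linear g -> monoid_morphism f -> monoid_morphism g ->
  (forall a b, f (U a b) = g (U a b)) -> f =1 g.
Proof.
move=> fl gl fm gm fg; apply: presented_ext => // b.
  by rewrite -[pres_gen _ b]/(w b) -U0.
rewrite -[pres_gen _ b]/(w b); elim/ord2P: b; rewrite -?U11 //.
by rewrite -[star _]opprK -U10 -scaleN1r !lin_mapZ // fg.
Qed.

Lemma SU2_comulA h :
  ctens_assoc (ctens_map SU2_comul idfun (SU2_comul h)) =
  ctens_map idfun SU2_comul (SU2_comul h).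
Proof.
have cl := SU2_comul_linear; have cm := SU2_comul_monoid.
have il := @lrmorph_linear C SU2 SU2 idfun.
have im := @lrmorph_monoid C SU2 SU2 idfun.
have ml := ctens_map_linear cl il; have mr := ctens_map_linear il cl.
have al := @ctens_assoc_linear C SU2 SU2 SU2.
apply: (SU2_ext (f := @ctens_assoc _ _ _ _ \o (ctens_map SU2_comul idfun \o SU2_comul))
                (g := ctens_map idfun SU2_comul \o SU2_comul)).
- by do 2![apply: comp_linear => //].
- exact: comp_linear.
- apply: comp_monoid; first exact: ctens_assoc_monoid.
  by apply: comp_monoid => //; exact: ctens_map_monoid.
- by apply: comp_monoid => //; exact: ctens_map_monoid.
move=> a b /=; rewrite SU2_comulE !lin_map_sum //.
under eq_bigr => c _ do
  rewrite ctens_mapE // SU2_comulE pure_suml lin_map_sum //.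
under [RHS]eq_bigr => c _ do rewrite ctens_mapE // SU2_comulE pure_sumr.
rewrite exchange_big; apply: eq_bigr => c _; apply: eq_bigr => d _.
by rewrite ctens_assocE.
Qed.

Lemma counit_bilinl (P : algType C) :
  bilin (fun (p : P) (h : SU2) => SU2_counit h *: p).
Proof.
split=> [h c p q|p c h k] /=; first by rewrite scalerDr !scalerA mulrC.
by rewrite linearP scalerDl scalerA.
Qed.

Lemma counit_monoidl (P : algType C) :
  monoid_morphism (tlift (fun p h => SU2_counit h *: p) : P ⊗ SU2 -> P).
Proof.
apply: tlift_monoid; first exact: counit_bilinl.
  by rewrite rmorph1 scale1r.
by move=> p q h k; rewrite rmorphM -scalerAl -scalerAr scalerA.
Qed.

Lemma counit_bilinr : bilin (fun a b : SU2 => SU2_counit a *: b).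
Proof.
split=> [h c p q|p c h k] /=; first by rewrite linearP scalerDl scalerA.
by rewrite scalerDr !scalerA mulrC.
Qed.

Lemma counit_monoidr :
  monoid_morphism (tlift (fun a b => SU2_counit a *: b) : SU2 ⊗ SU2 -> SU2).
Proof.
apply: tlift_monoid; first exact: counit_bilinr.
  by rewrite rmorph1 scale1r.
by move=> p q h k; rewrite rmorphM -scalerAl -scalerAr scalerA.
Qed.

Lemma SU2_comul1l h : tlift (fun a b => SU2_counit a *: b) (SU2_comul h) = h.
Proof.
have cl := SU2_comul_linear; have cm := SU2_comul_monoid.
have tl := ctlift_linear counit_bilinr.
apply: (SU2_ext (f := tlift _ \o SU2_comul) (g := idfun)) => //.
- exact: comp_linear.
- exact: comp_monoid counit_monoidr cm.
move=> a b /=; rewrite SU2_comulE (@lin_map_sum _ _ _ _ _ _ tl).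
under eq_bigr => c _ do rewrite (ctliftE counit_bilinr) SU2_counitE.
rewrite (bigD1 a) //= eqxx scale1r big1 ?addr0 // => c.
by rewrite eq_sym => /negPf ->; rewrite scale0r.
Qed.

Lemma SU2_comul1r h : tlift (fun a b => SU2_counit b *: a) (SU2_comul h) = h.
Proof.
have cl := SU2_comul_linear; have cm := SU2_comul_monoid.
have tl := ctlift_linear (counit_bilinl SU2).
apply: (SU2_ext (f := tlift _ \o SU2_comul) (g := idfun)) => //.
- exact: comp_linear.
- exact: comp_monoid (counit_monoidl SU2) cm.
move=> a b /=; rewrite SU2_comulE (@lin_map_sum _ _ _ _ _ _ tl).
under eq_bigr => c _ do rewrite (ctliftE (counit_bilinl SU2)) SU2_counitE.
rewrite (bigD1 b) //= eqxx scale1r big1 ?addr0 // => c.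
by move=> /negPf ->; rewrite scale0r.
Qed.

Let unit_linear : linear (fun h => SU2_counit h *: (1 : SU2)).
Proof. by move=> c x y; rewrite linearP scalerDl scalerA. Qed.

Let unit_monoid : monoid_morphism (fun h => SU2_counit h *: (1 : SU2)).
Proof.
split=> [|x y]; first by rewrite rmorph1 scale1r.
by rewrite rmorphM -scalerAl mul1r scalerA.
Qed.

Lemma SU2_mulACA (a b c d : SU2) : (a * b) * (c * d) = (a * c) * (b * d).
Proof. by rewrite -!mulrA (mulrA b) (SU2_mulC b) -mulrA. Qed.

Lemma SU2_antipodel h :
  tlift (fun a b => SU2_antipode a * b) (SU2_comul h) = SU2_counit h *: 1.
Proof.
have cl := SU2_comul_linear; have cm := SU2_comul_monoid.
have bS : bilin (fun a b => SU2_antipode a * b).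
  split=> [x c y z|x c y z] /=; first by rewrite linearP mulrDl -scalerAl.
  by rewrite mulrDr -scalerAr.
have tl := ctlift_linear bS.
apply: (SU2_ext (f := tlift _ \o SU2_comul) (g := fun h => SU2_counit h *: 1)) => //.
- exact: comp_linear.
- apply: comp_monoid cm; apply: tlift_monoid => //.
    by rewrite rmorph1 mulr1.
  by move=> *; rewrite rmorphM SU2_mulACA.
move=> a b /=; rewrite SU2_comulE (@lin_map_sum _ _ _ _ _ _ tl).
under eq_bigr => c _ do rewrite (ctliftE bS) SU2_antipodeE.
rewrite SU2_counitE sum2; have := SU2_sum; rewrite sum2 => E.
elim/ord2P: a; elim/ord2P: b; rewrite ?(U0, U10, U11) ?(starN, starK) /= ?scale1r ?scale0r.
- by rewrite mulrNN SU2_mulC E.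
- by rewrite mulNr (SU2_mulC (w 1)) addrN.
- by rewrite mulrN SU2_mulC addrN.
- by rewrite addrC -E SU2_mulC [X in _ + X]SU2_mulC.
Qed.

Lemma SU2_antipoder h :
  tlift (fun a b => a * SU2_antipode b) (SU2_comul h) = SU2_counit h *: 1.
Proof.
have cl := SU2_comul_linear; have cm := SU2_comul_monoid.
have bS : bilin (fun a b => a * SU2_antipode b).
  split=> [x c y z|x c y z] /=; first by rewrite mulrDl -scalerAl.
  by rewrite linearP mulrDr -scalerAr.
have tl := ctlift_linear bS.
apply: (SU2_ext (f := tlift _ \o SU2_comul) (g := fun h => SU2_counit h *: 1)) => //.
- exact: comp_linear.
- apply: comp_monoid cm; apply: tlift_monoid => //.
    by rewrite rmorph1 mulr1.
  by move=> *; rewrite rmorphM SU2_mulACA.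
move=> a b /=; rewrite SU2_comulE (@lin_map_sum _ _ _ _ _ _ tl).
under eq_bigr => c _ do rewrite (ctliftE bS) SU2_antipodeE.
rewrite SU2_counitE SU2_mx_unitary.
by case: (a == b); rewrite ?scale1r ?scale0r.
Qed.

Definition SU2_hopf : hopf_algebra SU2 :=
  HopfAlgebra SU2_comulA SU2_comul1l SU2_comul1r SU2_antipodel SU2_antipoder.

End SU2.

(******************************************************************************)
(* The spheres A(S^7_theta') and A(S^4_theta), with mu for e^(pi i theta).    *)
(******************************************************************************)

Inductive star_subalg (C : numClosedFieldType) (A : starAlgType C)
    (X : A -> Prop) : A -> Prop :=
  | SS_gen a : X a -> star_subalg X a
  | SS_one : star_subalg X 1
  | SS_lin c a b : star_subalg X a -> star_subalg X b ->
      star_subalg X (c *: a + b)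
  | SS_mul a b : star_subalg X a -> star_subalg X b -> star_subalg X (a * b)
  | SS_star a : star_subalg X a -> star_subalg X (star a).

Section S7.
Variables (C : numClosedFieldType) (mu : C).

(* Indices are counted from 0. *)
Definition lambda' (i j : 'I_4) : C :=
  if (i < 2)%N == (j < 2)%N then 1 else if (i < 2)%N then mu else mu^*.

Variant S7_rel : star_expr C 'I_4 -> star_expr C 'I_4 -> Prop :=
  | S7_zz i j :
      S7_rel (EMul (EGen _ i) (EGen _ j))
             (EMul (EConst _ (lambda' i j)) (EMul (EGen _ j) (EGen _ i)))
  | S7_bz i j :
      S7_rel (EMul (EStar (EGen _ i)) (EGen _ j))
             (EMul (EConst _ (lambda' j i)) (EMul (EGen _ j) (EStar (EGen _ i))))
  | S7_bb i j :
      S7_rel (EMul (EStar (EGen _ i)) (EStar (EGen _ j)))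
             (EMul (EConst _ (lambda' i j))
                   (EMul (EStar (EGen _ j)) (EStar (EGen _ i))))
  | S7_unit :
      S7_rel (\big[@EAdd C _/EConst _ 0]_(i < 4)
                EMul (EGen _ i) (EStar (EGen _ i)))
             (EConst _ 1).

Lemma S7_satisfies (A : starAlgType C) (v : 'I_4 -> A) :
  (forall i j, v i * v j = lambda' i j *: (v j * v i)) ->
  (forall i j, star (v i) * v j = lambda' j i *: (v j * star (v i))) ->
  (forall i j, star (v i) * star (v j) = lambda' i j *: (star (v j) * star (v i))) ->
  \sum_i v i * star (v i) = 1 -> satisfies S7_rel v.
Proof.
move=> zz bz bb v1 _ _ [i j|i j|i j|] /=; rewrite ?mulr_algl //.
rewrite scale1r -v1; apply: (big_morph (star_eval v)) => //=.
exact: scale0r.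
Qed.

Fact S7_neq0 : ~ star_cong S7_rel (EConst _ 1) (EConst _ 0).
Proof.
pose v (i : 'I_4) : C^o := (i == 0)%:R.
have vs i : star (v i) = v i.
  by rewrite /v; case: (i == 0); [exact: rmorph1|exact: rmorph0].
have v0 i j : i != j -> v i * v j = 0.
  rewrite /v; have [->|_ _] := eqVneq i 0; last by rewrite mul0r.
  by rewrite eq_sym => /negPf ->; rewrite mulr0.
have vv i j c : (i = j -> c = 1) -> v i * v j = c *: (v j * v i).
  have [-> -> //|nij _] := eqVneq i j; first by rewrite scale1r.
  by rewrite !v0 ?scaler0 // eq_sym.
have l1 i j : i = j -> lambda' i j = 1 by move=> ->; rewrite /lambda' eqxx.
apply: (@satisfies_neq0 _ _ _ v).
apply: S7_satisfies => [i j|i j|i j|]; rewrite ?vs; try by apply: vv => // /esym; exact: l1.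
- by apply: vv; exact: l1.
- by apply: vv; exact: l1.
rewrite (bigD1 0) //= big1 => [|i /negPf i0].
  by rewrite vs /v eqxx mulr1 addr0.
by rewrite vs /v i0 mul0r.
Qed.

Definition S7_pres := StarPresentation S7_neq0.
Definition S7 : starAlgType C := presented S7_pres.

(* z 0, ..., z 3 are the generators z^1, ..., z^4. *)
Definition z (i : 'I_4) : S7 := pres_gen _ i.

Lemma z_zz i j : z i * z j = lambda' i j *: (z j * z i).
Proof.
by have := @pres_satisfies _ _ S7_pres _ _ (S7_zz i j); rewrite /= mulr_algl.
Qed.
Lemma z_bz i j : star (z i) * z j = lambda' j i *: (z j * star (z i)).
Proof.
by have := @pres_satisfies _ _ S7_pres _ _ (S7_bz i j); rewrite /= mulr_algl.
Qed.
Lemma z_bb i j :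
  star (z i) * star (z j) = lambda' i j *: (star (z j) * star (z i)).
Proof.
by have := @pres_satisfies _ _ S7_pres _ _ (S7_bb i j); rewrite /= mulr_algl.
Qed.
Lemma z_sum : \sum_i z i * star (z i) = 1.
Proof.
have := @pres_satisfies _ _ S7_pres _ _ S7_unit; rewrite /= scale1r => <-.
symmetry; apply: (big_morph (star_eval _)) => //=; exact: scale0r.
Qed.

Local Notation SU2 := (SU2 C).
Local Notation U := (SU2_mx C).

Definition SU2_block : 'M[SU2]_4 := block_mx U 0 0 U : 'M_(2 + 2).
Local Notation V := SU2_block.

Let Vul (a b : 'I_2) : V (lshift 2 a) (lshift 2 b) = U a b.
Proof. exact: (@block_mxEul _ 2 2 2 2). Qed.
Let Vur (a b : 'I_2) : V (lshift 2 a) (rshift 2 b) = 0.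
Proof. by rewrite [LHS](@block_mxEur _ 2 2 2 2) mxE. Qed.
Let Vdl (a b : 'I_2) : V (rshift 2 a) (lshift 2 b) = 0.
Proof. by rewrite [LHS](@block_mxEdl _ 2 2 2 2) mxE. Qed.
Let Vdr (a b : 'I_2) : V (rshift 2 a) (rshift 2 b) = U a b.
Proof. exact: (@block_mxEdr _ 2 2 2 2). Qed.
Let VE := (Vul, Vur, Vdl, Vdr).
Let Ell (a b : 'I_2) : (lshift 2 a == lshift 2 b :> 'I_4) = (a == b).
Proof. exact: (@eq_lshift 2 2). Qed.
Let Elr (a b : 'I_2) : (lshift 2 a == rshift 2 b :> 'I_4) = false.
Proof. exact: (@eq_lrshift 2 2). Qed.
Let Erl (a b : 'I_2) : (rshift 2 a == lshift 2 b :> 'I_4) = false.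
Proof. exact: (@eq_rlshift 2 2). Qed.
Let Err (a b : 'I_2) : (rshift 2 a == rshift 2 b :> 'I_4) = (a == b).
Proof. exact: (@eq_rshift 2 2). Qed.

Lemma SU2_block0 (i j : 'I_4) : (i < 2)%N != (j < 2)%N -> V i j = 0.
Proof.
by case: (@split_ordP 2 2 i) => a ->; case: (@split_ordP 2 2 j) => b -> //; rewrite VE.
Qed.

Lemma SU2_block_unitary i l : \sum_j V i j * star (V l j) = (i == l)%:R.
Proof.
rewrite (@big_split_ord _ _ _ 2 2) /=.
case: (@split_ordP 2 2 i) => a ->; case: (@split_ordP 2 2 l) => b ->.
all: under eq_bigr do rewrite !VE.
all: under [X in _ + X]eq_bigr do rewrite !VE.
- rewrite SU2_mx_unitary big1 ?addr0 ?Ell // => j _.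
  by rewrite mul0r.
- by rewrite Elr !big1 ?addr0 // => j _; rewrite ?star0 ?mul0r ?mulr0.
- by rewrite Erl !big1 ?addr0 // => j _; rewrite ?star0 ?mul0r ?mulr0.
- rewrite SU2_mx_unitary big1 ?add0r ?Err // => j _.
  by rewrite mul0r.
Qed.

Lemma SU2_block_comul i j : SU2_comul (V i j) = \sum_k V i k ⊗ V k j.
Proof.
rewrite (@big_split_ord _ _ _ 2 2) /=.
case: (@split_ordP 2 2 i) => a ->; case: (@split_ordP 2 2 j) => b ->.
all: under eq_bigr do rewrite !VE.
all: under [X in _ + X]eq_bigr do rewrite !VE.
all: rewrite VE.
- by rewrite SU2_comulE [X in _ + X]big1 ?addr0 // => k _; exact: pure0l.
- by rewrite raddf0 !big1 ?addr0 // => k _; [exact: pure0l|exact: pure0r].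
- by rewrite raddf0 !big1 ?addr0 // => k _; [exact: pure0r|exact: pure0l].
- by rewrite SU2_comulE [X in X + _]big1 ?add0r // => k _; exact: pure0l.
Qed.

Lemma SU2_block_counit i j : SU2_counit (V i j) = (i == j)%:R.
Proof.
case: (@split_ordP 2 2 i) => a ->; case: (@split_ordP 2 2 j) => b ->.
all: rewrite VE.
- by rewrite SU2_counitE Ell.
- by rewrite raddf0 Elr.
- by rewrite raddf0 Erl.
- by rewrite SU2_counitE Err.
Qed.

Let coact_gen (j : 'I_4) : (S7 ⊗ SU2)%type := \sum_i z i ⊗ V i j.

(* The *-morphism with (z 0, ..., z 3) |-> (z 0, ..., z 3) ⊗ V. *)
Definition S7_coact : S7 -> S7 ⊗ SU2 := pres_lift coact_gen.

Let mul_sums (A : nzRingType) (F G : 'I_4 -> A) :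
  (\sum_k F k) * (\sum_l G l) = \sum_k \sum_l F k * G l.
Proof. by rewrite mulr_suml; apply: eq_bigr => k _; rewrite mulr_sumr. Qed.

Lemma coact_comm (x y : 'I_4 -> S7) (s t : SU2 -> SU2) (m : 'I_4 -> 'I_4 -> C) :
  s 0 = 0 -> t 0 = 0 ->
  (forall i j, x i * y j = m i j *: (y j * x i)) ->
  (forall i j k l : 'I_4, (i < 2)%N = (k < 2)%N -> (j < 2)%N = (l < 2)%N ->
     m i j = m k l) ->
  forall i j, (\sum_k x k ⊗ s (V k i)) * (\sum_l y l ⊗ t (V l j)) =
    m i j *: ((\sum_l y l ⊗ t (V l j)) * (\sum_k x k ⊗ s (V k i))).
Proof.
move=> s0 t0 xy mE i j; rewrite !mul_sums exchange_big scaler_sumr.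
apply: eq_bigr => l _; rewrite scaler_sumr; apply: eq_bigr => k _.
rewrite !pureM -pureZl xy.
have [ki|ki] := boolP ((k < 2)%N == (i < 2)%N); last first.
  by rewrite (SU2_block0 ki) s0 mul0r mulr0 !pure0r.
have [lj|lj] := boolP ((l < 2)%N == (j < 2)%N); last first.
  by rewrite (SU2_block0 lj) t0 mul0r mulr0 !pure0r.
by rewrite (mE _ _ _ _ (eqP ki) (eqP lj)) (SU2_mulC (s _)).
Qed.

Let coact_sat : satisfies S7_pres coact_gen.
Proof.
have L (i j k l : 'I_4) : (i < 2)%N = (k < 2)%N -> (j < 2)%N = (l < 2)%N ->
  lambda' i j = lambda' k l by rewrite /lambda' => -> ->.
have gs j : star (coact_gen j) = \sum_i star (z i) ⊗ star (V i j).
  by rewrite star_sum; apply: eq_bigr => i _; exact: pure_star.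
apply: S7_satisfies => [i j|i j|i j|]; rewrite ?gs.
- by apply: (coact_comm (s := id) (t := id)) => //; exact: z_zz.
- apply: (coact_comm (s := star) (t := id) (m := fun i j => lambda' j i)) => //.
  + exact: star0.
  + exact: z_bz.
  + by move=> *; exact: L.
- by apply: (coact_comm (s := star) (t := star)) => //;
    [exact: star0|exact: star0|exact: z_bb].
under eq_bigr => j _.
  rewrite gs mulr_suml; under eq_bigr => k _.
    by rewrite mulr_sumr; under eq_bigr => l _ do rewrite pureM; over.
  over.
rewrite exchange_big /= -pure1 -z_sum pure_suml; apply: eq_bigr => k _.
rewrite exchange_big /=; under eq_bigr => l _.
  by rewrite -pure_sumr SU2_block_unitary; over.
rewrite (bigD1 k) //= eqxx big1 ?addr0 // => l.
by rewrite eq_sym => /negPf ->; exact: pure0r.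
Qed.

HB.instance Definition _ := GRing.isLinear.Build C S7 (S7 ⊗ SU2)%type _
  S7_coact (pres_lift_linear coact_sat).
HB.instance Definition _ := GRing.isMonoidMorphism.Build S7 (S7 ⊗ SU2)%type
  S7_coact (pres_lift_monoid coact_sat).

Lemma S7_coact_star p : S7_coact (star p) = star (S7_coact p).
Proof. exact: (pres_lift_star coact_sat). Qed.

Lemma S7_coactE j : S7_coact (z j) = \sum_i z i ⊗ V i j.
Proof. exact: (pres_lift_gen coact_sat). Qed.

Lemma S7_coact_starE j : S7_coact (star (z j)) = \sum_i star (z i) ⊗ star (V i j).
Proof.
rewrite S7_coact_star S7_coactE star_sum.
by apply: eq_bigr => i _; exact: pure_star.
Qed.

Lemma S7_coactA p :
  ctens_assoc (ctens_map S7_coact idfun (S7_coact p)) =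
  ctens_map idfun (comul (SU2_hopf C)) (S7_coact p).
Proof.
rewrite [comul _]/=.
have cl := lrmorph_linear S7_coact; have cm := lrmorph_monoid S7_coact.
have dl := @SU2_comul_linear C; have dm := @SU2_comul_monoid C.
have il := @lrmorph_linear C SU2 SU2 idfun.
have im := @lrmorph_monoid C SU2 SU2 idfun.
have jl := @lrmorph_linear C S7 S7 idfun.
have jm := @lrmorph_monoid C S7 S7 idfun.
have ml := ctens_map_linear cl il; have mr := ctens_map_linear jl dl.
have al := @ctens_assoc_linear C S7 SU2 SU2.
apply: (presented_ext
  (f := @ctens_assoc _ _ _ _ \o (ctens_map S7_coact idfun \o S7_coact))
  (g := ctens_map idfun (@SU2_comul C) \o S7_coact)).
- by do 2![apply: comp_linear => //].
- exact: comp_linear.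
- apply: comp_monoid; first exact: ctens_assoc_monoid.
  by apply: comp_monoid => //; exact: ctens_map_monoid.
- by apply: comp_monoid => //; exact: ctens_map_monoid.
- move=> j; rewrite -[pres_gen _ j]/(z j) /= S7_coactE !lin_map_sum //.
  under eq_bigr => i _ do
    rewrite ctens_mapE // S7_coactE pure_suml lin_map_sum //.
  under [RHS]eq_bigr => i _ do rewrite ctens_mapE // SU2_block_comul pure_sumr.
  rewrite exchange_big; apply: eq_bigr => i _; apply: eq_bigr => k _.
  by rewrite ctens_assocE.
- move=> j; rewrite -[pres_gen _ j]/(z j) /= S7_coact_starE !lin_map_sum //.
  under eq_bigr => i _ do
    rewrite ctens_mapE // S7_coact_starE pure_suml lin_map_sum //.
  under [RHS]eq_bigr => i _.
    rewrite ctens_mapE // SU2_comul_star SU2_block_comul star_sum pure_sumr.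
    under eq_bigr => k _ do rewrite pure_star.
    over.
  rewrite exchange_big; apply: eq_bigr => i _; apply: eq_bigr => k _.
  by rewrite ctens_assocE.
Qed.

Lemma S7_coact1 p :
  tlift (fun q h => counit (SU2_hopf C) h *: q) (S7_coact p) = p.
Proof.
have cl := lrmorph_linear S7_coact; have cm := lrmorph_monoid S7_coact.
have tl := ctlift_linear (counit_bilinl S7).
apply: (presented_ext (f := tlift _ \o S7_coact) (g := idfun)) => //.
- exact: comp_linear.
- exact: comp_monoid (counit_monoidl S7) cm.
- move=> j; rewrite -[pres_gen _ j]/(z j) /= S7_coactE (@lin_map_sum _ _ _ _ _ _ tl).
  under eq_bigr => i _ do rewrite (ctliftE (counit_bilinl S7)) SU2_block_counit.
  rewrite (bigD1 j) //= eqxx scale1r big1 ?addr0 // => i /negPf ->.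
  by rewrite scale0r.
- move=> j; rewrite -[pres_gen _ j]/(z j) /= S7_coact_starE (@lin_map_sum _ _ _ _ _ _ tl).
  under eq_bigr => i _ do
    rewrite (ctliftE (counit_bilinl S7)) SU2_counit_star SU2_block_counit rmorph_nat.
  rewrite (bigD1 j) //= eqxx scale1r big1 ?addr0 // => i /negPf ->.
  by rewrite scale0r.
Qed.

Definition S7_comodule : comodule_algebra (SU2_hopf C) S7 :=
  ComoduleAlgebra S7_coactA S7_coact1.

Definition S4_alpha : S7 := 2 *: (z 0 * star (z 2) + z 1 * star (z 3)).
Definition S4_beta : S7 := 2 *: (- (z 0 * z 3) + z 1 * z 2).
Definition S4_x : S7 :=
  z 0 * star (z 0) + z 1 * star (z 1) - z 2 * star (z 2) - z 3 * star (z 3).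

Definition S4_pred : {pred S7} := fun p =>
  `[< star_subalg (fun a => [\/ a = S4_alpha, a = S4_beta | a = S4_x]) p >].

Fact S4_subalg_closed : subalg_closed S4_pred.
Proof.
split=> [|c a b|a b]; rewrite /in_mem /= /S4_pred.
- exact/asboolP/SS_one.
- by move=> /asboolP Sa /asboolP Sb; exact/asboolP/SS_lin.
- by move=> /asboolP Sa /asboolP Sb; exact/asboolP/SS_mul.
Qed.

HB.instance Definition _ := GRing.isSubalgClosed.Build C S7 S4_pred S4_subalg_closed.

Definition S4 := {p : S7 | p \in S4_pred}.
HB.instance Definition _ := SubChoice.on S4.
HB.instance Definition _ := [SubChoice_isSubAlgebra of S4 by <:].

Definition S4_incl : {rmorphism S4 -> S7} := \val.

End S7.

Definition exp_ipi (R : realType) (theta : R) : R[i] :=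
  (cos (pi * theta) +i* sin (pi * theta))%C.

(* Main.v *)
From HB Require Import structures.
Require Import Defs.
From mathcomp Require Import all_boot all_order all_algebra generic_quotient.
From mathcomp Require Import boolp classical_sets functions reals trigo complex.
From mathcomp Require Import ring.

Set Implicit Arguments.
Unset Strict Implicit.
Unset Printing Implicit Defensive.

Import Order.TTheory GRing.Theory Num.Theory.
Local Open Scope ring_scope.

(** Let U be the fundamental 2 x 2 matrix over the coordinate algebra H of
    SU(2), let h be the Haar functional of H, let rho be the coaction on the
    seven-sphere algebra P and B the four-sphere algebra.

    Galois and flat.  The rows (z^1, z^2), (z^3, z^4) and their quaternionic
    conjugates are four vectors that rho multiplies by U.  They generate P,
    commute up to phases, and the sphere relation says that they pair to the
    symplectic form ([Psi_unimod]).  The functional h is known on monomials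
    and obeys a Wick recursion ([haar_wick]); applied to rho of a word in the
    rows, each contraction produces a 2 x 2 minor of two rows, and these minors
    are multiples of alpha, beta, their adjoints and 1 + x, 1 - x.  Hence the
    conditional expectation E = (id (x) h) rho takes values in B ([haar_inv],
    [minor_S4]), which identifies the coinvariants with B.  The same argument
    applied to U, whose minors are scalars, gives the invariance of h.

    The symplectic pairing also inverts U, so every 1 (x) t is a finite sum of
    terms (e (x) 1) rho(q) ([right_lift_ex]): the canonical map is onto.
    Moreover h is nondegenerate enough to imitate the counit on finitely many
    elements: some k satisfies h (k t) = counit t for all of them
    ([haar_approx_counit]).  Lifting 1 (x) k gives local dual bases
    p = \sum e E(q p) and p = \sum E(p q) e.  The second makes the canonical
    map injective; the first makes P (x)_B - exact, and it is faithful because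
    E 1 = 1 makes B a direct summand of P.

    Not cleft.  A cleaving map sends U to an invertible matrix F over P with
    rho F = F U.  Classically F is an equivariant map to SU(2), of degree
    one up to sign on the fibre over the pole x = 1; but that fibre contracts
    inside the sphere.  The contraction is realised by a polynomial family, in a
    parameter y, of representations of P by operators of a twisted Laurent ring
    over H: z = (u_00 y, u_10 y, (1 - y) T, 0).
    The degree is the Maurer-Cartan integral of A_h [A_e, A_f], where
    A_X = F^-1 [D_X, F] for the vector fields D_e, D_f, D_h of sl_2 on SU(2),
    and the integral is h applied to the constant term of the matrix trace.
    It is a polynomial in y with vanishing derivative ([degree_stationary]).
    At y = 0 the dependence on SU(2) has disappeared and it is 0; at y = 1 it
    is the trace of the square of diag(1, -1), that is 2. *)

(** * Operators representing a presented star-algebra *)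

Section AlgLift.
Variables (C : numClosedFieldType) (I : Type) (pr : star_presentation C I).
Variables (A : pzRingType) (iota : {rmorphism C -> A}).
Variables v v' : I -> A.

(** The target has no involution, so an expression is evaluated together with
    its adjoint; a star exchanges the two values. *)
Fixpoint dbl_eval (x : star_expr C I) : A * A :=
  match x with
  | EGen i => (v i, v' i)
  | EConst c => (iota c, iota c^*)
  | EAdd x y => ((dbl_eval x).1 + (dbl_eval y).1, (dbl_eval x).2 + (dbl_eval y).2)
  | EMul x y => ((dbl_eval x).1 * (dbl_eval y).1, (dbl_eval y).2 * (dbl_eval x).2)
  | EStar x => ((dbl_eval x).2, (dbl_eval x).1)
  end.

Lemma dbl_eval_comm (a : A) : (forall c, iota c * a = a * iota c) ->
  (forall i, v i * a = a * v i) -> (forall i, v' i * a = a * v' i) ->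
  forall x, (dbl_eval x).1 * a = a * (dbl_eval x).1 /\
            (dbl_eval x).2 * a = a * (dbl_eval x).2.
Proof.
move=> ca va v'a; elim=> [i|c|x [x1 x2] y [y1 y2]|x [x1 x2] y [y1 y2]|x [x1 x2]] //=.
- by rewrite !mulrDl !mulrDr x1 x2 y1 y2.
- by rewrite -!mulrA y1 x2 !mulrA x1 y2.
Qed.

Hypothesis iotav : forall c i, iota c * v i = v i * iota c.
Hypothesis iotav' : forall c i, iota c * v' i = v' i * iota c.

Lemma iotaC c x : (dbl_eval x).1 * iota c = iota c * (dbl_eval x).1 /\
                  (dbl_eval x).2 * iota c = iota c * (dbl_eval x).2.
Proof.
by apply: dbl_eval_comm => // d; rewrite -!rmorphM mulrC.
Qed.

Hypothesis sat : forall x y, pr x y -> dbl_eval x = dbl_eval y.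

Lemma dbl_evalP x y : star_cong pr x y -> dbl_eval x = dbl_eval y.
Proof.
elim=> //=.
- by move=> ? ? ? _ -> _ ->.
- by move=> ? ? ? ? _ -> _ ->.
- by move=> ? ? ? ? _ -> _ ->.
- by move=> ? ? _ ->.
- by move=> *; rewrite !addrA.
- by move=> *; congr pair; rewrite addrC.
- by move=> ?; rewrite !rmorph0 !add0r; case: dbl_eval.
- by move=> ?; rewrite !rmorphN1 !rmorph0 mulN1r mulrN1 !addNr.
- by move=> *; rewrite !mulrA.
- by move=> ?; rewrite !rmorph1 mul1r mulr1; case: dbl_eval.
- by move=> ?; rewrite !rmorph1 mul1r mulr1; case: dbl_eval.
- by move=> *; rewrite !mulrDl !mulrDr.
- by move=> *; rewrite !mulrDl !mulrDr.
- by move=> *; rewrite !rmorphD.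
- by move=> *; rewrite !rmorphM -[in X in (_, X)]rmorphM [_^* * _]mulrC rmorphM.
- by move=> b t; have [-> _] := iotaC b t; have [_ ->] := iotaC b^* t.
- by move=> *; rewrite conjCK.
- by move=> ?; case: dbl_eval.
Qed.

Definition alg_lift (x : presented pr) : A :=
  (dbl_eval (proj1_sig (cid (pres_classP x)))).1.

Lemma pres_class_inj x y :
  pres_class pr x = pres_class pr y -> star_cong pr x y.
Proof. by move=> E; have /eqmodP/asboolP := E. Qed.

Lemma alg_liftE x : alg_lift (pres_class pr x) = (dbl_eval x).1.
Proof.
rewrite /alg_lift; case: cid => y /= E.
by rewrite (dbl_evalP (pres_class_inj E)).
Qed.

Lemma pres_class_add x y :
  pres_class pr x + pres_class pr y = pres_class pr (EAdd x y).
Proof. by rewrite -!pres_evalE. Qed.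
Lemma pres_class_mul x y :
  pres_class pr x * pres_class pr y = pres_class pr (EMul x y).
Proof. by rewrite -!pres_evalE. Qed.

Lemma alg_lift_gen i : alg_lift (pres_gen pr i) = v i.
Proof. exact: alg_liftE. Qed.
Lemma alg_lift_star i : alg_lift (star (pres_gen pr i)) = v' i.
Proof.
have -> : star (pres_gen pr i) = pres_class pr (EStar (EGen C i)) by rewrite -pres_evalE.
exact: alg_liftE.
Qed.
Lemma alg_liftC c : alg_lift c%:A = iota c.
Proof.
have -> : c%:A = pres_class pr (EConst _ c) by rewrite -pres_evalE.
exact: alg_liftE.
Qed.

Lemma alg_liftD : {morph alg_lift : x y / x + y}.
Proof.
move=> x y; have [x' ->] := pres_classP x; have [y' ->] := pres_classP y.
by rewrite pres_class_add !alg_liftE.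
Qed.
Lemma alg_liftM : {morph alg_lift : x y / x * y}.
Proof.
move=> x y; have [x' ->] := pres_classP x; have [y' ->] := pres_classP y.
by rewrite pres_class_mul !alg_liftE.
Qed.
Lemma alg_lift1 : alg_lift 1 = 1.
Proof. by rewrite -[1]scale1r alg_liftC rmorph1. Qed.
Lemma alg_liftZ c x : alg_lift (c *: x) = iota c * alg_lift x.
Proof. by rewrite -[x in LHS]mul1r scalerAl alg_liftM alg_liftC. Qed.

End AlgLift.

(** A subtype of the functions, so that equality of operators is pointwise. *)
Definition endo (V : zmodType) := {f : V -> V | `[< {morph f : x y / x + y} >]}.
HB.instance Definition _ V := SubChoice.on (endo V).

Definition endo_apply (V : zmodType) (f : endo V) : V -> V := val f.
Coercion endo_apply : endo >-> Funclass.

Section Endo.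
Variable V : zmodType.
Implicit Types f g k : endo V.

Definition Endo (f : V -> V) (fD : {morph f : x y / x + y}) : endo V :=
  Sub f (introT (asboolP _) fD).
Lemma endoD f : {morph f : x y / x + y}.
Proof. exact: (asboolP _ (valP f)). Qed.
Lemma endo_ext f g : f =1 g -> f = g.
Proof. by move=> fg; apply/val_inj/funext. Qed.
Lemma endo0 f : f 0 = 0.
Proof. by apply: (addIr (f 0)); rewrite -endoD !add0r. Qed.

Fact endo_zero_subproof : {morph (fun _ : V => 0 : V) : x y / x + y}.
Proof. by move=> *; rewrite addr0. Qed.
Fact endo_add_subproof f g : {morph (fun x => f x + g x) : x y / x + y}.
Proof. by move=> x y; rewrite !endoD addrACA. Qed.
Fact endo_opp_subproof f : {morph (fun x => - f x) : x y / x + y}.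
Proof. by move=> x y; rewrite endoD opprD. Qed.
Fact endo_comp_subproof f g : {morph (fun x => f (g x)) : x y / x + y}.
Proof. by move=> x y; rewrite !endoD. Qed.
Fact endo_one_subproof : {morph (fun x : V => x) : x y / x + y}.
Proof. by []. Qed.

Fact endo_addA : associative (fun f g => Endo (endo_add_subproof f g)).
Proof. by move=> f g h; apply: endo_ext => x; exact: addrA. Qed.
Fact endo_addC : commutative (fun f g => Endo (endo_add_subproof f g)).
Proof. by move=> f g; apply: endo_ext => x; exact: addrC. Qed.
Fact endo_add0 :
  left_id (Endo endo_zero_subproof) (fun f g => Endo (endo_add_subproof f g)).
Proof. by move=> f; apply: endo_ext => x; exact: add0r. Qed.
Fact endo_addN : left_inverse (Endo endo_zero_subproof)
  (fun f => Endo (endo_opp_subproof f)) (fun f g => Endo (endo_add_subproof f g)).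
Proof. by move=> f; apply: endo_ext => x; exact: addNr. Qed.
HB.instance Definition _ :=
  GRing.isZmodule.Build (endo V) endo_addA endo_addC endo_add0 endo_addN.

Fact endo_mulA : associative (fun f g => Endo (endo_comp_subproof f g)).
Proof. by move=> f g h; exact: endo_ext. Qed.
Fact endo_mul1l : left_id (Endo endo_one_subproof) (fun f g => Endo (endo_comp_subproof f g)).
Proof. by move=> f; exact: endo_ext. Qed.
Fact endo_mul1r : right_id (Endo endo_one_subproof) (fun f g => Endo (endo_comp_subproof f g)).
Proof. by move=> f; exact: endo_ext. Qed.
Fact endo_mulDl :
  left_distributive (fun f g => Endo (endo_comp_subproof f g)) +%R.
Proof. by move=> f g h; exact: endo_ext. Qed.
Fact endo_mulDr :
  right_distributive (fun f g => Endo (endo_comp_subproof f g)) +%R.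
Proof. by move=> f g h; apply: endo_ext => x; exact: endoD. Qed.
HB.instance Definition _ := GRing.Zmodule_isPzRing.Build (endo V)
  endo_mulA endo_mul1l endo_mul1r endo_mulDl endo_mulDr.

Lemma endoDE f g x : (f + g : endo V) x = f x + g x. Proof. by []. Qed.
Lemma endoNE f x : (- f : endo V) x = - f x. Proof. by []. Qed.
Lemma endoME f g x : (f * g : endo V) x = f (g x). Proof. by []. Qed.
Lemma endo0E x : (0 : endo V) x = 0. Proof. by []. Qed.

End Endo.

(** * The Haar functional of SU(2) *)

Section SU2Lift.
Variables (C : numClosedFieldType) (A : pzRingType) (iota : {rmorphism C -> A}).
Variables v v' : 'I_2 -> A.
Hypothesis iotav : forall c i, iota c * v i = v i * iota c.
Hypothesis iotav' : forall c i, iota c * v' i = v' i * iota c.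

Hypothesis vv : forall b c, v b * v c = v c * v b.
Hypothesis vv' : forall b c, v b * v' c = v' c * v b.
Hypothesis v'v' : forall b c, v' b * v' c = v' c * v' b.
Hypothesis v1 : v 0 * v' 0 + v 1 * v' 1 = 1.

(** The presentation makes any two expressions commute; by structural induction
    it is enough that the images of the generators do. *)
Lemma SU2_alg_sat x y : SU2_pres C x y -> dbl_eval iota v v' x = dbl_eval iota v v' y.
Proof.
case=> [{}x {}y|] /=; last first.
  by rewrite v1 !rmorph1.
have cg b : forall z, (dbl_eval iota v v' z).1 * v b = v b * (dbl_eval iota v v' z).1 /\
            (dbl_eval iota v v' z).2 * v b = v b * (dbl_eval iota v v' z).2.
  exact: dbl_eval_comm.
have cg' b : forall z, (dbl_eval iota v v' z).1 * v' b = v' b * (dbl_eval iota v v' z).1 /\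
            (dbl_eval iota v v' z).2 * v' b = v' b * (dbl_eval iota v v' z).2.
  exact: dbl_eval_comm.
have [c1 c2] : (dbl_eval iota v v' x).1 * (dbl_eval iota v v' y).1 =
   (dbl_eval iota v v' y).1 * (dbl_eval iota v v' x).1 /\
   (dbl_eval iota v v' x).2 * (dbl_eval iota v v' y).2 =
   (dbl_eval iota v v' y).2 * (dbl_eval iota v v' x).2.
  split.
    apply: (proj1 (dbl_eval_comm _ _ _ x)) => i.
    - by have [-> _] := iotaC iotav iotav' i y.
    - by have [-> _] := cg i y.
    - by have [-> _] := cg' i y.
  apply: (proj2 (dbl_eval_comm _ _ _ x)) => i.
  - by have [_ ->] := iotaC iotav iotav' i y.
  - by have [_ ->] := cg i y.
  - by have [_ ->] := cg' i y.
by congr pair.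
Qed.

End SU2Lift.

(** The invariant symplectic form of the fundamental representation. *)
Definition eps {C : pzRingType} (j k : 'I_2) : C :=
  if j == k then 0 else if j == 0 then 1 else -1.

Definition letter := ('I_2 * 'I_2)%type.
Definition expo := letter -> nat.
Definition expo_incr (x : letter) (e : expo) : expo := fun y => (e y + (y == x))%N.

Lemma expo_incrC x y e : expo_incr x (expo_incr y e) = expo_incr y (expo_incr x e).
Proof. by apply/funext => z; rewrite /expo_incr addnAC. Qed.

Section HaarModule.
Variable C : numClosedFieldType.

(** A linear functional on polynomials in the four entries of U is its table of
    moments, indexed by exponents; it factors through SU(2) exactly when the
    table respects the relation that the determinant is 1.  Multiplication of
    the argument by an entry shifts the exponents, so H acts on these tables. *)
Definition det_pred : {pred expo -> C} := fun f =>
  `[< forall e, f (expo_incr (0, 0) (expo_incr (1, 1) e)) -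
                f (expo_incr (0, 1) (expo_incr (1, 0) e)) = f e >].

Lemma det_predP f : reflect (forall e, f (expo_incr (0, 0) (expo_incr (1, 1) e)) -
                f (expo_incr (0, 1) (expo_incr (1, 0) e)) = f e) (f \in det_pred).
Proof. exact: asboolP. Qed.

Fact det_pred_closed : zmod_closed det_pred.
Proof.
split=> [|f g /det_predP Hf /det_predP Hg]; apply/det_predP => e.
  by rewrite subr0.
rewrite -[LHS]/(f _ - g _ - (f _ - g _)) -[RHS]/(f e - g e) -(Hf e) -(Hg e); ring.
Qed.

HB.instance Definition _ := GRing.isZmodClosed.Build (expo -> C) det_pred det_pred_closed.

Definition det_fun := {f : expo -> C | f \in det_pred}.
HB.instance Definition _ := SubChoice.on det_fun.
HB.instance Definition _ := [SubChoice_isSubZmodule of det_fun by <:].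

Fact shift_closed x (f : det_fun) : (fun e => val f (expo_incr x e)) \in det_pred.
Proof.
apply/det_predP => e; have /det_predP H := valP f.
by rewrite !(expo_incrC x) H.
Qed.
Fact shift_additive x :
  {morph (fun f : det_fun => Sub (fun e => val f (expo_incr x e)) (shift_closed x f) : det_fun)
    : f g / f + g}.
Proof. by move=> f g; exact/val_inj/funext. Qed.
Definition shift x : endo det_fun := Endo (@shift_additive x).
Lemma shiftE x f e : val (shift x f) e = val f (expo_incr x e).
Proof. by []. Qed.

Fact dscale_closed c (f : det_fun) : (fun e => c * val f e) \in det_pred.
Proof.
apply/det_predP => e; have /det_predP H := valP f.
by rewrite -mulrBr H.
Qed.
Fact dscale_additive c :
  {morph (fun f : det_fun => Sub (fun e => c * val f e) (dscale_closed c f) : det_fun)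
    : f g / f + g}.
Proof. by move=> f g; apply/val_inj/funext => e; rewrite /= mulrDr. Qed.
Definition dscale c : endo det_fun := Endo (@dscale_additive c).
Lemma dscaleE c f e : val (dscale c f) e = c * val f e.
Proof. by []. Qed.

Lemma det_ext (f g : det_fun) : (forall e, val f e = val g e) -> f = g.
Proof. by move=> fg; apply/val_inj/funext. Qed.

Fact dscale_zmod : zmod_morphism dscale.
Proof. by move=> a b; apply: endo_ext => f; apply: det_ext => e; rewrite dscaleE /= mulrBl. Qed.
Fact dscale_monoid : monoid_morphism dscale.
Proof.
split=> [|a b]; apply: endo_ext => f; apply: det_ext => e; rewrite ?endoME !dscaleE ?mul1r //.
by rewrite mulrA.
Qed.
HB.instance Definition _ := GRing.isZmodMorphism.Build C (endo det_fun) dscale dscale_zmod.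
HB.instance Definition _ := GRing.isMonoidMorphism.Build C (endo det_fun) dscale dscale_monoid.

End HaarModule.

Section Haar.
Variable C : numClosedFieldType.
Local Notation SU2 := (SU2 C).
Local Notation U := (SU2_mx C).

(** The integral of u_00^a u_01^b u_10^c u_11^d.  Torus invariance kills it
    unless a = d and b = c; since u_01 u_10 = - (1 - t) with t = |u_00|^2
    uniform on [0, 1], it is then (-1)^b times the beta integral of
    t^a (1 - t)^b. *)
Definition haar_table (a b c d : nat) : C :=
  if (a == d) && (b == c) then (-1) ^+ b * (a`! * b`!)%:R / ((a + b).+1)`!%:R else 0.

Definition haar_fun (e : expo) : C :=
  haar_table (e (0, 0)) (e (0, 1)) (e (1, 0)) (e (1, 1)).

Lemma haar_table_det a b c d :
  haar_table a.+1 b c d.+1 - haar_table a b.+1 c.+1 d = haar_table a b c d.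
Proof.
rewrite /haar_table !eqSS; case: ifP => _; last by rewrite subr0.
rewrite addSn addnS [in LHS](factS (a + b).+1) (factS a) (factS b) !natrM exprS.
rewrite -!natr1 !natrD -?natr1; field.
by apply/and3P; split; rewrite -?natrD ?natr1 pnatr_eq0 // -lt0n; exact: fact_gt0.
Qed.

Lemma haar_table_wick00 a b c d : (a + b + c + d).+3%:R * haar_table a.+1 b c d =
  2 * (d%:R * haar_table a b c d.-1).
Proof.
rewrite /haar_table; case: d => [|d]; first by rewrite andFb mul0r !mulr0.
rewrite eqSS succnK; case: andP => [[/eqP <- /eqP <-]|_]; last by rewrite !mulr0.
rewrite addSn (factS (a + b).+1) (factS a) !natrM.
rewrite -!natr1 !natrD -?natr1; field.
by apply/and3P; split; rewrite -?natrD ?natr1 pnatr_eq0 // -lt0n; exact: fact_gt0.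
Qed.

Lemma haar_table_sym a b c d : haar_table a b c d = haar_table d c b a.
Proof.
rewrite /haar_table [d == a]eq_sym [c == b]eq_sym.
by case: andP => // -[/eqP-> /eqP->].
Qed.

Lemma haar_table_wick01 a b c d : (a + b + c + d).+3%:R * haar_table a b.+1 c d =
  - 2 * (c%:R * haar_table a b c.-1 d).
Proof.
rewrite /haar_table; case: c => [|c]; first by rewrite andbF mul0r !mulr0.
rewrite eqSS succnK; case: andP => [[/eqP <- /eqP <-]|_]; last by rewrite !mulr0.
rewrite [(a + b.+1)%N]addnS (factS (a + b).+1) (factS b) !natrM exprS.
rewrite -!natr1 !natrD -?natr1; field.
by apply/and3P; split; rewrite -?natrD ?natr1 pnatr_eq0 // -lt0n; exact: fact_gt0.
Qed.

Fact haar_fun_det : haar_fun \in @det_pred C.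
Proof.
apply/det_predP => e; rewrite /haar_fun /expo_incr !xpair_eqE /= !addn0 !addn1.
exact: haar_table_det.
Qed.
Definition haar_vec : det_fun C := Sub haar_fun haar_fun_det.

Let v (b : 'I_2) := shift C (0, b).
Let v' (b : 'I_2) := if b == 0 then shift C (1, 1) else - shift C (1, 0).

Lemma shiftC x y : shift C x * shift C y = shift C y * shift C x.
Proof.
by apply: endo_ext => f; apply: det_ext => e; rewrite !endoME !shiftE expo_incrC.
Qed.

Let dv c x : dscale c * shift C x = shift C x * dscale c.
Proof. by apply: endo_ext => f; apply: det_ext => e. Qed.

Let v'C x c : shift C x * v' c = v' c * shift C x.
Proof. by rewrite /v'; case: ifP => _; rewrite ?mulrN ?mulNr shiftC. Qed.

Let dv' c b : dscale c * v' b = v' b * dscale c.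
Proof. by rewrite /v'; case: ifP => _; rewrite ?mulrN ?mulNr dv. Qed.

Let dvv c b : dscale c * v b = v b * dscale c.
Proof. exact: dv. Qed.

Let sat : forall x y, SU2_pres C x y -> dbl_eval (@dscale C) v v' x = dbl_eval (@dscale C) v v' y.
Proof.
apply: SU2_alg_sat.
- by move=> *; exact: dv.
- by move=> *; exact: dv'.
- by move=> *; exact: shiftC.
- by move=> *; exact: v'C.
- move=> b c; have -> : v' b = if b == 0 then shift C (1, 1) else - shift C (1, 0) by [].
  by case: ifP => _; rewrite ?mulrN ?mulNr v'C.
- apply: endo_ext => f; apply: det_ext => e.
  have /det_predP H := valP f; rewrite -[RHS]H /v' /=.
  by rewrite [in RHS]expo_incrC [expo_incr (0, 1) (expo_incr (1, 0) e) in RHS]expo_incrC.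
Qed.

Definition haar_act : SU2 -> endo (det_fun C) := alg_lift (@dscale C) v v'.

Lemma haar_actU i j : haar_act (U i j) = shift C (i, j).
Proof.
have sE b : haar_act (star (w C b)) = v' b by exact: (alg_lift_star dvv dv' sat).
have wE b : haar_act (w C b) = v b by exact: (alg_lift_gen dvv dv' sat).
elim/ord2P: i; first by rewrite U0 wE.
elim/ord2P: j; rewrite ?U10 ?U11 ?sE //.
rewrite -scaleN1r [LHS](alg_liftZ dvv dv' sat) [alg_lift _ _ _ _]sE /v' /=.
by rewrite rmorphN1 mulN1r opprK.
Qed.

(** The moments give the functional t' |-> h (t' t); its value at the empty
    monomial is h t. *)
Definition haar (t : SU2) : C := val (haar_act t haar_vec) (fun=> 0%N).

Definition SU2_word (l : seq letter) : SU2 := \prod_(x <- l) U x.1 x.2.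

Lemma haar_actM : {morph haar_act : s t / s * t}.
Proof. exact: (alg_liftM dvv dv' sat). Qed.
Lemma haar_actD : {morph haar_act : s t / s + t}.
Proof. exact: (alg_liftD dvv dv' sat). Qed.
Lemma haar_actZ c t : haar_act (c *: t) = dscale c * haar_act t.
Proof. exact: (alg_liftZ dvv dv' sat). Qed.

Lemma haar_act0 : haar_act 0 = 0.
Proof. by apply: (addIr (haar_act 0)); rewrite -haar_actD !add0r. Qed.

Fact haar_linear : linear (haar : SU2 -> C^o).
Proof.
by move=> c s t; rewrite /haar haar_actD haar_actZ endoDE endoME /=.
Qed.
HB.instance Definition _ := GRing.isLinear.Build C SU2 C^o _ haar haar_linear.

Definition expo_word (l : seq letter) (e : expo) : expo :=
  fun y => (e y + count_mem y l)%N.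

Lemma haar_act_word l f e :
  val (haar_act (SU2_word l) f) e = val f (expo_word l e).
Proof.
elim: l e => [|[i j] l IH] e.
  rewrite /SU2_word big_nil [haar_act 1](alg_lift1 dvv dv' sat).
  by congr (val f _); apply/funext => y; rewrite /expo_word addn0.
rewrite /SU2_word big_cons haar_actM haar_actU endoME shiftE IH.
congr (val f _); apply/funext => y.
by rewrite /expo_word /expo_incr /= -addnA [_ == y]eq_sym.
Qed.

Lemma haar_word l : haar (SU2_word l) = haar_table (count_mem (0, 0) l)
  (count_mem (0, 1) l) (count_mem (1, 0) l) (count_mem (1, 1) l).
Proof. by rewrite /haar haar_act_word. Qed.

Lemma haar1 : haar 1 = 1.
Proof.
have := haar_word [::]; rewrite /SU2_word big_nil => ->.
by rewrite /haar_table !eqxx /= mul1r divff // oner_eq0.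
Qed.

(** Wick contractions of a letter with each letter of a word, for the form
    eps (x) eps invariant under both translations. *)
Fixpoint SU2_contr (x : letter) (l : seq letter) : SU2 :=
  if l is y :: l' then
    (eps x.1 y.1 * eps x.2 y.2) *: SU2_word l' + U y.1 y.2 * SU2_contr x l'
  else 0.

Definition opp2 (i : 'I_2) : 'I_2 := if i == 0 then 1 else 0.
Definition opp_letter (x : letter) : letter := (opp2 x.1, opp2 x.2).

Lemma eps_opp2 (j k : 'I_2) : k != opp2 j -> eps j k = 0 :> C.
Proof. by elim/ord2P: j; elim/ord2P: k. Qed.

(** Only the letters opposite to [x] contribute, all by the same moment.  Where
    there is none, the factor is 0 and the truncated subtraction is harmless. *)
Lemma haar_act_contr x l e : val (haar_act (SU2_contr x l) haar_vec) e =
  eps x.1 (opp2 x.1) * eps x.2 (opp2 x.2) * ((count_mem (opp_letter x) l)%:R *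
  haar_fun (fun y => (expo_word l e y - (y == opp_letter x))%N)).
Proof.
elim: l e => [|[i j] l IH] e /=.
  by rewrite haar_act0 mul0r mulr0.
rewrite haar_actD haar_actZ haar_actM haar_actU endoDE !endoME.
rewrite -[LHS]/(_ * val (haar_act (SU2_word l) haar_vec) e +
  val (haar_act (SU2_contr x l) haar_vec) (expo_incr (i, j) e)).
rewrite IH haar_act_word.
have -> : expo_word l (expo_incr (i, j) e) = expo_word ((i, j) :: l) e.
  apply/funext => y; rewrite /expo_word /expo_incr /= -addnA.
  by rewrite [_ == y]eq_sym.
have [xE|nx] := eqVneq (i, j) (opp_letter x); last first.
  rewrite (_ : eps x.1 i * eps x.2 j = 0) ?mul0r ?add0r ?add0n //.
  move: nx; rewrite xpair_eqE negb_and => /orP[/eps_opp2->|/eps_opp2->].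
    by rewrite mul0r.
  by rewrite mulr0.
have [-> ->] : i = opp2 x.1 /\ j = opp2 x.2 by case: xE.
rewrite -mulrDr -[(opp2 _, opp2 _)]/(opp_letter x).
rewrite -[val haar_vec _]/(haar_fun _).
have -> : haar_fun (expo_word l e) = haar_fun (fun y =>
    (expo_word (opp_letter x :: l) e y - (y == opp_letter x))%N).
  congr haar_fun; apply/funext => y; rewrite /expo_word /=.
  by rewrite [opp_letter x == y]eq_sym addnCA addKn.
by rewrite natrD [in RHS]mulrDl mul1r.
Qed.

(** The sphere S^3 carries the angular part of a Gaussian on R^4, whose moments
    obey Wick's rule; the factor (size l).+3 is the quotient of the radial moments
    of orders (size l).+1 and (size l).-1, and 2 normalises the covariance. *)
Lemma haar_wick x l :
  (size l).+3%:R * haar (U x.1 x.2 * SU2_word l) = 2 * haar (SU2_contr x l).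
Proof.
have -> : U x.1 x.2 * SU2_word l = SU2_word (x :: l).
  by rewrite /SU2_word big_cons.
rewrite haar_word /haar haar_act_contr /haar_fun /expo_word.
have -> : size l = (count_mem (0%R, 0%R) l + count_mem (0%R, 1%R) l
    + count_mem (1%R, 0%R) l + count_mem (1%R, 1%R) l)%N.
  elim: l => //= y l ->; move: y => [i j].
  by elim/ord2P: i; elim/ord2P: j; rewrite /= ?add0n ?add1n ?addnS ?addSn.
have sumE (a b c d : nat) : (a + b + c + d = d + c + b + a)%N by ring.
case: x => i j; elim/ord2P: i; elim/ord2P: j;
  rewrite /opp_letter /= ?add0n ?subn0 ?add1n ?subn1 ?addn1.
- rewrite haar_table_wick00 /eps /=; ring.
- rewrite haar_table_wick01 /eps /=; ring.
- rewrite haar_table_sym [in RHS]haar_table_sym sumE haar_table_wick01 /eps /=; ring.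
- rewrite haar_table_sym [in RHS]haar_table_sym sumE haar_table_wick00 /eps /=; ring.
Qed.

End Haar.

(** * Haar averages in comodules over SU(2) *)

Lemma SU2_matrix_ind (C : numClosedFieldType) (P : SU2 C -> Prop) :
  P 1 -> (forall c x y, P x -> P y -> P (c *: x + y)) ->
  (forall x y, P x -> P y -> P (x * y)) -> (forall a b, P (SU2_mx C a b)) ->
  forall x, P x.
Proof.
move=> P1 Pl PM PU.
have P0 : P 0 by have := Pl (-1) 1 1 P1 P1; rewrite scaleN1r addNr.
have PZ c x : P x -> P (c *: x) by move=> Px; rewrite -[_ *: _]addr0; exact: Pl.
have PD x y : P x -> P y -> P (x + y) by move=> Px Py; rewrite -[x]scale1r; exact: Pl.
have Pw b : P (w C b) by rewrite -U0.
have Pws b : P (star (w C b)).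
  elim/ord2P: b; first by rewrite -U11.
  by rewrite -[star _]opprK -U10 -scaleN1r; exact: PZ.
move=> x; suff [] : P x /\ P (star x) by [].
elim/presented_ind: x => [i|c|x y [? ?] [? ?]|x y [? ?] [? ?]|x [? ?]].
- by split; [exact: Pw|exact: Pws].
- by rewrite starZ star1; split; exact: PZ.
- by rewrite starD; split; exact: PD.
- by rewrite starM; split; exact: PM.
- by rewrite starK.
Qed.

Section HaarPart.
Variables (C : numClosedFieldType) (Q : algType C).

Lemma haar_part_bilin : bilin (fun (q : Q) (t : SU2 C) => haar t *: q).
Proof.
split=> [t c q q'|q c t t'] /=; first by rewrite scalerDr !scalerA mulrC.
by rewrite linearP scalerDl scalerA.
Qed.

Definition haar_part (z : Q ⊗ SU2 C) : Q := tlift (fun q t => haar t *: q) z.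

Lemma haar_partE q t : haar_part (q ⊗ t) = haar t *: q.
Proof. exact: (ctliftE haar_part_bilin). Qed.
Fact haar_part_linear : linear haar_part.
Proof. exact: (ctlift_linear haar_part_bilin). Qed.
HB.instance Definition _ := GRing.isLinear.Build C _ _ _ haar_part haar_part_linear.

Lemma haar_part_mull q z : haar_part ((q ⊗ 1) * z) = q * haar_part z.
Proof.
elim/ctens_ind: z => [p t|x y IHx IHy].
  by rewrite pureM mul1r !haar_partE scalerAr.
by rewrite mulrDr !linearD /= mulrDr IHx IHy.
Qed.
Lemma haar_part_mulr q z : haar_part (z * (q ⊗ 1)) = haar_part z * q.
Proof.
elim/ctens_ind: z => [p t|x y IHx IHy].
  by rewrite pureM mulr1 !haar_partE scalerAl.
by rewrite mulrDl !linearD /= mulrDl IHx IHy.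
Qed.

End HaarPart.

Section Comodule.
Variables (C : numClosedFieldType) (Q : algType C).
Local Notation SU2 := (SU2 C).
Local Notation U := (SU2_mx C).
Variable rho : {lrmorphism Q -> Q ⊗ SU2}.
Variables (S : finType) (Psi : S -> 'I_2 -> Q) (c : S -> S -> C).
Hypothesis rhoE : forall s j, rho (Psi s j) = \sum_k Psi s k ⊗ U k j.
Hypothesis PsiC : forall s s' j k,
  Psi s j * Psi s' k = c s s' *: (Psi s' k * Psi s j).

Definition minor s s' := Psi s 0 * Psi s' 1 - Psi s 1 * Psi s' 0.
Definition Psi_word (l : seq (S * 'I_2)) : Q := \prod_(x <- l) Psi x.1 x.2.

(** Expanding the coaction of a word over the column indices leaves a word in
    each tensor factor, to which Wick's rule applies term by term. *)
Fixpoint coact_terms (l : seq (S * 'I_2)) : seq (Q * seq letter) :=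
  if l is x :: l' then
    [seq (Psi x.1 0 * p.1, (0, x.2) :: p.2) | p <- coact_terms l'] ++
    [seq (Psi x.1 1 * p.1, (1, x.2) :: p.2) | p <- coact_terms l']
  else [:: (1, [::])].

Lemma coact_terms_size l p : p \in coact_terms l -> size p.2 = size l.
Proof.
elim: l p => [|x l IH] p /=; first by rewrite inE => /eqP->.
by rewrite mem_cat => /orP[] /mapP[q /IH <- ->].
Qed.

Definition coact_contr k j l : (Q ⊗ SU2)%type :=
  \sum_(p <- coact_terms l) p.1 ⊗ SU2_contr C (k, j) p.2.

Lemma coact_termsE l :
  rho (Psi_word l) = \sum_(p <- coact_terms l) p.1 ⊗ SU2_word C p.2.
Proof.
elim: l => [|x l IH] /=.
  by rewrite /Psi_word big_nil big_seq1 /= /SU2_word big_nil rmorph1.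
rewrite big_cat !big_map /= /Psi_word big_cons rmorphM /= rhoE sum2 mulrDl IH.
rewrite !mulr_sumr; congr (_ + _); apply: eq_bigr => p _;
by rewrite pureM [SU2_word C (_ :: _)]big_cons.
Qed.

Lemma coact_contr_cons k j x l : coact_contr k j (x :: l) =
  eps j x.2 *: ((\sum_k' eps k k' *: Psi x.1 k') ⊗ 1 * rho (Psi_word l)) +
  rho (Psi x.1 x.2) * coact_contr k j l.
Proof.
rewrite /coact_contr /= big_cat !big_map /= coact_termsE rhoE !sum2 mulrDl.
rewrite pureDl mulrDl scalerDr addrACA !mulr_sumr !scaler_sumr.
congr (_ + _); rewrite -big_split /=; apply: eq_bigr => p _;
  rewrite !pureM mul1r pureDr; congr (_ + _).
all: by rewrite pureZr -scalerAl pureZl scalerA mulrC.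
Qed.

Lemma haar_coact_wick s j l :
  (size l).+3%:R *: haar_part (rho (Psi s j) * rho (Psi_word l)) =
  2 *: haar_part (\sum_k (Psi s k ⊗ 1) * coact_contr k j l).
Proof.
rewrite rhoE mulr_suml !linear_sum /=; apply: eq_bigr => k _.
rewrite coact_termsE /coact_contr !mulr_sumr !linear_sum /=.
rewrite big_seq [in RHS]big_seq; apply: eq_bigr => p /coact_terms_size <-.
have /= wick := haar_wick C (k, j) p.2.
by rewrite !pureM mul1r !haar_partE !scalerA wick.
Qed.

(** The index is the length of the word that remains after a contraction; it
    drives the recursion that computes averages of words. *)
Inductive contracted n : (Q ⊗ SU2)%type -> Prop :=
  | Contracted0 : contracted n 0
  | ContractedD x y : contracted n x -> contracted n y -> contracted n (x + y)
  | ContractedM a s s' l : size l = n ->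
      contracted n (a *: ((minor s s' ⊗ 1) * rho (Psi_word l))).

Lemma contractedZ n a x : contracted n x -> contracted n (a *: x).
Proof.
elim=> [|{}x y _ IHx _ IHy|b s s' l ls].
- by rewrite scaler0; exact: Contracted0.
- by rewrite scalerDr; exact: ContractedD.
- by rewrite scalerA; exact: ContractedM.
Qed.

Lemma Psi_minor s k s' s'' :
  Psi s k * minor s' s'' = (c s s' * c s s'') *: (minor s' s'' * Psi s k).
Proof.
rewrite /minor mulrBr mulrBl !mulrA !(PsiC s s') -!scalerAl -!mulrA !(PsiC s s'').
by rewrite -!scalerAr !scalerA scalerBr.
Qed.

Lemma contracted_cons n s j x :
  contracted n x -> contracted n.+1 (rho (Psi s j) * x).
Proof.
elim=> [|{}x y _ IHx _ IHy|b s1 s2 l ls].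
- by rewrite mulr0; exact: Contracted0.
- by rewrite mulrDr; exact: ContractedD.
- have -> : rho (Psi s j) * (b *: (minor s1 s2 ⊗ 1 * rho (Psi_word l))) =
    (b * (c s s1 * c s s2)) *: (minor s1 s2 ⊗ 1 * rho (Psi_word ((s, j) :: l))).
    rewrite -scalerAr mulrA /Psi_word big_cons rmorphM /= -[in RHS](scalerA b) [in RHS]mulrA.
    congr (_ *: _); rewrite scalerAl; congr (_ * _); rewrite rhoE mulr_suml mulr_sumr scaler_sumr.
    by apply: eq_bigr => k _; rewrite !pureM Psi_minor mulr1 mul1r pureZl.
  by apply: ContractedM; rewrite /= ls.
Qed.

(** Contracting [Psi s j] with a letter of row [s'] pairs the two rows by eps,
    which leaves their minor; the minor commutes with all rows up to phases
    and moves to the front. *)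
Lemma contracted_sum s j l : contracted (size l).-1
  (\sum_k (Psi s k ⊗ 1) * coact_contr k j l).
Proof.
have contr0 k : coact_contr k j [::] = 0.
  by rewrite /coact_contr big_seq1 pure0r.
elim: l => [|x l IH].
  by rewrite big1 => [|k _]; [exact: Contracted0|rewrite contr0 mulr0].
have -> : \sum_k (Psi s k ⊗ 1) * coact_contr k j (x :: l) =
    eps j x.2 *: ((minor s x.1 ⊗ 1) * rho (Psi_word l)) +
    c s x.1 *: (rho (Psi x.1 x.2) * \sum_k (Psi s k ⊗ 1) * coact_contr k j l).
  under eq_bigr => k _ do rewrite coact_contr_cons mulrDr.
  rewrite big_split /=; congr (_ + _).
    rewrite !sum2 -!scalerAr -scalerDr !mulrA !pureM mulr1 -mulrDl.
    rewrite -pureDl /eps /= !scale0r !add0r addr0 scale1r scaleN1r mulrN.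
    by [].
  rewrite mulr_sumr scaler_sumr; apply: eq_bigr => k _.
  rewrite !mulrA scalerAl; congr (_ * _).
  rewrite rhoE mulr_sumr mulr_suml scaler_sumr; apply: eq_bigr => k' _.
  by rewrite !pureM mul1r mulr1 PsiC pureZl.
apply: ContractedD; first exact: ContractedM.
apply: contractedZ; case: l IH => [|y l] IH; last exact: contracted_cons.
by rewrite big1 => [|k _]; [rewrite mulr0; exact: Contracted0|rewrite contr0 mulr0].
Qed.

Section Invariants.
Variable B : Q -> Prop.
Hypothesis B1 : B 1.
Hypothesis Blin : forall a x y, B x -> B y -> B (a *: x + y).
Hypothesis BM : forall x y, B x -> B y -> B (x * y).
Hypothesis Bminor : forall s s', B (minor s s').
Hypothesis Psi_span : forall P : Q -> Prop,
  (forall a x y, P x -> P y -> P (a *: x + y)) -> (forall l, P (Psi_word l)) ->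
  forall q, P q.

Let B0 : B 0. Proof. by have := Blin (-1) B1 B1; rewrite scaleN1r addNr. Qed.
Let BZ a x : B x -> B (a *: x).
Proof. by move=> Bx; rewrite -[_ *: _]addr0; exact: Blin. Qed.
Let BD x y : B x -> B y -> B (x + y).
Proof. by move=> Bx By; rewrite -[x]scale1r; exact: Blin. Qed.

Lemma haar_word_inv l : B (haar_part (rho (Psi_word l))).
Proof.
have [n] := ubnP (size l); elim: n l => // n IH [|[s j] l] /= ln.
  rewrite /Psi_word big_nil rmorph1 -pure1 haar_partE haar1 scale1r.
  exact: B1.
have n3 : (size l).+3%:R != 0 :> C by rewrite pnatr_eq0.
rewrite -[haar_part _](scalerK n3) /Psi_word big_cons rmorphM /= haar_coact_wick.
do 2![apply: BZ].
have IH' l' : (size l' <= size l)%N -> B (haar_part (rho (Psi_word l'))).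
  by move=> l'l; apply: IH; exact: leq_ltn_trans l'l ln.
elim: (contracted_sum s j l) => [|x y _ IHx _ IHy|a s1 s2 l' l'E].
- by rewrite linear0.
- by rewrite linearD; exact: BD.
- rewrite linearZ /= haar_part_mull; apply/BZ/BM => //.
  by apply: IH'; rewrite l'E leq_pred.
Qed.

(** Each step of Wick's rule splits off a minor and shortens the word, so that
    averages lie in any subalgebra containing the minors. *)
Lemma haar_inv q : B (haar_part (rho q)).
Proof.
elim/Psi_span: q => [a x y Bx By|l]; last exact: haar_word_inv.
by rewrite !linearP; exact: Blin.
Qed.

End Invariants.

Section Translation.
Variable g : S -> S -> C.
Hypothesis Psi_unimod : forall j k,
  \sum_s \sum_s' g s s' *: (Psi s j * Psi s' k) = (eps j k)%:A.

Definition right_lift (l : seq (Q * Q)) (t : SU2) :=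
  \sum_(p <- l) (p.1 ⊗ 1) * rho p.2 = 1 ⊗ t.
Definition left_lift (l : seq (Q * Q)) (t : SU2) :=
  \sum_(p <- l) rho p.1 * (p.2 ⊗ 1) = 1 ⊗ t.

Lemma right_lift_sum j k :
  \sum_s \sum_s' (g s s' *: Psi s j ⊗ 1) * rho (Psi s' k) =
  1 ⊗ (\sum_l eps j l *: U l k).
Proof.
under eq_bigr => s _ do under eq_bigr => s' _ do rewrite rhoE mulr_sumr.
under eq_bigr => s _ do rewrite exchange_big /=.
rewrite exchange_big pure_sumr; apply: eq_bigr => l _.
rewrite pureZr -pureZl -Psi_unimod pure_suml; apply: eq_bigr => s _.
by rewrite pure_suml; apply: eq_bigr => s' _; rewrite pureM mul1r scalerAl.
Qed.

Lemma left_lift_sum j k :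
  \sum_s \sum_s' rho (Psi s j) * (g s s' *: Psi s' k ⊗ 1) =
  1 ⊗ (\sum_l eps l k *: U l j).
Proof.
under eq_bigr => s _ do under eq_bigr => s' _ do rewrite rhoE mulr_suml.
under eq_bigr => s _ do rewrite exchange_big /=.
rewrite exchange_big pure_sumr; apply: eq_bigr => l _.
rewrite pureZr -pureZl -Psi_unimod pure_suml; apply: eq_bigr => s _.
by rewrite pure_suml; apply: eq_bigr => s' _; rewrite pureM mulr1 scalerAr.
Qed.

(** Pairing the rows by [g] inverts the coefficients in rho (Psi s k), which
    yields the entries of U.  Lifts of products are obtained by nesting. *)
Lemma right_lift_ex t : exists l, right_lift l t.
Proof.
elim/SU2_matrix_ind: t => [|a x y [l lx] [l' ly]|x y [l lx] [l' ly]|a b].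
- by exists [:: (1, 1)]; rewrite /right_lift big_seq1 /= rmorph1 mul1r.
- exists ([seq (a *: p.1, p.2) | p <- l] ++ l'); rewrite /right_lift big_cat.
  rewrite big_map ly pureDr pureZr -lx scaler_sumr; congr (_ + _).
  by apply: eq_bigr => p _ /=; rewrite pureZl scalerAl.
- exists [seq (p'.1 * p.1, p.2 * p'.2) | p' <- l', p <- l].
  rewrite /right_lift big_allpairs_dep /=.
  transitivity (\sum_(p' <- l') (p'.1 ⊗ 1) * (1 ⊗ x) * rho p'.2).
    apply: eq_bigr => p' _; rewrite -lx mulr_sumr mulr_suml; apply: eq_bigr => p _.
    by rewrite rmorphM /= !mulrA pureM mul1r.
  have -> : 1 ⊗ (x * y) = (1 ⊗ x) * (1 ⊗ y) :> (Q ⊗ SU2)%type by rewrite pureM mul1r.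
  rewrite -ly mulr_sumr; apply: eq_bigr => p' _.
  by rewrite mulrA !pureM !mul1r !mulr1.
- have key j a' : right_lift [seq (a' *: (g s s' *: Psi s j), Psi s' b) | s <- enum S, s' <- enum S]
      (a' *: \sum_l eps j l *: U l b).
    rewrite /right_lift big_allpairs_dep /= big_enum /= pureZr -right_lift_sum scaler_sumr.
    apply: eq_bigr => s _; rewrite big_enum /= scaler_sumr; apply: eq_bigr => s' _.
    by rewrite pureZl scalerAl.
  elim/ord2P: a; [have := key 1 (-1)|have := key 0 1]; rewrite sum2 /eps /=.
    by rewrite scale0r addr0 scalerA mulrNN mulr1 scale1r; eexists; eassumption.
  by rewrite scale0r add0r !scale1r; eexists; eassumption.
Qed.

Lemma left_lift_ex t : exists l, left_lift l t.
Proof.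
elim/SU2_matrix_ind: t => [|a x y [l lx] [l' ly]|x y [l lx] [l' ly]|a b].
- by exists [:: (1, 1)]; rewrite /left_lift big_seq1 /= rmorph1 mul1r.
- exists ([seq (p.1, a *: p.2) | p <- l] ++ l'); rewrite /left_lift big_cat.
  rewrite big_map ly pureDr pureZr -lx scaler_sumr; congr (_ + _).
  by apply: eq_bigr => p _ /=; rewrite pureZl scalerAr.
- exists [seq (p'.1 * p.1, p.2 * p'.2) | p' <- l', p <- l].
  rewrite /left_lift big_allpairs_dep /=.
  transitivity (\sum_(p' <- l') rho p'.1 * (1 ⊗ x) * (p'.2 ⊗ 1)).
    apply: eq_bigr => p' _; rewrite -lx mulr_sumr mulr_suml; apply: eq_bigr => p _.
    by rewrite rmorphM /= -!mulrA pureM mulr1.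
  have -> : 1 ⊗ (x * y) = (1 ⊗ y) * (1 ⊗ x) :> (Q ⊗ SU2)%type.
    by rewrite pureM mul1r SU2_mulC.
  rewrite -ly mulr_suml; apply: eq_bigr => p' _.
  by rewrite -!mulrA !pureM !mul1r !mulr1.
- have key k a' : left_lift [seq (Psi s b, a' *: (g s s' *: Psi s' k)) | s <- enum S, s' <- enum S]
      (a' *: \sum_l eps l k *: U l b).
    rewrite /left_lift big_allpairs_dep /= big_enum /= pureZr -left_lift_sum scaler_sumr.
    apply: eq_bigr => s _; rewrite big_enum /= scaler_sumr; apply: eq_bigr => s' _.
    by rewrite pureZl scalerAr.
  elim/ord2P: a; [have := key 1 1|have := key 0 (-1)]; rewrite sum2 /eps /=.
    by rewrite scale0r addr0 !scale1r; eexists; eassumption.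
  by rewrite scale0r add0r scalerA mulrNN mulr1 scale1r; eexists; eassumption.
Qed.

End Translation.

End Comodule.

(** * Invariance and nondegeneracy of the Haar functional *)

Section LinearAlgebra.
Variable F : fieldType.

(** In a rank factorisation N = A B, the identity A (B A) B = 0 forces
    B A = 0, and tr N = tr (B A). *)
Lemma sqr0_mxtrace n (N : 'M[F]_n) : N *m N = 0 -> \tr N = 0.
Proof.
have := mulmx_base N; have := row_base_free N; have := col_base_full N.
move: (col_base N) (row_base N) => A B fullA freeB NE NN.
rewrite -NE mxtrace_mulC.
suff -> : B *m A = 0 by rewrite linear0.
have : A *m (B *m A) *m B = 0 by rewrite mulmxA NE -mulmxA NE.
move/eqP; rewrite mulmx_free_eq0 // => /eqP.
move/(congr1 trmx); rewrite trmx_mul trmx0 => /eqP.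
rewrite mulmx_free_eq0; last by rewrite -row_leq_rank mxrank_tr col_leq_rank.
by rewrite trmx_eq0 => /eqP.
Qed.

(** [V] may be infinite-dimensional; its image is the row space of a matrix of
    maximal rank among those whose rows are values of [f]. *)
Lemma linear_image_rV (V : lmodType F) n (f : {linear V -> 'rV[F]_n}) (b : 'rV_n) :
  (forall c : 'cV_n, (forall v, f v *m c = 0) -> b *m c = 0) ->
  exists v, f v = b.
Proof.
move=> Hb.
pose im (A : 'M[F]_n) := forall i, exists v, f v = row i A.
pose P k := `[< exists2 A, im A & \rank A = k >].
have imP A u : im A -> (u <= A)%MS -> exists v, f v = u.
  move=> /choice[w wE] /submxP[D ->].
  exists (\sum_i D 0 i *: w i); rewrite linear_sum /= mulmx_sum_row.
  by apply: eq_bigr => i _; rewrite linearZ /= wE.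
have exP : exists k, P k.
  exists 0%N; apply/asboolP; exists 0; last by rewrite mxrank0.
  by move=> i; exists 0; rewrite linear0 row0.
have ubP k : P k -> (k <= n)%N.
  by move=> /asboolP[A _ <-]; exact: rank_leq_row.
case: (ex_maxnP exP ubP) => k /asboolP[A imA rA] maxk.
have fA v : (f v <= A)%MS.
  have imA' : im (A + f v)%MS.
    move=> i; have := row_sub i (A + f v)%MS => /sub_addsmxP[[u1 u2]] /= ->.
    have [x xE] : exists x, f x = u1 *m A by apply: (imP A) => //; exact: submxMl.
    exists (x + u2 0 0 *: v); rewrite linearD linearZ /= xE; congr (_ + _).
    by rewrite [u2]mx11_scalar mul_scalar_mx mxE.
  have := maxk _ (introT (asboolP _) (ex_intro2 _ _ _ imA' erefl)).
  rewrite -rA => le; apply: submx_trans (addsmxSr A (f v)) _.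
  by rewrite -mxrank_leqif_sup ?addsmxSl // eqn_leq le mxrankS ?addsmxSl.
apply: (imP A) => //; rewrite submxE; apply/eqP/matrixP => i j.
rewrite [RHS]mxE.
have -> : (b *m cokermx A) i j = (b *m col j (cokermx A)) 0 0.
  by rewrite ord1 colE mulmxA -colE [RHS]mxE.
rewrite Hb ?mxE // => v.
by have := fA v; rewrite submxE colE mulmxA => /eqP ->; rewrite mul0mx.
Qed.

Lemma ctens_sum (M N : lmodType F) (z : M ⊗ N) :
  exists n (x : 'I_n -> M) (y : 'I_n -> N), z = \sum_i x i ⊗ y i.
Proof.
elim/ctens_ind: z => [m n|z1 z2 [n1 [x1 [y1 ->]]] [n2 [x2 [y2 ->]]]].
  by exists 1%N, (fun=> m), (fun=> n); rewrite big_ord1.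
exists (n1 + n2)%N,
  (fun i : 'I_(n1 + n2) => match fintype.split i with inl j => x1 j | inr j => x2 j end),
  (fun i : 'I_(n1 + n2) => match fintype.split i with inl j => y1 j | inr j => y2 j end).
rewrite big_split_ord /=; congr (_ + _); apply: eq_bigr => i _.
  by rewrite (unsplitK (inl i)).
by rewrite (unsplitK (inr i)).
Qed.

End LinearAlgebra.

Section WordSpan.
Variables (C : numClosedFieldType) (Q : algType C) (T : Type) (gen : T -> Q).

(** The linear span of the words, given by its induction principle. *)
Definition word_span (q : Q) := forall P : Q -> Prop,
  (forall a x y, P x -> P y -> P (a *: x + y)) ->
  (forall l, P (\prod_(x <- l) gen x)) -> P q.

Lemma word_span1 : word_span 1.
Proof. by move=> P _ Pw; have := Pw [::]; rewrite big_nil. Qed.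
Lemma word_span_gen x : word_span (gen x).
Proof. by move=> P _ Pw; have := Pw [:: x]; rewrite big_seq1. Qed.
Lemma word_span_lin a x y : word_span x -> word_span y -> word_span (a *: x + y).
Proof. by move=> Wx Wy P Pl Pw; apply: (Pl); [exact: (Wx P Pl Pw)|exact: (Wy P Pl Pw)]. Qed.
Lemma word_spanM x y : word_span x -> word_span y -> word_span (x * y).
Proof.
move=> Wx Wy P Pl Pw; apply: (Wx (fun z => P (z * y))) => [a u v Pu Pv|l].
  by rewrite mulrDl -scalerAl; exact: Pl.
apply: (Wy (fun z => P (_ * z))) => [a u v Pu Pv|l'].
  by rewrite mulrDr -scalerAr; exact: Pl.
by rewrite -big_cat.
Qed.

End WordSpan.

Section HaarSU2.
Variable C : numClosedFieldType.
Local Notation SU2 := (SU2 C).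
Local Notation U := (SU2_mx C).
Local Notation Delta := (comul (SU2_hopf C)).

Lemma SU2_det j k : U 0 j * U 1 k - U 1 j * U 0 k = (eps j k)%:A.
Proof.
have := SU2_sum C; rewrite sum2 => E.
elim/ord2P: j; elim/ord2P: k; rewrite ?U0 ?U10 ?U11 /eps /=.
- by rewrite SU2_mulC subrr scale0r.
- by rewrite mulNr opprK [star _ * _]SU2_mulC E scale1r.
- by rewrite mulrN -opprD [star _ * _]SU2_mulC addrC E scaleN1r.
- by rewrite SU2_mulC subrr scale0r.
Qed.

Lemma SU2_comul_lr i j : Delta (U i j) = \sum_k U i k ⊗ U k j.
Proof. exact: SU2_comulE. Qed.

Let UC (i i' j k : 'I_2) : U i j * U i' k = 1 *: (U i' k * U i j).
Proof. by rewrite scale1r SU2_mulC. Qed.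

Lemma SU2_minor i i' : minor U i i' = (eps i i')%:A.
Proof.
rewrite /minor; elim/ord2P: i; elim/ord2P: i'; rewrite /eps /=.
- by rewrite SU2_mulC subrr scale0r.
- by have := SU2_det 0 1; rewrite /eps /= => <-; rewrite [U 1 0 * _]SU2_mulC.
- have := SU2_det 1 0; rewrite /eps /= => <-; rewrite [U 0 1 * _]SU2_mulC.
  by [].
- by rewrite SU2_mulC subrr scale0r.
Qed.

Lemma SU2_word_span t : word_span (fun x : letter => U x.1 x.2) t.
Proof.
elim/SU2_matrix_ind: t => [|a x y|x y|a b].
- exact: word_span1.
- exact: word_span_lin.
- exact: word_spanM.
- exact: (@word_span_gen _ _ _ (fun x : letter => U x.1 x.2) (a, b)).
Qed.

(** In the regular comodule the minors are scalars, hence so are the averages;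
    the counit determines which scalar. *)
Lemma haar_left_inv t : haar_part (Delta t) = (haar t)%:A.
Proof.
have [] := @haar_inv C SU2 Delta _ U (fun _ _ => 1) SU2_comul_lr UC
  (fun q => exists a, q = a%:A) _ _ _ _ _ t.
- by exists 1; rewrite scale1r.
- by move=> a _ _ [b ->] [d ->]; exists (a * b + d); rewrite scalerDl scalerA.
- by move=> _ _ [b ->] [d ->]; exists (b * d); rewrite -scalerAl mul1r scalerA.
- by move=> i i'; exists (eps i i'); exact: SU2_minor.
- by move=> P Pl Pw q; apply: SU2_word_span.
move=> a E; rewrite E; congr (_%:A).
have := congr1 (counit (SU2_hopf C)) E; rewrite linearZ /= rmorph1 [_ *: _]mulr1 => <-.
rewrite -[in RHS](comul1l (SU2_hopf C) t).
have bl : bilin (fun a b : SU2 => counit (SU2_hopf C) a *: b).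
  split=> [y d x x'|x d y y'] /=; first by rewrite linearP scalerDl scalerA.
  by rewrite scalerDr !scalerA mulrC.
have tD := lin_mapD (ctlift_linear bl).
suff key z : SU2_counit (haar_part z) =
    haar (tlift (fun a b : SU2 => counit (SU2_hopf C) a *: b) z) by exact: key.
elim/ctens_ind: z => [x y|x y IHx IHy].
  by rewrite haar_partE (ctliftE bl) !linearZ /= [LHS]mulrC.
by rewrite tD !linearD /= IHx IHy.
Qed.

Let Psi_unimod j k :
  \sum_s \sum_s' eps s s' *: (U s j * U s' k) = (eps j k)%:A.
Proof.
rewrite -SU2_det !sum2 /eps /= !scale0r !add0r addr0 scale1r scaleN1r.
by rewrite [U 1 j * _]SU2_mulC.
Qed.

(** Write Delta t = \sum x_i (x) y_i.  Invariance, and the lift of 1 (x) k, turn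
    the hypothesis into \sum h (k y_i) x_i = 0 for all k.  So the matrix
    N_ij = h (S(x_i) y_j) squares to zero, and its trace is
    h (\sum S(x_i) y_i), the counit of t. *)
Lemma haar_nondeg (t : SU2) :
  (forall k, haar (k * t) = 0) -> counit (SU2_hopf C) t = 0.
Proof.
move=> Ht; pose Sa := antipode (SU2_hopf C).
have bS : bilin (fun a b : SU2 => Sa a * b).
  split=> [y d x x'|x d y y'] /=; first by rewrite linearP mulrDl -scalerAl.
  by rewrite mulrDr -scalerAr.
have [n [x [y tE]]] := ctens_sum (Delta t).
have xy0 k : \sum_l haar (k * y l) *: x l = 0.
  have [l lk] := right_lift_ex SU2_comul_lr Psi_unimod k.
  have : haar_part ((1 ⊗ k) * Delta t) = 0.
    rewrite -lk mulr_suml linear_sum big1 //= => p _.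
    rewrite -mulrA haar_part_mull -rmorphM /= haar_left_inv Ht scale0r.
    by rewrite mulr0.
  rewrite tE mulr_sumr linear_sum /= => E; rewrite -[RHS]E; apply: eq_bigr => i _.
  by rewrite pureM mul1r haar_partE.
pose N := \matrix_(i, j) (haar (Sa (x i) * y j) : C).
have NN : N *m N = 0.
  apply/matrixP => i j; rewrite !mxE.
  transitivity (haar (Sa (\sum_l haar (Sa (x i) * y l) *: x l) * y j)).
    rewrite linear_sum mulr_suml linear_sum /=; apply: eq_bigr => l _.
    by rewrite !mxE linearZ /= -scalerAl linearZ.
  by rewrite xy0 linear0 mul0r linear0.
have := sqr0_mxtrace NN; rewrite /mxtrace => trN.
have := congr1 (@haar C) (antipodel (SU2_hopf C) t).
rewrite tE (@lin_map_sum _ _ _ _ _ _ (ctlift_linear bS)) linear_sum linearZ /=.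
rewrite haar1 [_ *: _]mulr1 => <-; rewrite -[RHS]trN; apply: eq_bigr => i _.
by rewrite (ctliftE bS) mxE.
Qed.

(** By duality only linear relations can obstruct [k]: a combination [s] of [ts]
    with h (k s) = 0 for all k has zero counit by [haar_nondeg]. *)
Lemma haar_approx_counit (ts : seq SU2) :
  exists k, forall t, t \in ts -> haar (k * t) = counit (SU2_hopf C) t.
Proof.
pose n := size ts; pose f (k : SU2) : 'rV[C]_n := \row_i haar (k * ts`_i).
have fl : linear f.
  move=> a u v; apply/rowP => i; rewrite !mxE mulrDl -scalerAl.
  by rewrite linearP.
pose fL := GRing.isLinear.Build C SU2 'rV[C]_n _ f fl.
pose F : {linear SU2 -> 'rV[C]_n} := HB.pack f fL.
pose b : 'rV[C]_n := \row_i counit (SU2_hopf C) ts`_i.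
have [d Hd|k kE] := @linear_image_rV _ _ _ F b.
  pose s := \sum_(i < n) d i 0 *: ts`_i.
  have bE : b *m d = (counit (SU2_hopf C) s)%:M.
    apply/matrixP => i j; rewrite !ord1 !mxE mulr1n linear_sum; apply: eq_bigr => l _.
    by rewrite mxE linearZ /= mulrC.
  have fE k : F k *m d = (haar (k * s))%:M.
    apply/matrixP => i j; rewrite !ord1 !mxE mulr1n mulr_sumr linear_sum; apply: eq_bigr => l _.
    by rewrite mxE -scalerAr linearZ /= mulrC.
  rewrite bE haar_nondeg ?raddf0 // => k; have := Hd k.
  by rewrite fE => /matrixP/(_ 0 0); rewrite !mxE.
exists k => t /(nthP 0)[i ilt <-].
by have /rowP/(_ (Ordinal ilt)) := kE; rewrite !mxE.
Qed.

End HaarSU2.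

(** * The quaternionic rows of the seven-sphere *)

Section Quaternions.
Variables (C : numClosedFieldType) (mu : C).
Hypothesis mu_unit : mu * mu^* = 1.
Local Notation SU2 := (SU2 C).
Local Notation U := (SU2_mx C).
Local Notation S7 := (S7 mu).
Local Notation rho := (coact (S7_comodule mu)).

Definition block_index (b j : 'I_2) : 'I_4 :=
  if b == 0 then lshift 2 j else rshift 2 j.
Definition zb (b j : 'I_2) : S7 := z mu (block_index b j).
Definition block_phase (b b' : 'I_2) : C :=
  if b == b' then 1 else if b == 0 then mu else mu^*.

Lemma lambda'_block b b' j k :
  lambda' mu (block_index b j) (block_index b' k) = block_phase b b'.
Proof.
have lj (i : 'I_2) : (lshift 2 i < 2)%N by rewrite /= ltn_ord.
have rj (i : 'I_2) : (rshift 2 i < 2)%N = false by rewrite /= ltnNge leq_addr.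
rewrite /lambda' /block_index /block_phase.
by elim/ord2P: b; elim/ord2P: b'; rewrite /= ?lj ?rj.
Qed.

Lemma block_phaseK b b' : block_phase b b' * block_phase b' b = 1.
Proof.
rewrite /block_phase; elim/ord2P: b; elim/ord2P: b'; rewrite /= ?mulr1 //.
by rewrite mulrC.
Qed.

Lemma zb_zz b b' j k : zb b j * zb b' k = block_phase b b' *: (zb b' k * zb b j).
Proof. by rewrite [LHS]z_zz lambda'_block. Qed.
Lemma zb_sz b b' j k :
  star (zb b j) * zb b' k = block_phase b' b *: (zb b' k * star (zb b j)).
Proof. by rewrite [LHS]z_bz lambda'_block. Qed.
Lemma zb_zs b b' j k :
  zb b j * star (zb b' k) = block_phase b' b *: (star (zb b' k) * zb b j).
Proof. by rewrite zb_sz scalerA block_phaseK scale1r. Qed.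
Lemma zb_ss b b' j k :
  star (zb b j) * star (zb b' k) = block_phase b b' *: (star (zb b' k) * star (zb b j)).
Proof. by rewrite [LHS]z_bb lambda'_block. Qed.

Lemma sum_block (V : zmodType) (F : 'I_4 -> V) :
  \sum_i F i = \sum_b \sum_j F (block_index b j).
Proof. by rewrite [RHS]sum2 (@big_split_ord _ _ _ 2 2). Qed.

(** For [s = (b, e)] the row of block [b] if [e = 0], and its quaternionic
    conjugate if [e = 1]: both are multiplied by U under the coaction. *)
Definition Psi (s : 'I_2 * 'I_2) (j : 'I_2) : S7 :=
  if s.2 == 0 then zb s.1 j
  else if j == 0 then - star (zb s.1 1) else star (zb s.1 0).

Definition Psi_phase (s s' : 'I_2 * 'I_2) : C :=
  if s.2 == s'.2 then block_phase s.1 s'.1 else block_phase s'.1 s.1.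

Lemma PsiC s s' j k : Psi s j * Psi s' k = Psi_phase s s' *: (Psi s' k * Psi s j).
Proof.
case: s s' => [b e] [b' e']; rewrite /Psi /Psi_phase /=.
elim/ord2P: e; elim/ord2P: e'; rewrite /=.
- exact: zb_zz.
- by case: ifP => _; rewrite ?mulrN ?mulNr zb_zs ?scalerN.
- by case: ifP => _; rewrite ?mulrN ?mulNr zb_sz ?scalerN.
- by do 2![case: ifP => _]; rewrite ?mulrN ?mulNr zb_ss ?scalerN.
Qed.

Lemma rho_zb b j : rho (zb b j) = \sum_k zb b k ⊗ U k j.
Proof.
rewrite [LHS]S7_coactE sum_block (bigD1 b) //= [X in _ + X]big1 ?addr0.
  apply: eq_bigr => k _; congr (_ ⊗ _); elim/ord2P: b.
    exact: (@block_mxEul _ 2 2 2 2).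
  exact: (@block_mxEdr _ 2 2 2 2).
move=> b' nb; rewrite big1 // => k _; rewrite (_ : SU2_block _ _ _ = 0) ?pure0r //.
elim/ord2P: b nb; elim/ord2P: b' => // _.
  by rewrite [LHS](@block_mxEdl _ 2 2 2 2) mxE.
by rewrite [LHS](@block_mxEur _ 2 2 2 2) mxE.
Qed.

Lemma rho_star p : rho (star p) = star (rho p).
Proof. exact: S7_coact_star. Qed.

Lemma rho_Psi s j : rho (Psi s j) = \sum_k Psi s k ⊗ U k j.
Proof.
case: s => b e; rewrite /Psi /=; elim/ord2P: e; first exact: rho_zb.
rewrite sum2; elim/ord2P: j; rewrite /= ?raddfN /= rho_star rho_zb sum2 starD !pure_star.
  rewrite !U0 U10 U11 starK opprD addrC -pureNl; congr (_ + _).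
  by rewrite pureNr.
rewrite !U0 U10 U11 starN starK addrC; congr (_ + _).
by rewrite pureNl pureNr.
Qed.

Definition Psi_form (s s' : 'I_2 * 'I_2) : C := if s.1 == s'.1 then eps s.2 s'.2 else 0.

Lemma sum_rows (V : zmodType) (F : 'I_2 * 'I_2 -> V) :
  \sum_s F s = F (0, 0) + F (0, 1) + (F (1, 0) + F (1, 1)).
Proof.
rewrite (eq_bigr (fun s => F (s.1, s.2))) => [|[b e] //].
by rewrite -(pair_bigA _ (fun b e => F (b, e))) !sum2.
Qed.

Lemma zb_sum : \sum_b \sum_j zb b j * star (zb b j) = 1.
Proof. by rewrite -(z_sum mu) sum_block. Qed.

Lemma Psi_unimod j k :
  \sum_s \sum_s' Psi_form s s' *: (Psi s j * Psi s' k) = (eps j k)%:A.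
Proof.
have sC b i l : star (zb b i) * zb b l = zb b l * star (zb b i).
  by rewrite zb_sz /block_phase eqxx scale1r.
have := zb_sum; rewrite !sum2 => zE.
rewrite !sum_rows /Psi_form /Psi /eps /=.
rewrite !scale0r !scaleN1r !scale1r !add0r !addr0.
elim/ord2P: j; elim/ord2P: k; rewrite /= ?mulrN ?mulNr ?opprK ?sC.
- by rewrite !addNr addr0 scale0r.
- by rewrite zE scale1r.
- by rewrite -!opprD [X in - (X + _)]addrC [X in - (_ + X)]addrC zE scaleN1r.
- by rewrite !subrr addr0 scale0r.
Qed.

Lemma Psi_word_span p : word_span (fun x : ('I_2 * 'I_2) * 'I_2 => Psi x.1 x.2) p.
Proof.
set W := word_span _.
have Wl a x y : W x -> W y -> W (a *: x + y) by exact: word_span_lin.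
have W1 : W 1 by exact: word_span1.
have W0 : W 0 by have := Wl (-1) _ _ W1 W1; rewrite scaleN1r addNr.
have WZ a x : W x -> W (a *: x) by move=> Wx; rewrite -[_ *: _]addr0; exact: Wl.
have WD x y : W x -> W y -> W (x + y) by move=> Wx Wy; rewrite -[x]scale1r; exact: Wl.
have WM x y : W x -> W y -> W (x * y) by exact: word_spanM.
have WPsi s j : W (Psi s j) by exact: (@word_span_gen _ _ _ _ (s, j)).
have Wz b j : W (zb b j) := WPsi (b, 0) j.
have Ws b j : W (star (zb b j)).
  elim/ord2P: j; first exact: (WPsi (b, 1) 1).
  by rewrite -[star _]opprK -scaleN1r; apply: WZ; exact: (WPsi (b, 1) 0).
have idx i : exists b j, i = block_index b j.
  by case: (@split_ordP 2 2 i) => j ->; [exists 0, j|exists 1, j].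
suff [] : W p /\ W (star p) by [].
elim/presented_ind: p => [i|a|x y [? ?] [? ?]|x y [? ?] [? ?]|x [? ?]].
- by have [b [j ->]] := idx i; split; [exact: (Wz b j)|exact: (Ws b j)].
- by rewrite starZ star1; split; exact: WZ.
- by rewrite starD; split; exact: WD.
- by rewrite starM; split; exact: WM.
- by rewrite starK.
Qed.

Definition S4_sub (p : S7) : Prop :=
  star_subalg (fun a => [\/ a = S4_alpha mu, a = S4_beta mu | a = S4_x mu]) p.

Let B := S4_sub.
Let B1 : B 1. Proof. exact: SS_one. Qed.
Let Blin a x y : B x -> B y -> B (a *: x + y). Proof. exact: SS_lin. Qed.
Let BM x y : B x -> B y -> B (x * y). Proof. exact: SS_mul. Qed.
Let B0 : B 0. Proof. by have := Blin (-1) B1 B1; rewrite scaleN1r addNr. Qed.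
Let BZ a x : B x -> B (a *: x).
Proof. by move=> Bx; rewrite -[_ *: _]addr0; exact: Blin. Qed.
Let BD x y : B x -> B y -> B (x + y).
Proof. by move=> Bx By; rewrite -[x]scale1r; exact: Blin. Qed.

Lemma minor_anti s s' : minor Psi s' s = - Psi_phase s' s *: minor Psi s s'.
Proof. by rewrite /minor !(PsiC s') -scalerBr scaleNr -scalerN opprB. Qed.

Let two_neq0 : (2 : C) != 0. Proof. by rewrite pnatr_eq0. Qed.
Let halfK (x : S7) : 2^-1 *: (2 *: x) = x.
Proof. by rewrite scalerK. Qed.
Let star2 (x : S7) : star (2 *: x) = 2 *: star x.
Proof. by rewrite starZ rmorph_nat. Qed.

Lemma minor_alpha : minor Psi (0, 0) (1, 1) = 2^-1 *: S4_alpha mu.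
Proof.
rewrite /S4_alpha halfK /minor /Psi /= mulrN opprK.
by congr (z mu _ * star (z mu _) + z mu _ * star (z mu _)); apply/val_inj.
Qed.
Lemma minor_beta : minor Psi (0, 0) (1, 0) = - 2^-1 *: S4_beta mu.
Proof.
rewrite scaleNr /S4_beta halfK /minor /Psi /= opprD opprK.
by congr (z mu _ * (z mu _) - z mu _ * (z mu _)); apply/val_inj.
Qed.
Lemma minor_star_alpha :
  minor Psi (0, 1) (1, 0) = - block_phase 1 0 *: (2^-1 *: star (S4_alpha mu)).
Proof.
rewrite /S4_alpha star2 halfK starD !starM !starK /minor /Psi /=.
rewrite !zb_sz !mulNr zb_sz -opprD -scalerDr scaleNr addrC; congr (- (_ *: _)).
by congr (z mu _ * star (z mu _) + z mu _ * star (z mu _)); apply/val_inj.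
Qed.
Lemma minor_star_beta :
  minor Psi (0, 1) (1, 1) = - block_phase 0 1 *: (2^-1 *: star (S4_beta mu)).
Proof.
rewrite /S4_beta star2 halfK starD starN !starM /minor /Psi /=.
rewrite !(mulNr, mulrN) opprK (zb_ss 0 1 1 0) (zb_ss 0 1 0 1) addrC.
rewrite -scalerBr scaleNr -scalerN; congr (_ *: _).
rewrite opprD opprK.
by congr (_ - _); congr (star (z mu _) * star (z mu _)); apply/val_inj.
Qed.

Let norm b := \sum_j zb b j * star (zb b j).
Lemma minor_norm b : minor Psi (b, 0) (b, 1) = norm b.
Proof. by rewrite /minor /norm /Psi sum2 /= mulrN opprK. Qed.
Lemma norm_sum : norm 0 + norm 1 = 1.
Proof. by rewrite -zb_sum sum2. Qed.
Lemma norm_diff : norm 0 - norm 1 = S4_x mu.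
Proof.
rewrite /norm !sum2 opprD addrA /S4_x.
by congr (z mu _ * star (z mu _) + z mu _ * star (z mu _) -
  z mu _ * star (z mu _) - z mu _ * star (z mu _)); apply/val_inj.
Qed.

(** Six minors determine the others up to phases: they are multiples of alpha,
    beta and their adjoints, and the norms of the two blocks, (1 + x) / 2 and
    (1 - x) / 2. *)
Lemma minor_S4 s s' : S4_sub (minor Psi s s').
Proof.
have Ba : B (S4_alpha mu) by apply: SS_gen; constructor 1.
have Bb : B (S4_beta mu) by apply: SS_gen; constructor 2.
have Bx : B (S4_x mu) by apply: SS_gen; constructor 3.
have norm0 : norm 0 = 2^-1 *: (1 + S4_x mu).
  by rewrite -norm_sum -norm_diff addrACA subrr addr0 -mulr2n -scaler_nat halfK.
have norm1 : norm 1 = 2^-1 *: (1 - S4_x mu).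
  rewrite -norm_sum -norm_diff opprB [X in X + (norm 1 - _)]addrC addrACA subrr addr0 -mulr2n.
  by rewrite -scaler_nat halfK.
have Bn b : B (minor Psi (b, 0) (b, 1)).
  rewrite minor_norm; elim/ord2P: b; rewrite ?norm0 ?norm1; apply/BZ/BD => //.
  by rewrite -scaleN1r; exact: BZ.
have sym t t' : B (minor Psi t t') -> B (minor Psi t' t).
  by move=> Bt; rewrite minor_anti; exact: BZ.
have diag t : B (minor Psi t t).
  have := PsiC t t 0 1; rewrite /Psi_phase /block_phase !eqxx scale1r /minor => ->.
  by rewrite subrr.
have M02 : B (minor Psi (0, 0) (1, 0)) by rewrite minor_beta; exact: BZ.
have M03 : B (minor Psi (0, 0) (1, 1)) by rewrite minor_alpha; exact: BZ.
have M12 : B (minor Psi (0, 1) (1, 0)) by rewrite minor_star_alpha; apply/BZ/BZ/SS_star.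
have M13 : B (minor Psi (0, 1) (1, 1)) by rewrite minor_star_beta; apply/BZ/BZ/SS_star.
case: s s' => [b e] [b' e'].
elim/ord2P: b; elim/ord2P: e; elim/ord2P: b'; elim/ord2P: e';
  first [exact: diag|exact: Bn|assumption|by apply: sym].
Qed.

(** The minor of two rows multiplied by U picks up the determinant of U. *)
Lemma rho_minor s s' : rho (minor Psi s s') = minor Psi s s' ⊗ 1.
Proof.
have E : minor Psi s s' = \sum_k \sum_l eps k l *: (Psi s k * Psi s' l).
  by rewrite !sum2 /eps /= !scale0r add0r addr0 scale1r scaleN1r.
rewrite {1}/minor rmorphB !rmorphM /= !rho_Psi !mulr_suml -sumrB E pure_suml.
apply: eq_bigr => k _; rewrite !mulr_sumr -sumrB pure_suml; apply: eq_bigr => l _.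
by rewrite !pureM -pureNr -pureDr [_ - _](SU2_minor C k l) pureZr pureZl.
Qed.

Lemma S4_coinv p : S4_sub p -> rho p = p ⊗ 1.
Proof.
have coZ a x : rho x = x ⊗ 1 -> rho (a *: x) = (a *: x) ⊗ 1.
  by move=> xE; rewrite linearZ /= xE pureZl.
elim=> [{}p|||{}p q _ IHp _ IHq|{}p _ IHp].
- case=> ->.
  + have -> : S4_alpha mu = 2 *: minor Psi (0, 0) (1, 1).
      by rewrite minor_alpha scalerA mulfV ?scale1r.
    exact/coZ/rho_minor.
  + have -> : S4_beta mu = - 2 *: minor Psi (0, 0) (1, 0).
      by rewrite minor_beta scalerA mulrNN mulfV ?scale1r.
    exact/coZ/rho_minor.
  + rewrite -norm_diff -!minor_norm raddfB /= !rho_minor -pureNl -pureDl.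
    by [].
- by rewrite rmorph1.
- by move=> a {}p q _ IHp _ IHq; rewrite linearP /= IHp IHq pureDl pureZl.
- by rewrite rmorphM /= IHp IHq pureM mulr1.
- by rewrite rho_star IHp pure_star star1.
Qed.

(** The conditional expectation onto the coinvariants. *)
Definition expect (p : S7) : S7 := haar_part (rho p).
Lemma expect_S4 p : S4_sub (expect p).
Proof.
apply: (haar_inv rho_Psi PsiC (B := S4_sub)) => //; first exact: minor_S4.
by move=> P Pl Pw q; exact: Psi_word_span.
Qed.
(** A coinvariant is its own average. *)
Lemma coinv_S4 p : rho p = p ⊗ 1 -> S4_sub p.
Proof.
move=> E; have := expect_S4 p; rewrite /expect E haar_partE haar1 scale1r.
by [].
Qed.

End Quaternions.

(** * Dual bases, the canonical map and flatness *)

Section TensSum.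
Variables (S : Type) (M N : zmodType) (ra : M -> S -> M) (la : S -> N -> N).

Lemma tens_sum (x : tens ra la) :
  exists l : seq (M * N), x = \sum_(p <- l) tpure ra la p.1 p.2.
Proof.
elim/tens_ind: x => [m n|x y [l1 ->] [l2 ->]].
  by exists [:: (m, n)]; rewrite big_seq1.
by exists (l1 ++ l2); rewrite big_cat.
Qed.

Lemma tpure_suml (I : Type) (r : seq I) (F : I -> M) n :
  tpure ra la (\sum_(i <- r) F i) n = \sum_(i <- r) tpure ra la (F i) n.
Proof.
by apply: (big_morph (fun m => tpure ra la m n)) => [m m'|]; [exact: tpureDl|exact: tpure0l].
Qed.
Lemma tpure_sumr (I : Type) (r : seq I) (F : I -> N) m :
  tpure ra la m (\sum_(i <- r) F i) = \sum_(i <- r) tpure ra la m (F i).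
Proof.
by apply: (big_morph (tpure ra la m)) => [n n'|]; [exact: tpureDr|exact: tpure0r].
Qed.

Lemma tlift0 (V : zmodType) (f : M -> N -> V) : balanced ra la f -> tlift f (0 : tens ra la) = 0.
Proof.
by move=> bf; apply: (addIr (tlift f (0 : tens ra la))); rewrite -(tliftD bf) !add0r.
Qed.
Lemma tlift_sum (V : zmodType) (f : M -> N -> V) (I : Type) (r : seq I) (F : I -> tens ra la) :
  balanced ra la f -> tlift f (\sum_(i <- r) F i) = \sum_(i <- r) tlift f (F i).
Proof. by move=> bf; apply: big_morph; [exact: tliftD|exact: tlift0]. Qed.

End TensSum.

Section Extension.
Variables (C : numClosedFieldType) (mu : C).
Hypothesis mu_unit : mu * mu^* = 1.
Local Notation SU2 := (SU2 C).
Local Notation P := (S7 mu).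
Local Notation B := (S4 mu).
Local Notation iota := (S4_incl mu).
Local Notation rho := (coact (S7_comodule mu)).

(** If h (k t) agrees with the counit on the H-components of rho p, then the
    average weighted by [k] returns p by the counit axiom. *)
Lemma expect_approx (ps : seq P) :
  exists k : SU2, forall p, p \in ps -> haar_part ((1 ⊗ k) * rho p) = p.
Proof.
have [ts Hts] : exists ts : seq SU2, forall p, p \in ps ->
    exists n (x : 'I_n -> P) (y : 'I_n -> SU2),
    rho p = \sum_i x i ⊗ y i /\ forall i, y i \in ts.
  elim: ps => [|p ps [ts IH]]; first by exists [::].
  have [n [x [y xy]]] := ctens_sum (rho p).
  exists ([seq y i | i <- enum 'I_n] ++ ts) => q; rewrite inE => /orP[/eqP->|/IH].
    exists n, x, y; split=> // i.
    by rewrite mem_cat (map_f y (mem_enum _ i)).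
  move=> [m [x' [y' [E yt]]]]; exists m, x', y'; split=> // i.
  by rewrite mem_cat yt orbT.
have [k Hk] := haar_approx_counit ts.
exists k => p /Hts[n [x [y [E yt]]]].
have bl := counit_bilinl P.
rewrite -[RHS](coact1 (S7_comodule mu)) E.
rewrite (@lin_map_sum _ _ _ _ _ _ (ctlift_linear bl)) mulr_sumr linear_sum.
apply: eq_bigr => i _ /=.
by rewrite pureM mul1r haar_partE Hk // (ctliftE bl).
Qed.

Definition expectB (p : P) : B :=
  exist _ (expect p) (introT (asboolP _) (expect_S4 mu_unit p)).
Lemma expectBE p : iota (expectB p) = expect p. Proof. by []. Qed.
Lemma iota_coinv b : rho (iota b) = iota b ⊗ 1.
Proof. by apply: S4_coinv; exact: (asboolP _ (valP b)). Qed.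

Lemma expectMr b (p : P) : expect (p * iota b) = expect p * iota b.
Proof. by rewrite /expect rmorphM /= iota_coinv haar_part_mulr. Qed.
Lemma expectD (p q : P) : expect (p + q : P) = expect p + expect q.
Proof. by rewrite /expect !linearD. Qed.
Lemma expect1 : expect (1 : P) = 1.
Proof. by rewrite /expect rmorph1 haar_partE haar1 scale1r. Qed.

Lemma iota_expectM (p q : P) : iota (expectB (p * q)) = haar_part (rho p * rho q).
Proof. by rewrite expectBE /expect rmorphM. Qed.

Lemma iota_inj : injective iota. Proof. exact: val_inj. Qed.

Let rightU := right_lift_ex (rho_Psi mu) (Psi_unimod mu).
Let leftU := left_lift_ex (rho_Psi mu) (Psi_unimod mu).

(** A lift \sum (e (x) 1) rho(q) of 1 (x) k turns the weighted average of rho p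
    into \sum e E(q p). *)
Lemma right_dual_basis (ps : seq P) : exists l : seq (P * P),
  forall p, p \in ps -> \sum_(q <- l) q.1 * iota (expectB (q.2 * p)) = p.
Proof.
have [k Hk] := expect_approx ps; have [l lk] := rightU k.
exists l => p /Hk; rewrite -lk mulr_suml linear_sum => pE; rewrite -[RHS]pE.
by apply: eq_bigr => q _; rewrite iota_expectM -mulrA [RHS]haar_part_mull.
Qed.

Lemma left_dual_basis (ps : seq P) : exists l : seq (P * P),
  forall p, p \in ps -> \sum_(q <- l) iota (expectB (p * q.1)) * q.2 = p.
Proof.
have [k Hk] := expect_approx ps; have [l lk] := leftU k.
exists l => p /Hk pE; rewrite -[RHS]pE.
have -> : (1 ⊗ k) * rho p = rho p * (1 ⊗ k).
  elim/ctens_ind: (rho p) => [x t|x y IHx IHy].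
    by rewrite !pureM mul1r mulr1 SU2_mulC.
  by rewrite mulrDl mulrDr IHx IHy.
rewrite -lk mulr_sumr linear_sum; apply: eq_bigr => q _.
by rewrite iota_expectM mulrA [RHS]haar_part_mulr.
Qed.

Lemma canonical_mapE p' p :
  ctens_map ( *%R p') idfun (rho p) = (p' ⊗ 1) * rho p.
Proof.
have ml : linear ( *%R p' : P -> P) by move=> c x y; rewrite mulrDr scalerAr.
have il : linear (idfun : SU2 -> SU2) by [].
elim/ctens_ind: (rho p) => [x t|x y IHx IHy].
  by rewrite (ctens_mapE ml il) pureM mul1r.
by rewrite (lin_mapD (ctens_map_linear ml il)) IHx IHy mulrDr.
Qed.

Let canb := canonical_map_balanced iota_coinv.

Lemma canonical_map_sum (l : seq (P * P)) :
  canonical_map (S7_comodule mu) (\sum_(p <- l) tpure _ _ p.1 p.2 : ext_square iota) =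
  \sum_(p <- l) (p.1 ⊗ 1) * rho p.2.
Proof.
rewrite /canonical_map (tlift_sum _ _ canb); apply: eq_bigr => p _.
by rewrite (tliftE canb) canonical_mapE.
Qed.

(** The dual basis expands \sum p_1 (x) p_2 as \sum c_q (x) q.2, with c_q the
    average of the image under the canonical map times rho q.1; hence the image
    determines the tensor. *)
Lemma canonical_map_inj : injective (@canonical_map _ _ _ _ (S7_comodule mu) B iota).
Proof.
suff ker0 (x : ext_square iota) : canonical_map (S7_comodule mu) x = 0 -> x = 0.
  move=> x y E; apply/eqP; rewrite -subr_eq0; apply/eqP/ker0.
  apply: (addIr (canonical_map (S7_comodule mu) y)).
  by rewrite /canonical_map -(tliftD canb) subrK add0r.
have [l ->] := tens_sum x; rewrite canonical_map_sum => E.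
have [d Hd] := left_dual_basis [seq p.2 | p <- l].
transitivity (\sum_(q <- d) tpure (fun (p : P) (b : B) => p * iota b)
    (fun (b : B) (p : P) => iota b * p)
    (haar_part ((\sum_(p <- l) (p.1 ⊗ 1) * rho p.2) * rho q.1)) q.2); last first.
  by rewrite E big1 // => q _; rewrite mul0r linear0 tpure0l.
under [RHS]eq_bigr => q _ do rewrite mulr_suml linear_sum /= tpure_suml.
rewrite exchange_big /= big_seq [RHS]big_seq; apply: eq_bigr => p pl.
rewrite -[in LHS](Hd p.2 (map_f _ pl)) tpure_sumr; apply: eq_bigr => q _.
rewrite -tpure_bal; congr tpure.
rewrite -[sval _]/(iota (expectB (p.2 * q.1))) iota_expectM -mulrA.
by rewrite [RHS]haar_part_mull.
Qed.

Lemma canonical_map_surj y :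
  exists x : ext_square iota, canonical_map (S7_comodule mu) x = y.
Proof.
elim/ctens_ind: y => [p t|_ _ [x <-] [y <-]]; last first.
  by exists (x + y); rewrite /canonical_map (tliftD canb).
have [l lt] := rightU t.
exists (\sum_(q <- [seq (p * q.1, q.2) | q <- l]) tpure _ _ q.1 q.2).
rewrite canonical_map_sum big_map /=.
have -> : p ⊗ t = (p ⊗ 1) * (1 ⊗ t) by rewrite pureM mulr1 mul1r.
rewrite -lt mulr_sumr; apply: eq_bigr => q _.
by rewrite mulrA pureM mulr1.
Qed.

Theorem S7_hopf_galois : hopf_galois (S7_comodule mu) iota.
Proof.
split; first exact: iota_inj.
  move=> p; split=> [[b <-]|/(coinv_S4 mu_unit) Sp]; first exact: iota_coinv.
  by exists (exist _ p (introT (asboolP _) Sp)).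
have [inv invK] := choice canonical_map_surj.
by exists inv => // x; apply: canonical_map_inj.
Qed.

Section Flat.
Variable N : lmodType B.

Lemma expect_contract_balanced (q : P) :
  balanced (fun (p : P) (b : B) => p * iota b) (fun (b : B) (n : N) => b *: n)
    (fun p n => expectB (q * p) *: n).
Proof.
split=> [n p p'|p n n'|p b n]; last 1 first.
- rewrite scalerA; congr (_ *: _); apply: iota_inj.
  by rewrite rmorphM !expectBE mulrA expectMr.
- rewrite -scalerDl; congr (_ *: _); apply: iota_inj.
  by rewrite rmorphD !expectBE mulrDr expectD.
- by rewrite scalerDr.
Qed.

Definition expect_contract (q : P) (x : ext_tens iota N) : N :=
  tlift (fun p n => expectB (q * p) *: n) x.

Lemma expect_contractE q p n : expect_contract q (tpure _ _ p n) = expectB (q * p) *: n.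
Proof. exact: (tliftE (expect_contract_balanced q)). Qed.

(** The coefficients in N of a tensor: this is what makes exactness of N
    pass to the tensor product. *)
Lemma ext_tens_dual_basis (x : ext_tens iota N) : exists l : seq (P * P),
  x = \sum_(q <- l) tpure _ _ q.1 (expect_contract q.2 x).
Proof.
have [l ->] := tens_sum x.
have [d Hd] := right_dual_basis [seq p.1 | p <- l].
exists d; rewrite {1}big_seq.
under [RHS]eq_bigr => q _.
  rewrite /expect_contract (tlift_sum _ _ (expect_contract_balanced q.2)) tpure_sumr.
  under eq_bigr => p _ do
    rewrite (tliftE (expect_contract_balanced q.2)) -tpure_bal.
  over.
rewrite exchange_big /= [RHS]big_seq; apply: eq_bigr => p pl.
by rewrite -tpure_suml (Hd p.1 (map_f _ pl)).
Qed.

End Flat.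

Lemma ext_tens_mapD (N N' : lmodType B) (f : {linear N -> N'}) (y z : ext_tens iota N) :
  ext_tens_map f (y + z) = ext_tens_map f y + ext_tens_map f z.
Proof. exact: (tliftD (ext_tens_map_balanced iota f)). Qed.

Lemma expect_contract_map (N N' : lmodType B) (f : {linear N -> N'}) q (x : ext_tens iota N) :
  expect_contract q (ext_tens_map f x) = f (expect_contract q x).
Proof.
have eD (M : lmodType B) (y z : ext_tens iota M) :
  expect_contract q (y + z) = expect_contract q y + expect_contract q z.
  exact: (tliftD (expect_contract_balanced M q)).
elim/tens_ind: x => [p n|x y IHx IHy]; last by rewrite ext_tens_mapD !eD linearD /= IHx IHy.
rewrite /ext_tens_map (tliftE (ext_tens_map_balanced iota f)).
by rewrite !expect_contractE linearZ.
Qed.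

(** An element of the kernel is lifted coefficient by coefficient; for
    faithfulness, contraction with 1 recovers n from 1 (x) n. *)
Theorem S7_faithfully_flat : faithfully_flat iota.
Proof.
split=> [N1 N2 N3 f g fg x|N1 N2 f g fg n].
  have bf := ext_tens_map_balanced iota f; have bg := ext_tens_map_balanced iota g.
  split=> [gx0|[u <-]].
    have [l xE] := ext_tens_dual_basis x.
    have /choice[u uE] (q : P) : exists m, f m = expect_contract q x.
      apply/fg; rewrite -expect_contract_map gx0.
      exact: (tlift0 (expect_contract_balanced _ q)).
    exists (\sum_(q <- l) tpure _ _ q.1 (u q.2)).
    rewrite [RHS]xE /ext_tens_map (tlift_sum _ _ bf); apply: eq_bigr => q _.
    by rewrite (tliftE bf) uE.
  elim/tens_ind: u => [p n|u v IHu IHv].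
    rewrite /ext_tens_map (tliftE bf) (tliftE bg) (_ : g (f n) = 0) ?tpure0r //.
    by apply/fg; exists n.
  by rewrite !ext_tens_mapD IHu IHv addr0.
have := congr1 (expect_contract 1) (fg (tpure _ _ 1 n)).
rewrite !expect_contract_map !expect_contractE (_ : expectB _ = 1) ?scale1r //.
by apply: iota_inj; rewrite expectBE mulr1 expect1.
Qed.

End Extension.

(** * Vector fields and torus translations on SU(2) *)

Section DualNumbers.
Variable F : comNzRingType.

(** The dual number a + b epsilon as a triangular matrix. *)
Definition dual_mx (a b : F) : 'M[F]_2 := a%:M + b *: delta_mx 0 1.

Lemma dual_mxM a b c d : dual_mx a b * dual_mx c d = dual_mx (a * c) (a * d + b * c).
Proof.
apply/matrixP => i j; rewrite !mxE sum2 !mxE.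
elim/ord2P: i; elim/ord2P: j; rewrite /= ?mulr1n ?mulr0n; ring.
Qed.
Lemma dual_mxD a b c d : dual_mx a b + dual_mx c d = dual_mx (a + c) (b + d).
Proof. by rewrite /dual_mx raddfD /= scalerDl addrACA. Qed.
Lemma dual_mx_scalar a : dual_mx a 0 = a%:M.
Proof. by rewrite /dual_mx scale0r addr0. Qed.
Lemma dual_mx01 a b : dual_mx a b 0 1 = b.
Proof. by rewrite !mxE /= mulr0n add0r mulr1. Qed.

End DualNumbers.

Section Derivations.
Variable C : numClosedFieldType.
Local Notation SU2 := (SU2 C).
Local Notation U := (SU2_mx C).
Local Notation Delta := (comul (SU2_hopf C)).
Local Notation ep := (counit (SU2_hopf C)).

(** A tangent vector at the identity is a homomorphism to the dual numbers that
    lifts the counit; vanishing of the trace is the determinant relation. *)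
Lemma tangent_ex (xi : 'I_2 -> 'I_2 -> C) : xi 0 0 + xi 1 1 = 0 ->
  exists X : SU2 -> C^o, [/\ linear X, forall s t, X (s * t) = ep s * X t + X s * ep t &
    forall i j, X (U i j) = xi j i].
Proof.
move=> trxi.
pose u i j : 'M[C]_2 := dual_mx (i == j)%:R (xi j i).
pose v b := u 0 b; pose v' (b : 'I_2) := if b == 0 then u 1 1 else - u 1 0.
have dc (a b c d : C) : dual_mx a b * dual_mx c d = dual_mx c d * dual_mx a b.
  by rewrite !dual_mxM; congr dual_mx; ring.
have iotau c i j : (c%:M : 'M[C]_2) * u i j = u i j * c%:M.
  by rewrite -dual_mx_scalar dc.
have uu i j k l : u i j * u k l = u k l * u i j by exact: dc.
have iv c b : (c%:M : 'M[C]_2) * v b = v b * c%:M by exact: iotau.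
have iv' c b : (c%:M : 'M[C]_2) * v' b = v' b * c%:M.
  by rewrite /v'; case: ifP => _; rewrite ?mulrN ?mulNr iotau.
have uv' i j b : u i j * v' b = v' b * u i j.
  by rewrite /v'; case: ifP => _; rewrite ?mulrN ?mulNr uu.
have sat : forall x y, SU2_pres C x y ->
    dbl_eval (@scalar_mx C 2) v v' x = dbl_eval (@scalar_mx C 2) v v' y.
  apply: SU2_alg_sat => //.
  - by move=> b c; exact: uu.
  - by move=> b c; exact: uv'.
  - move=> b c; have -> : v' b = if b == 0 then u 1 1 else - u 1 0 by [].
    by case: ifP => _; rewrite ?mulrN ?mulNr uv'.
  - rewrite /v /v' /= mulrN !dual_mxM /= !(mul1r, mul0r, mulr1, mulr0, add0r, addr0).
    by rewrite [dual_mx 0 0]dual_mx_scalar raddf0 subr0 addrC trxi dual_mx_scalar.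
pose L := alg_lift (pr := SU2_pres C) (@scalar_mx C 2) v v'.
have LM x y : L (x * y) = L x * L y by exact: (alg_liftM iv iv' sat).
have LD x y : L (x + y) = L x + L y by exact: (alg_liftD iv iv' sat).
have LZ c x : L (c *: x) = c%:M * L x by exact: (alg_liftZ iv iv' sat).
have L1 : L 1 = 1 := alg_lift1 iv iv' sat.
have LU i j : L (U i j) = u i j.
  have Lw b : L (w C b) = v b := alg_lift_gen iv iv' sat b.
  have Lws b : L (star (w C b)) = v' b := alg_lift_star iv iv' sat b.
  elim/ord2P: i; first by rewrite U0 Lw.
  elim/ord2P: j; rewrite ?U10 ?U11 ?Lws //.
  rewrite -scaleN1r LZ Lws /v' /= raddfN mulrN mulNr opprK.
  by rewrite mul1r.
pose X t : C := L t 0 1.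
have LE t : L t = dual_mx (ep t) (X t).
  elim/SU2_matrix_ind: t => [|a x y Ex Ey|x y Ex Ey|a b].
  - by rewrite /X L1 rmorph1 -[1 in LHS]dual_mx_scalar !mxE.
  - have E : L (a *: x + y) = dual_mx (ep (a *: x + y)) (a * X x + X y).
      by rewrite LD LZ Ex Ey -dual_mx_scalar dual_mxM mul0r addr0
         dual_mxD linearP.
    by rewrite /X E dual_mx01.
  - have E : L (x * y) = dual_mx (ep (x * y)) (ep x * X y + X x * ep y).
      by rewrite LM Ex Ey dual_mxM rmorphM.
    by rewrite /X E dual_mx01.
  - by rewrite /X LU dual_mx01 [ep _]SU2_counitE.
exists X; split=> [a x y|x y|i j].
- by rewrite {1}/X LD LZ !LE -dual_mx_scalar dual_mxM dual_mxD dual_mx01 mul0r addr0.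
- by rewrite {1}/X LM !LE dual_mxM dual_mx01.
- by rewrite /X LU dual_mx01.
Qed.

Definition derivation (D : SU2 -> SU2) :=
  linear D /\ forall s t, D (s * t) = s * D t + D s * t.

Lemma derivation1 D : derivation D -> D 1 = 0.
Proof.
move=> [_ DM]; have := DM 1 1; rewrite !mul1r mulr1 => E.
by apply: (addIr (D 1)); rewrite -E add0r.
Qed.

Lemma derivation_ext D E : derivation D -> derivation E ->
  (forall i j, D (U i j) = E (U i j)) -> D =1 E.
Proof.
move=> dD dE DE t; have [Dl DM] := dD; have [El EM] := dE.
elim/SU2_matrix_ind: t => [|a x y Ex Ey|x y Ex Ey|a b].
- by rewrite !derivation1.
- by rewrite Dl El Ex Ey.
- by rewrite DM EM Ex Ey.
- exact: DE.
Qed.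

Lemma derivation_comm D E : derivation D -> derivation E ->
  derivation (fun t => D (E t) - E (D t)).
Proof.
move=> [Dl DM] [El EM]; split=> [a x y|s t].
  by rewrite El Dl Dl El scalerBr opprD addrACA.
rewrite DM EM (lin_mapD Dl) (lin_mapD El) !DM !EM mulrBr mulrBl.
move: (s * D (E t)) (D s * E t) (E s * D t) (D (E s) * t) (s * E (D t)) (E (D s) * t).
move=> a b c d e f; rewrite !opprD (AC ((2*2)*(2*2)) ((1*5)*(4*8)*((2*7)*(3*6)))) /=.
by rewrite !subrr !addr0.
Qed.

(** The invariant vector field (X (x) id) Delta of the tangent vector X; its
    integrals are zero because h (x) id of Delta t is a constant, which X kills. *)
Lemma SU2_derivation_ex (xi : 'I_2 -> 'I_2 -> C) : xi 0 0 + xi 1 1 = 0 ->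
  exists D : SU2 -> SU2, [/\ derivation D,
    forall i j, D (U i j) = \sum_k xi k i *: U k j & forall t, haar (D t) = 0].
Proof.
move=> /tangent_ex[X [Xl XM XU]].
have X1 : X 1 = 0.
  have := XM 1 1; rewrite !rmorph1 !mul1r mulr1 => E.
  by apply: (addIr (X 1)); rewrite -E add0r.
have bX : bilin (fun a b : SU2 => X a *: b).
  split=> [t a s s'|s a t t'] /=; first by rewrite Xl scalerDl scalerA.
  by rewrite scalerDr !scalerA mulrC.
have be : bilin (fun a b : SU2 => ep a *: b).
  split=> [t a s s'|s a t t'] /=; first by rewrite linearP scalerDl scalerA.
  by rewrite scalerDr !scalerA mulrC.
pose DX (z : (SU2 ⊗ SU2)%type) := tlift (fun a b : SU2 => X a *: b) z.
pose DE (z : (SU2 ⊗ SU2)%type) := tlift (fun a b : SU2 => ep a *: b) z.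
have XD z w : DX (z + w) = DX z + DX w by exact: (lin_mapD (ctlift_linear bX)).
have ED z w : DE (z + w) = DE z + DE w by exact: (lin_mapD (ctlift_linear be)).
have DXM z z' : DX (z * z') = DE z * DX z' + DX z * DE z'.
  elim/ctens_ind: z => [a b|x y IHx IHy]; last first.
    by rewrite mulrDl !(XD, ED) IHx IHy !mulrDl addrACA.
  elim/ctens_ind: z' => [a' b'|x y IHx IHy]; last first.
    by rewrite mulrDr !(XD, ED) IHx IHy !mulrDr addrACA.
  rewrite pureM /DX /DE !(ctliftE bX) !(ctliftE be) XM scalerDl.
  by rewrite -!scalerAl -!scalerAr !scalerA.
exists (fun t => DX (Delta t)); split=> [|i j|t].
- split=> [a x y|s t]; first by rewrite linearP /= [LHS](ctlift_linear bX).
  by rewrite rmorphM DXM /DE !comul1l.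
- rewrite SU2_comul_lr /DX (@lin_map_sum _ _ _ _ _ _ (ctlift_linear bX)).
  by apply: eq_bigr => k _; rewrite (ctliftE bX) XU.
- have E z : haar (DX z) = X (haar_part z).
    elim/ctens_ind: z => [x y|x y IHx IHy].
      by rewrite haar_partE /DX (ctliftE bX) linearZ (lin_mapZ _ _ Xl) /= [LHS]mulrC.
    by rewrite XD !linearD /= IHx IHy (lin_mapD Xl).
  by rewrite E haar_left_inv (lin_mapZ _ _ Xl) X1 scaler0.
Qed.

End Derivations.

Section Torus.
Variable C : numClosedFieldType.
Local Notation SU2 := (SU2 C).
Local Notation U := (SU2_mx C).

Definition torus_wt (q : C) (j : 'I_2) : C := if j == 0 then q else q^*.
(** Right translation by diag(q, q^-1), as it acts on functions. *)
Definition torus (q : C) : SU2 -> SU2 := pres_lift (fun b => torus_wt q b *: w C b).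

Variable q : C.
Hypothesis q1 : q * q^* = 1.

Let sat : satisfies (SU2_pres C) (fun b => torus_wt q b *: w C b).
Proof.
apply: SU2_satisfies; first exact: SU2_mulC.
rewrite -SU2_sum; apply: eq_bigr => b _; rewrite starZ -scalerAl -scalerAr scalerA.
by rewrite /torus_wt; case: ifP => _; rewrite ?conjCK ?[q^* * q]mulrC q1 scale1r.
Qed.

Lemma torus_linear : linear (torus q). Proof. exact: (pres_lift_linear sat). Qed.
Lemma torus_monoid : monoid_morphism (torus q).
Proof. exact: (pres_lift_monoid sat). Qed.

Lemma torusU i j : torus q (U i j) = torus_wt q j *: U i j.
Proof.
have tw b : torus q (w C b) = torus_wt q b *: w C b := pres_lift_gen sat b.
have ts t : torus q (star t) = star (torus q t) := pres_lift_star sat t.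
elim/ord2P: i; first by rewrite U0 tw.
elim/ord2P: j; rewrite ?U10 ?U11.
  by rewrite -scaleN1r (lin_mapZ _ _ torus_linear) ts tw starZ /torus_wt /= conjCK
     !scalerA mulrC.
by rewrite ts tw starZ.
Qed.

(** Left and right translations commute. *)
Lemma torus_derivation (xi : 'I_2 -> 'I_2 -> C) D : derivation D ->
  (forall i j, D (U i j) = \sum_k xi k i *: U k j) ->
  forall t, D (torus q t) = torus q (D t).
Proof.
move=> dD DU t; have [Dl DM] := dD; have [T1 TM] := torus_monoid.
have Tl := torus_linear.
elim/SU2_matrix_ind: t => [|a x y Ex Ey|x y Ex Ey|i j].
- by rewrite T1 !derivation1 // (lin_map0 Tl).
- by rewrite Tl !Dl Tl Ex Ey.
- by rewrite TM !DM (lin_mapD Tl) !TM Ex Ey.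
- rewrite torusU (lin_mapZ _ _ Dl) DU scaler_sumr (@lin_map_sum _ _ _ _ _ _ Tl).
  by apply: eq_bigr => k _; rewrite (lin_mapZ _ _ Tl) torusU !scalerA mulrC.
Qed.

(** A word with nonzero integral has as many letters in the first column as in
    the second, and the weights cancel. *)
Lemma haar_torus t : haar (torus q t) = haar t.
Proof.
have [T1 TM] := torus_monoid; have Tl := torus_linear.
apply: (@SU2_word_span C t (fun t => haar (torus q t) = haar t)) => [a x y Ex Ey|l].
  by rewrite Tl !linearP /= Ex Ey.
rewrite -/(SU2_word C l).
have -> : torus q (SU2_word C l) =
    (q ^+ (count_mem (0, 0) l + count_mem (1, 0) l) *
     q^* ^+ (count_mem (0, 1) l + count_mem (1, 1) l)) *: SU2_word C l.
  elim: l => [|[i j] l IH]; first by rewrite /SU2_word big_nil T1 mulr1 scale1r.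
  rewrite /SU2_word big_cons TM torusU -/(SU2_word C l) IH -scalerAl -scalerAr scalerA.
  congr (_ *: _); rewrite /torus_wt.
  by elim/ord2P: i; elim/ord2P: j; rewrite /= ?add0n ?add1n ?addSn ?addnS exprS; ring.
rewrite linearZ /= haar_word /haar_table.
case: andP => [[/eqP-> /eqP->]|_]; last by rewrite [LHS]mulr0.
by rewrite addnC -exprMn q1 expr1n [LHS]mul1r.
Qed.

End Torus.

Section TorusAction.
Variable C : numClosedFieldType.

Lemma torusM (q r : C) : q * q^* = 1 -> r * r^* = 1 ->
  forall t, torus q (torus r t) = torus (q * r) t.
Proof.
move=> q1 r1 t.
have qr1 : (q * r) * (q * r)^* = 1 by rewrite rmorphM mulrACA q1 r1 mulr1.
have [Q1 QM] := torus_monoid q1; have [R1 RM] := torus_monoid r1.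
have [S1 SM] := torus_monoid qr1.
have Ql := torus_linear q1; have Rl := torus_linear r1; have Sl := torus_linear qr1.
elim/SU2_matrix_ind: t => [|a x y Ex Ey|x y Ex Ey|i j].
- by rewrite R1 Q1 S1.
- by rewrite Rl Ql Sl Ex Ey.
- by rewrite RM QM SM Ex Ey.
- rewrite !torusU // (lin_mapZ _ _ Ql) torusU // scalerA /torus_wt.
  by case: ifP => _; rewrite ?rmorphM [in LHS]mulrC.
Qed.

Lemma torus1 (t : SU2 C) : torus 1 t = t.
Proof.
have q1 : (1 : C) * 1^* = 1 by rewrite rmorph1 mulr1.
have [Q1 QM] := torus_monoid q1; have Ql := torus_linear q1.
elim/SU2_matrix_ind: t => [|a x y Ex Ey|x y Ex Ey|i j].
- exact: Q1.
- by rewrite Ql Ex Ey.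
- by rewrite QM Ex Ey.
- by rewrite torusU // /torus_wt rmorph1; case: ifP; rewrite scale1r.
Qed.

End TorusAction.

(** * Twisted Laurent operators *)

Lemma S7_star_ind (C : numClosedFieldType) (mu : C) (R : S7 mu -> Prop) : R 1 ->
  (forall c x y, R x -> R y -> R (c *: x + y)) -> (forall x y, R x -> R y -> R (x * y)) ->
  (forall i, R (z mu i)) -> (forall i, R (star (z mu i))) -> forall x, R x.
Proof.
move=> R1 Rl RM Rz Rs x.
have R0 : R 0 by have := Rl (-1) 1 1 R1 R1; rewrite scaleN1r addNr.
have RZ c y : R y -> R (c *: y) by move=> Ry; rewrite -[_ *: _]addr0; exact: Rl.
have RD y y' : R y -> R y' -> R (y + y') by move=> Ry Ry'; rewrite -[y]scale1r; exact: Rl.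
suff [] : R x /\ R (star x) by [].
elim/presented_ind: x => [i|a|x y [? ?] [? ?]|x y [? ?] [? ?]|x [? ?]].
- by split; [exact: (Rz i)|exact: (Rs i)].
- by rewrite starZ star1; split; exact: RZ.
- by rewrite starD; split; exact: RD.
- by rewrite starM; split; exact: RM.
- by rewrite starK.
Qed.

Section Laurent.
Variables (K : pzRingType) (s : int -> K -> K).
Hypothesis s_add : forall i, {morph s i : x y / x + y}.
Hypothesis s_mul : forall i, {morph s i : x y / x * y}.
Hypothesis s_one : forall i, s i 1 = 1.
Hypothesis s_id : forall x, s 0 x = x.
Hypothesis s_comp : forall i j x, s i (s j x) = s (i + j) x.

Fact mon_additive k n : {morph (fun (f : int -> K) i => s i k * f (i - n)) : f g / f + g}.
Proof. by move=> f g; apply/funext => i; exact: mulrDr. Qed.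
(** The operator k T^n on sequences, where T is the shift and T^n l = s (-n) l T^n. *)
Definition mon k n : endo (int -> K) := Endo (mon_additive k n).

Lemma monE k n f i : mon k n f i = s i k * f (i - n).
Proof. by []. Qed.

Lemma monM k m l n : mon k m * mon l n = mon (k * s (- m) l) (m + n).
Proof.
apply: endo_ext => f; apply/funext => i; rewrite endoME !monE s_mul s_comp mulrA.
by rewrite opprD addrA.
Qed.
Lemma monD k l n : mon (k + l) n = mon k n + mon l n.
Proof.
by apply: endo_ext => f; apply/funext => i; rewrite endoDE !monE s_add mulrDl.
Qed.
Lemma mon0 n : mon 0 n = 0.
Proof. by apply: (addIr (mon 0 n)); rewrite -monD !add0r. Qed.
Lemma monN k n : mon (- k) n = - mon k n.
Proof. by apply: (addIr (mon k n)); rewrite -monD !addNr mon0. Qed.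
Lemma mon1 : mon 1 0 = 1.
Proof.
by apply: endo_ext => f; apply/funext => i; rewrite monE s_one mul1r subr0.
Qed.

(** The twisted Laurent ring generated by K and T, as operators. *)
Inductive laurent : endo (int -> K) -> Prop :=
  | Laurent_mon k n : laurent (mon k n)
  | Laurent_add x y : laurent x -> laurent y -> laurent (x + y).

Lemma laurentN x : laurent x -> laurent (- x).
Proof.
elim=> [k n|{}x y _ IHx _ IHy]; first by rewrite -monN; exact: Laurent_mon.
by rewrite opprD; exact: Laurent_add.
Qed.
Lemma laurentM x y : laurent x -> laurent y -> laurent (x * y).
Proof.
move=> Lx Ly; elim: Lx => [k m|{}x x' _ IHx _ IHx']; last first.
  by rewrite mulrDl; exact: Laurent_add.
elim: Ly => [l n|{}y y' _ IHy _ IHy']; last by rewrite mulrDr; exact: Laurent_add.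
by rewrite monM; exact: Laurent_mon.
Qed.

Definition kronecker : int -> K := fun i => if i == 0 then 1 else 0.
(** The coefficient of T^0 of a Laurent operator is its value at 0 on the unit
    sequence. *)
Definition constant_term (x : endo (int -> K)) : K := x kronecker 0.

Lemma constant_term_mon k n : constant_term (mon k n) = if n == 0 then k else 0.
Proof.
rewrite /constant_term monE s_id /kronecker add0r oppr_eq0.
by case: ifP; rewrite ?mulr1 ?mulr0.
Qed.
Lemma constant_termD x y : constant_term (x + y) = constant_term x + constant_term y.
Proof. by []. Qed.

(** (k T^m) (l T^n) and (l T^n) (k T^m) have constant terms only if m + n = 0,
    and these differ by a twist, which [t] does not see. *)
Lemma constant_term_trace (Z : zmodType) (t : K -> Z) :
  {morph t : x y / x + y} -> (forall x y, t (x * y) = t (y * x)) ->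
  (forall i x, t (s i x) = t x) -> forall x y, laurent x -> laurent y ->
  t (constant_term (x * y)) = t (constant_term (y * x)).
Proof.
move=> tD tM ts x y Lx Ly; elim: Lx => [k m|{}x x' _ IHx _ IHx']; last first.
  by rewrite mulrDl mulrDr !constant_termD !tD IHx IHx'.
elim: Ly => [l n|{}y y' _ IHy _ IHy']; last first.
  by rewrite mulrDl mulrDr !constant_termD !tD IHy IHy'.
rewrite !monM !constant_term_mon [n + m]addrC.
have [mn|//] := eqVneq (m + n) 0.
have -> : n = - m by apply: (addrI m); rewrite mn subrr.
by rewrite opprK -(ts (- m) (l * _)) s_mul s_comp addNr s_id tM.
Qed.

Section Pointwise.
Variable D : K -> K.
Hypothesis D_add : {morph D : x y / x + y}.

Fact pointwise_additive : {morph (fun (f : int -> K) i => D (f i)) : f g / f + g}.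
Proof. by move=> f g; apply/funext => i; exact: D_add. Qed.
(** A derivation of K commuting with the twist acts on Laurent operators by the
    commutator with its pointwise extension. *)
Definition pointwise : endo (int -> K) := Endo pointwise_additive.

Hypothesis D_mul : forall x y, D (x * y) = x * D y + D x * y.
Hypothesis D_s : forall i x, D (s i x) = s i (D x).

Lemma pointwise_mon k n : pointwise * mon k n - mon k n * pointwise = mon (D k) n.
Proof.
apply: endo_ext => f; apply/funext => i.
rewrite -[LHS]/(D (s i k * f (i - n)) - s i k * D (f (i - n))) monE.
by rewrite D_mul D_s addrC addKr.
Qed.

Lemma laurent_pointwise x : laurent x -> laurent (pointwise * x - x * pointwise).
Proof.
elim=> [k n|{}x y _ IHx _ IHy]; first by rewrite pointwise_mon; exact: Laurent_mon.
by rewrite mulrDl mulrDr opprD addrACA; exact: Laurent_add.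
Qed.

Lemma constant_term_pointwise (x : endo (int -> K)) :
  constant_term (pointwise * x - x * pointwise) = D (constant_term x).
Proof.
have D1 : D 1 = 0.
  have := D_mul 1 1; rewrite mul1r !mulr1 mul1r => E.
  by apply: (addIr (D 1)); rewrite -E add0r.
have D0 : D 0 = 0 by apply: (addIr (D 0)); rewrite -D_add !add0r.
have -> : constant_term (pointwise * x - x * pointwise) =
  D (constant_term x) - x (pointwise kronecker) 0 by [].
have -> : pointwise kronecker = 0.
  apply/funext => i; rewrite -[LHS]/(D (kronecker i)) /kronecker.
  by case: (i == 0).
by rewrite endo0 subr0.
Qed.

End Pointwise.

Section Representation.
Variables (C : numClosedFieldType) (mu : C) (sc : {rmorphism C -> K}).
Hypothesis mu1 : mu * mu^* = 1.
Hypothesis KC : forall x y : K, x * y = y * x.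
Hypothesis s_sc : forall i c, s i (sc c) = sc c.

Definition weight (k : K) (w : int) := forall j, s j k = sc (mu ^ (w * j)) * k.

Let mu0 : mu != 0.
Proof. by apply: contra_eq_neq mu1 => ->; rewrite mul0r eq_sym oner_eq0. Qed.

(** The phase comes from moving the coefficient of weight w past T^m and that
    of weight w' past T^n. *)
Lemma mon_comm k n w l m w' : weight k w -> weight l w' ->
  mon k n * mon l m = mon (sc (mu ^ (w * m - w' * n))) 0 * (mon l m * mon k n).
Proof.
move=> kw lw; rewrite !monM kw lw add0r oppr0 s_id [n + m]addrC.
have <- : mu ^ (w * m - w' * n) * mu ^ (w * - m) = mu ^ (w' * - n).
  by rewrite -expfzDr // !mulrN addrAC subrr add0r.
congr mon; rewrite rmorphM [k * _]KC -!mulrA; congr (_ * _).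
by rewrite mulrA [_ * l]KC -mulrA.
Qed.

Fact scalar_mon_zmod : zmod_morphism (fun c : C => mon (sc c) 0).
Proof. by move=> a b; rewrite rmorphB monD monN. Qed.
Fact scalar_mon_monoid : monoid_morphism (fun c : C => mon (sc c) 0).
Proof.
split=> [|a b]; first by rewrite rmorph1 mon1.
by rewrite monM addr0 s_sc rmorphM.
Qed.
Definition scalar_mon (c : C) := mon (sc c) 0.
HB.instance Definition _ :=
  GRing.isZmodMorphism.Build C (endo (int -> K)) scalar_mon scalar_mon_zmod.
HB.instance Definition _ :=
  GRing.isMonoidMorphism.Build C (endo (int -> K)) scalar_mon scalar_mon_monoid.

Lemma scalar_monC c k n : scalar_mon c * mon k n = mon k n * scalar_mon c.
Proof. by rewrite !monM !s_sc oppr0 s_id add0r addr0 KC. Qed.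

Definition zwt (i : 'I_4) : int := if (i < 2)%N then 1 else 0.
Variables k k' : 'I_4 -> K.
Hypothesis k_wt : forall i, weight (k i) (zwt i).
Hypothesis k'_wt : forall i, weight (k' i) (- zwt i).
Hypothesis k_sum : \sum_i k i * k' i = 1.

(** The first block gets weight 1 and degree 0, the second weight 0 and degree 1,
    so that the phases of [mon_comm] are those of the seven-sphere. *)
Definition rep_z i := mon (k i) (1 - zwt i).
Definition rep_zs i := mon (k' i) (- (1 - zwt i)).

Lemma lambda'_zwt i j : lambda' mu i j = mu ^ (zwt i * (1 - zwt j) - zwt j * (1 - zwt i)).
Proof.
have muV : mu^* = mu^-1 by apply: (mulfI mu0); rewrite mu1 divff.
rewrite /lambda' /zwt; case: (i < 2)%N; case: (j < 2)%N => //=.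
Qed.

Lemma lambda'_conj (i j : 'I_4) : (lambda' mu i j)^* = lambda' mu j i.
Proof.
rewrite /lambda' [(j < 2)%N == _]eq_sym; case: ifP => [_|]; first exact: rmorph1.
by case: (i < 2)%N; case: (j < 2)%N => //= _; exact: conjCK.
Qed.

Let zz i j : rep_z i * rep_z j = scalar_mon (lambda' mu i j) * (rep_z j * rep_z i).
Proof. by rewrite lambda'_zwt; exact: mon_comm. Qed.
Let bz i j : rep_zs i * rep_z j = scalar_mon (lambda' mu j i) * (rep_z j * rep_zs i).
Proof.
rewrite lambda'_zwt; have -> : zwt j * (1 - zwt i) - zwt i * (1 - zwt j) =
  (- zwt i) * (1 - zwt j) - zwt j * - (1 - zwt i) by ring.
exact: mon_comm.
Qed.
Let bb i j : rep_zs i * rep_zs j = scalar_mon (lambda' mu i j) * (rep_zs j * rep_zs i).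
Proof.
rewrite lambda'_zwt; have -> : zwt i * (1 - zwt j) - zwt j * (1 - zwt i) =
  (- zwt i) * - (1 - zwt j) - - zwt j * - (1 - zwt i) by ring.
exact: mon_comm.
Qed.

Let rep_sum : \sum_i rep_z i * rep_zs i = 1.
Proof.
rewrite -mon1 -k_sum.
have -> : mon (\sum_i k i * k' i) 0 = \sum_i mon (k i * k' i) 0.
  by apply: (big_morph (fun x => mon x 0)) => [x y|]; [exact: monD|exact: mon0].
apply: eq_bigr => i _; rewrite /rep_z /rep_zs monM subrr; congr mon; congr (_ * _).
rewrite k'_wt; have -> : - zwt i * - (1 - zwt i) = 0.
  by rewrite /zwt; case: ifP; rewrite ?subrr ?mulr0 ?oppr0 ?mul0r.
by rewrite expr0z rmorph1 mul1r.
Qed.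

Lemma scalar_rep_z c i : scalar_mon c * rep_z i = rep_z i * scalar_mon c.
Proof. exact: scalar_monC. Qed.
Lemma scalar_rep_zs c i : scalar_mon c * rep_zs i = rep_zs i * scalar_mon c.
Proof. exact: scalar_monC. Qed.

Lemma S7_rep_sat x y : S7_pres mu x y ->
  dbl_eval scalar_mon rep_z rep_zs x = dbl_eval scalar_mon rep_z rep_zs y.
Proof.
have cz c i j : rep_z i * rep_z j * scalar_mon c = scalar_mon c * (rep_z i * rep_z j).
  by rewrite -mulrA -scalar_rep_z !mulrA scalar_rep_z.
have cs c i j : rep_zs i * rep_zs j * scalar_mon c = scalar_mon c * (rep_zs i * rep_zs j).
  by rewrite -mulrA -scalar_rep_zs !mulrA scalar_rep_zs.
have czs c i j : rep_z i * rep_zs j * scalar_mon c = scalar_mon c * (rep_z i * rep_zs j).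
  by rewrite -mulrA -scalar_rep_zs !mulrA scalar_rep_z.
case=> [i j|i j|i j|] /=.
- by rewrite zz (bb j i) lambda'_conj cs.
- by rewrite bz (bz j i) lambda'_conj czs.
- by rewrite bb (zz j i) lambda'_conj cz.
rewrite !big_ord_recl !big_ord0 /=.
have := rep_sum; rewrite !big_ord_recl !big_ord0 addr0 => E.
by rewrite !rmorph0 !rmorph1 !addr0 E.
Qed.

Definition S7_rep : S7 mu -> endo (int -> K) := alg_lift scalar_mon rep_z rep_zs.

Lemma S7_repM x y : S7_rep (x * y) = S7_rep x * S7_rep y.
Proof. exact: (alg_liftM scalar_rep_z scalar_rep_zs S7_rep_sat). Qed.
Lemma S7_repD x y : S7_rep (x + y) = S7_rep x + S7_rep y.
Proof. exact: (alg_liftD scalar_rep_z scalar_rep_zs S7_rep_sat). Qed.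
Lemma S7_repZ c x : S7_rep (c *: x) = scalar_mon c * S7_rep x.
Proof. exact: (alg_liftZ scalar_rep_z scalar_rep_zs S7_rep_sat). Qed.
Lemma S7_rep1 : S7_rep 1 = 1.
Proof. exact: (alg_lift1 scalar_rep_z scalar_rep_zs S7_rep_sat). Qed.
Lemma S7_rep_z i : S7_rep (z mu i) = rep_z i.
Proof. exact: (alg_lift_gen scalar_rep_z scalar_rep_zs S7_rep_sat). Qed.
Lemma S7_rep_zs i : S7_rep (star (z mu i)) = rep_zs i.
Proof. exact: (alg_lift_star scalar_rep_z scalar_rep_zs S7_rep_sat). Qed.

Theorem S7_rep_ex : exists pi : S7 mu -> endo (int -> K),
  [/\ pi 1 = 1, {morph pi : x y / x * y},
      forall c x y, pi (c *: x + y) = scalar_mon c * pi x + pi y,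
      forall i, pi (z mu i) = mon (k i) (1 - zwt i) /\
                pi (star (z mu i)) = mon (k' i) (- (1 - zwt i)) &
      forall x, laurent (pi x)].
Proof.
exists S7_rep; split=> [|x y|c x y|i|x].
- exact: S7_rep1.
- exact: S7_repM.
- by rewrite S7_repD S7_repZ.
- by rewrite S7_rep_z S7_rep_zs.
elim/S7_star_ind: x => [|c x y Lx Ly|x y Lx Ly|i|i].
- by rewrite S7_rep1 -mon1; exact: Laurent_mon.
- by rewrite S7_repD S7_repZ; apply: Laurent_add => //; apply: laurentM => //; exact: Laurent_mon.
- by rewrite S7_repM; exact: laurentM.
- by rewrite S7_rep_z; exact: Laurent_mon.
- by rewrite S7_rep_zs; exact: Laurent_mon.
Qed.

End Representation.

End Laurent.

(** * Stationarity of the Maurer-Cartan integral *)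

Section Commutator.
Variable R : pzRingType.
Implicit Types x y z d : R.

Fact com_key : unit. Proof. by []. Qed.
(** Locked, so that rearranging long sums of commutators keeps them folded. *)
Definition com x y : R := locked_with com_key (x * y - y * x).
Lemma comE x y : com x y = x * y - y * x.
Proof. exact: unlock. Qed.

Lemma com_anti x y : com y x = - com x y.
Proof. by rewrite !comE opprB. Qed.
Lemma comDl x y z : com (x + y) z = com x z + com y z.
Proof. by rewrite !comE mulrDl mulrDr opprD addrACA. Qed.
Lemma comDr x y z : com z (x + y) = com z x + com z y.
Proof. by rewrite !comE mulrDl mulrDr opprD addrACA. Qed.
Lemma comNl x y : com (- x) y = - com x y.
Proof. by rewrite !comE mulNr mulrN opprB opprK addrC. Qed.
Lemma comNr x y : com x (- y) = - com x y.
Proof. by rewrite !comE mulNr mulrN opprB opprK addrC. Qed.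
Lemma comM d x y : com d (x * y) = com d x * y + x * com d y.
Proof. by rewrite !comE mulrBl mulrBr !mulrA addrA subrK. Qed.
Lemma com_com d x y : com d (com x y) = com (com d x) y + com x (com d y).
Proof.
rewrite [com x y]comE comDr comNr !comM !comE opprD.
by rewrite (AC (2*2) (1*4*(2*3))).
Qed.
Lemma comMl x y z : com (x * y) z = com x z * y + x * com y z.
Proof. by rewrite com_anti comM opprD -mulNr -mulrN -!com_anti. Qed.
Lemma com_coml x y z : com (com x y) z = com (com x z) y + com x (com y z).
Proof. by rewrite com_anti com_com opprD -(comNl (com z x)) -(comNr x (com z y)) -!com_anti. Qed.

Variables e f h d F G : R.
Hypotheses (ef : com e f = h) (he : com h e = e + e) (hf : com h f = - (f + f)).
Hypotheses (de : com d e = 0) (df : com d f = 0) (dh : com d h = 0).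
Hypotheses (FG : F * G = 1) (GF : G * F = 1).

(** With G = F^-1 and x acting as a derivation, this is the Maurer-Cartan form
    F^-1 dF on the vector field x. *)
Definition gauge x := G * com x F.

Lemma gaugeE x : x + gauge x = G * x * F.
Proof. by rewrite /gauge !comE mulrBr !mulrA GF mul1r addrC subrK. Qed.

Lemma com_conj x y : com (G * x * F) (G * y * F) = G * com x y * F.
Proof.
have E a b : (G * a * F) * (G * b * F) = G * (a * b) * F.
  by rewrite -!mulrA (mulrA F) FG mul1r.
by rewrite !comE !E -mulrBl -mulrBr.
Qed.

Local Notation Ae := (gauge e).
Local Notation Af := (gauge f).
Local Notation Ah := (gauge h).
Local Notation A0 := (gauge d).

(** The Maurer-Cartan equation: the connection x + gauge x = F^-1 x F is flat. *)
Lemma gauge_com x y : com (gauge x) (gauge y) =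
  gauge (com x y) - com x (gauge y) + com y (gauge x).
Proof.
have := com_conj x y; rewrite -!gaugeE !comDl !comDr.
rewrite [com (gauge x) y]com_anti => E.
apply: (addrI (com x y + com x (gauge y) - com y (gauge x))).
rewrite (AC (3*1) (1*2*(3*4))) /= E.
by rewrite (AC (3*3) (1*4*(2*5)*(3*6))) /= subrr addNr !addr0.
Qed.

Lemma gaugeD x y : gauge (x + y) = gauge x + gauge y.
Proof. by rewrite /gauge comDl mulrDr. Qed.

(** Closedness of the 2-form [A, A], proportional to dA: flatness replaces each
    commutator of two forms by terms linear in them, and what remains is three
    Jacobi identities. *)
Lemma maurer_cartan : com h (com Ae Af) + com e (com Af Ah) + com f (com Ah Ae) = 0.
Proof.
have J a b x : com a (com b x) - com b (com a x) = com (com a b) x.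
  by rewrite com_com addrK.
have fh : com f h = f + f by rewrite com_anti hf opprK.
have Je := J h f Ae; have Jf := J e h Af; have Jh := J f e Ah.
move: Je Jf Jh; rewrite hf [com e h]com_anti he [com f e]com_anti ef !comNl !comDl.
rewrite !gauge_com ef he fh !gaugeD !comDr !comNr.
move=> Je Jf Jh.
rewrite (AC (3*4*4) ((3*10)*(8*9)*((7*2)*(4*5))*((11*6)*1))) /=.
by rewrite Je Jf Jh !addNr !addr0.
Qed.

Variables (Z : zmodType) (T : R -> Z) (L : R -> Prop).
Hypothesis T_add : {morph T : x y / x + y}.
Hypotheses (L_add : forall x y, L x -> L y -> L (x + y)) (L_opp : forall x, L x -> L (- x)).
Hypothesis L_mul : forall x y, L x -> L y -> L (x * y).
Hypothesis T_trace : forall x y, L x -> L y -> T (x * y) = T (y * x).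
Hypotheses (Le : forall x, L x -> L (com e x)) (Lf : forall x, L x -> L (com f x))
  (Lh : forall x, L x -> L (com h x)) (Ld : forall x, L x -> L (com d x)).
Hypotheses (Te : forall x, L x -> T (com e x) = 0) (Tf : forall x, L x -> T (com f x) = 0)
  (Th : forall x, L x -> T (com h x) = 0).
Hypotheses (LF : L F) (LG : L G).

Let T0 : T 0 = 0. Proof. by apply: (addIr (T 0)); rewrite -T_add !add0r. Qed.
Let TN x : T (- x) = - T x.
Proof. by apply: (addIr (T x)); rewrite -T_add !addNr T0. Qed.
Let L_com x y : L x -> L y -> L (com x y).
Proof. by move=> Lx Ly; rewrite comE; apply: L_add; [exact: L_mul|apply/L_opp/L_mul]. Qed.

Lemma com_gauge x : com d x = 0 -> com d (gauge x) = com x A0 + com (gauge x) A0.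
Proof.
move=> dx; have g0 : gauge 0 = 0 by apply: (addIr (gauge 0)); rewrite -gaugeD !add0r.
have := gauge_com d x; rewrite dx g0 add0r => E.
by rewrite [com (gauge x) A0]com_anti E opprD opprK addrC subrK.
Qed.

Lemma trace_by_parts u X : L X -> (forall x, L x -> T (com u x) = 0) ->
  (forall x, L x -> L (com u x)) -> T (com u A0 * X) = - T (A0 * com u X).
Proof.
move=> LX Tu Lu; have LA0 : L A0 by apply: L_mul => //; exact: Ld.
apply: (addIr (T (A0 * com u X))); rewrite -T_add -comM addNr Tu //.
exact: L_mul.
Qed.

Lemma trace_cycle_com x y z : L x -> L y -> L z -> T (x * com y z) = T (y * com z x).
Proof.
move=> Lx Ly Lz; rewrite !comE !mulrBr !T_add !TN; congr (_ - _).
  by rewrite T_trace ?mulrA //; exact: L_mul.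
by rewrite !mulrA T_trace ?mulrA //; exact: L_mul.
Qed.

(** By flatness the derivative of A_x along d is [x + A_x, A_0]: the forms vary
    by an infinitesimal gauge transformation with parameter A_0.  Its inner part
    is invisible to the trace, and integration by parts moves the rest onto
    A_0, where the coefficient is the left side of [maurer_cartan]. *)
Theorem degree_stationary : T (com d (Ah * com Ae Af)) = 0.
Proof.
have LAe : L Ae by apply: L_mul => //; exact: Le.
have LAf : L Af by apply: L_mul => //; exact: Lf.
have LAh : L Ah by apply: L_mul => //; exact: Lh.
have LA0 : L A0 by apply: L_mul => //; exact: Ld.
have LBe := Le LA0; have LBf := Lf LA0; have LBh := Lh LA0.
have Lef := L_com LAe LAf.
have E : com d (Ah * com Ae Af) = com h A0 * com Ae Af + Ah * com (com e A0) Af +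
    Ah * com Ae (com f A0) + com (Ah * com Ae Af) A0.
  rewrite comM com_com !com_gauge // comMl (com_coml Ae).
  rewrite !comDl !comDr !mulrDl !mulrDr.
  by rewrite (AC (2*(2*2)) (1*3*5*(2*(4*6)))).
rewrite E [com (Ah * _) A0]comE !T_add TN.
rewrite [T (Ah * com Ae Af * A0)]T_trace ?subrr ?addr0 //; last exact: L_mul.
rewrite [T (Ah * com (com e A0) Af)]trace_cycle_com //.
rewrite [T (Ah * com Ae _)]trace_cycle_com // [T (Ae * _)]trace_cycle_com //.
rewrite !trace_by_parts //; try exact: L_com.
rewrite -!opprD -!T_add -!mulrDr maurer_cartan mulr0 T0.
exact: oppr0.
Qed.

End Commutator.

(** * The path of representations *)

Section PolyMaps.
Variables (A A' : nzRingType) (f : A -> A').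
Hypothesis f_add : {morph f : x y / x + y}.

Lemma morph_add0 : f 0 = 0.
Proof. by apply: (addIr (f 0)); rewrite -f_add !add0r. Qed.
Lemma coef_map_add p i : (map_poly f p)`_i = f p`_i.
Proof. exact: coef_map_id0 morph_add0. Qed.
Lemma map_poly_add : {morph map_poly f : p q / p + q}.
Proof. by move=> p q; apply/polyP => i; rewrite coefD !coef_map_add coefD f_add. Qed.
Lemma map_poly_constant c : map_poly f c%:P = (f c)%:P.
Proof. by apply/polyP => i; rewrite coef_map_add !coefC; case: ifP; rewrite ?morph_add0. Qed.
Lemma morph_sum (I : Type) (r : seq I) (F : I -> A) :
  f (\sum_(i <- r) F i) = \sum_(i <- r) f (F i).
Proof. by apply: big_morph; [exact: f_add|exact: morph_add0]. Qed.

End PolyMaps.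

Section PolyMorphisms.
Variables (A : nzRingType) (f D : A -> A).
Hypothesis f_add : {morph f : x y / x + y}.
Hypothesis f_mul : {morph f : x y / x * y}.
Hypothesis D_add : {morph D : x y / x + y}.
Hypothesis D_mul : forall x y, D (x * y) = x * D y + D x * y.

Lemma map_poly_mul : {morph map_poly f : p q / p * q}.
Proof.
move=> p q; apply/polyP => i; rewrite coef_map_add // !coefM morph_sum //.
by apply: eq_bigr => j _; rewrite f_mul !coef_map_add.
Qed.
Lemma map_poly_leibniz p q :
  map_poly D (p * q) = p * map_poly D q + map_poly D p * q.
Proof.
apply/polyP => i; rewrite coef_map_add // coefD !coefM morph_sum // -big_split.
by apply: eq_bigr => j _; rewrite D_mul !coef_map_add.
Qed.
Lemma map_poly_deriv p : (map_poly D p)^`() = map_poly D p^`().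
Proof.
have Mn a n : D (a *+ n) = D a *+ n.
  elim: n => [|n IH]; first by rewrite !mulr0n morph_add0.
  by rewrite !mulrS D_add IH.
by apply/polyP => i; rewrite coef_map_add // !coef_deriv coef_map_add // Mn.
Qed.
End PolyMorphisms.

Lemma poly_mulC (A : nzRingType) : (forall x y : A, x * y = y * x) ->
  forall p q : {poly A}, p * q = q * p.
Proof.
by move=> AC p q; apply/polyP => i; rewrite coefM coefMr; apply: eq_bigr => j _.
Qed.

Section HomotopyRing.
Variables (C : numClosedFieldType) (mu : C).
Hypothesis mu1 : mu * mu^* = 1.
Local Notation SU2 := (SU2 C).
Local Notation U := (SU2_mx C).
Local Notation S7 := (S7 mu).

Let mu0 : mu != 0.
Proof. by apply: contra_eq_neq mu1 => ->; rewrite mul0r eq_sym oner_eq0. Qed.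
Let conj_exp i : (mu ^ i)^* = mu ^ (- i).
Proof.
have muV : mu^* = mu^-1 by apply: (mulfI mu0); rewrite mu1 divff.
by rewrite rmorphXz ?unitfE //= muV exprz_inv.
Qed.
Let exp_unit i : mu ^ i * (mu ^ i)^* = 1.
Proof. by rewrite conj_exp -expfzDr // subrr expr0z. Qed.

Definition twist (i : int) : SU2 -> SU2 := torus (mu ^ i).
Lemma twist_linear i : linear (twist i).
Proof. exact: torus_linear. Qed.
Lemma twist_add i : {morph twist i : x y / x + y}.
Proof. exact/lin_mapD/torus_linear. Qed.
Lemma twist_mul i : {morph twist i : x y / x * y}.
Proof. exact: (torus_monoid (exp_unit i)).2. Qed.
Lemma twist_one i : twist i 1 = 1.
Proof. exact: (torus_monoid (exp_unit i)).1. Qed.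
Lemma twist_id x : twist 0 x = x.
Proof. by rewrite /twist expr0z torus1. Qed.
Lemma twist_comp i j x : twist i (twist j x) = twist (i + j) x.
Proof. by rewrite /twist torusM // expfzDr. Qed.
Lemma twist_scalar i (c : C) : twist i c%:A = c%:A.
Proof. by rewrite /twist (lin_mapZ _ _ (torus_linear (exp_unit i))) [torus _ _]twist_one. Qed.
Lemma twist_U i a b : twist i (U a b) = mu ^ ((if b == 0 then 1 else -1) * i) *: U a b.
Proof.
rewrite /twist torusU // /torus_wt; case: ifP => _; first by rewrite mul1r.
by rewrite mulN1r conj_exp.
Qed.

Lemma haar_twist i t : haar (twist i t) = haar t.
Proof. exact: haar_torus. Qed.
Lemma twist_derivation xi D : derivation D ->
  (forall i j, D (U i j) = \sum_k xi k i *: U k j) ->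
  forall i t, D (twist i t) = twist i (D t).
Proof. by move=> dD DU i; apply: torus_derivation dD DU. Qed.

Definition ptwist (i : int) : {poly SU2} -> {poly SU2} := map_poly (twist i).
Lemma ptwist_add i : {morph ptwist i : x y / x + y}.
Proof. exact/map_poly_add/twist_add. Qed.
Lemma ptwist_mul i : {morph ptwist i : x y / x * y}.
Proof. exact: map_poly_mul (@twist_add i) (@twist_mul i). Qed.
Lemma ptwist_const i c : ptwist i c%:P = (twist i c)%:P.
Proof. exact/map_poly_constant/twist_add. Qed.
Lemma ptwist_one i : ptwist i 1 = 1.
Proof. by rewrite -[1 in LHS]/(1%:P) ptwist_const twist_one. Qed.
Lemma ptwist_id x : ptwist 0 x = x.
Proof.
apply/polyP => i; rewrite coef_map_add; last exact: twist_add.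
exact: twist_id.
Qed.
Lemma ptwist_comp i j x : ptwist i (ptwist j x) = ptwist (i + j) x.
Proof.
by apply/polyP => k; rewrite !(coef_map_add (@twist_add _)) twist_comp.
Qed.

Definition scalar_poly : C -> {poly SU2} := polyC \o in_alg SU2.
HB.instance Definition _ := GRing.RMorphism.on scalar_poly.
Lemma ptwist_scalar i c : ptwist i (scalar_poly c) = scalar_poly c.
Proof. by rewrite ptwist_const twist_scalar. Qed.

Definition lift_poly (r : {poly C}) : {poly SU2} := map_poly (in_alg SU2) r.
Lemma ptwist_lift i r : ptwist i (lift_poly r) = lift_poly r.
Proof.
apply/polyP => k; rewrite (coef_map_add (@twist_add _)) coef_map.
exact: twist_scalar.
Qed.

(** The coefficients in y of z and of its adjoint.  A unitary path would need
    square roots; only \sum z z^* = 1 has to hold, and the coefficients of the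
    adjoint are chosen by y^2 (3 - 2 y) + (1 - y)^2 (1 + 2 y) = 1. *)
Definition path_r (i : 'I_4) : {poly C} :=
  if (i < 2)%N then 'X else if i == 2 then 1 - 'X else 0.
Definition path_r' (i : 'I_4) : {poly C} :=
  if (i < 2)%N then 'X * (3 - 2 * 'X)
  else if i == 2 then (1 - 'X) * (1 + 2 * 'X) else 0.
Definition path_u (i : 'I_4) : SU2 :=
  if i == 0 then U 0 0 else if i == 1 then U 1 0 else if i == 2 then 1 else 0.
Definition path_u' (i : 'I_4) : SU2 :=
  if i == 0 then U 1 1 else if i == 1 then - U 0 1 else if i == 2 then 1 else 0.
Definition path_z i := lift_poly (path_r i) * (path_u i)%:P.
Definition path_zs i := lift_poly (path_r' i) * (path_u' i)%:P.

Lemma ord4P (P : 'I_4 -> Prop) : P 0 -> P 1 -> P 2 -> P 3 -> forall i, P i.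
Proof.
move=> P0 P1 P2 P3 [[|[|[|[|//]]]] im].
- by rewrite (_ : Ordinal im = 0) //; apply/val_inj.
- by rewrite (_ : Ordinal im = 1) //; apply/val_inj.
- by rewrite (_ : Ordinal im = 2) //; apply/val_inj.
- by rewrite (_ : Ordinal im = 3) //; apply/val_inj.
Qed.

Lemma sum4 (V : zmodType) (F : 'I_4 -> V) : \sum_i F i = F 0 + (F 1 + (F 2 + F 3)).
Proof.
rewrite !big_ord_recl big_ord0 addr0.
by congr (_ + (F _ + (F _ + F _))); apply/val_inj.
Qed.

Let SC : forall x y : SU2, x * y = y * x := @SU2_mulC C.

Lemma weight_path r u (w : int) : (forall j, twist j u = mu ^ (w * j) *: u) ->
  weight ptwist mu scalar_poly (lift_poly r * u%:P) w.
Proof.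
move=> uw j; rewrite ptwist_mul ptwist_lift ptwist_const uw mulrA.
rewrite [scalar_poly _ * _](poly_mulC SC) -mulrA -polyCM.
by rewrite -scalerAl mul1r.
Qed.

Lemma path_z_wt i : weight ptwist mu scalar_poly (path_z i) (zwt i).
Proof.
apply: weight_path => j; elim/ord4P: i; rewrite /path_u /zwt /=.
- exact: twist_U.
- exact: twist_U.
- by rewrite mul0r expr0z scale1r twist_one.
- by rewrite scaler0; exact/morph_add0/twist_add.
Qed.

Lemma path_zs_wt i : weight ptwist mu scalar_poly (path_zs i) (- zwt i).
Proof.
apply: weight_path => j; elim/ord4P: i; rewrite /path_u' /zwt /=.
- exact: twist_U.
- rewrite -scaleN1r /twist (lin_mapZ _ _ (torus_linear (exp_unit j))) [torus _ _]twist_U.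
  by rewrite !scalerA mulrC.
- by rewrite oppr0 mul0r expr0z scale1r twist_one.
- by rewrite scaler0; exact/morph_add0/twist_add.
Qed.

Lemma path_sum : \sum_i path_z i * path_zs i = 1.
Proof.
have E i : path_z i * path_zs i = lift_poly (path_r i * path_r' i) * (path_u i * path_u' i)%:P.
  rewrite /path_z /path_zs /lift_poly polyCM rmorphM /= -!mulrA; congr (_ * _).
  by rewrite !mulrA [_%:P * _](poly_mulC SC).
have := SU2_det C 0 1; rewrite /eps /= scale1r => det1.
rewrite (eq_bigr _ (fun i _ => E i)) sum4 /path_r /path_r' /path_u /path_u' /=.
rewrite !mulr0 addr0 mulr1 polyC1 mulr1 addrA -mulrDr -polyCD mulrN det1.
rewrite polyC1 mulr1 /lift_poly -rmorphD /=.
have -> : 'X * ('X * (3 - 2 * 'X)) + (1 - 'X) * ((1 - 'X) * (1 + 2 * 'X)) = 1 :> {poly C} by ring.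
by rewrite rmorph1.
Qed.

End HomotopyRing.

(** * The two ends of the path *)

Section Evaluation.
Variables (C : numClosedFieldType).
Local Notation SU2 := (SU2 C).

Lemma horner_map_linear (A : algType C) (f : SU2 -> A) (p : {poly SU2}) (c : C) :
  linear f -> (map_poly f p).[c%:A] = f p.[c%:A].
Proof.
move=> fl; rewrite (horner_coef_wide _ (size_poly _ _)) horner_coef.
rewrite lin_map_sum //; apply: eq_bigr => i _.
rewrite (coef_map_add (lin_mapD fl)) !exprZn !expr1n !mulr_algr.
by rewrite (lin_mapZ _ _ fl).
Qed.

Lemma hornerM_SU2 (p q : {poly SU2}) x : (p * q).[x] = p.[x] * q.[x].
Proof. by apply: hornerM_comm; exact: SU2_mulC. Qed.

Lemma horner_lift_poly (r : {poly C}) c : (lift_poly r).[c%:A] = r.[c]%:A.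
Proof. exact: (horner_map (in_alg SU2)). Qed.

Variable c : C.
Definition eval_at (f : int -> {poly SU2}) : int -> SU2 := fun i => (f i).[c%:A].
(** The operator [x] specialises to [x'] when y takes the value [c]. *)
Definition intertwined (x : endo (int -> {poly SU2})) (x' : endo (int -> SU2)) :=
  forall f, eval_at (x f) = x' (eval_at f).

Lemma eval_atD f g : eval_at (f + g) = eval_at f + eval_at g.
Proof. by apply/funext => i; exact: hornerD. Qed.

Lemma intertwinedD x y x' y' :
  intertwined x x' -> intertwined y y' -> intertwined (x + y) (x' + y').
Proof. by move=> xx yy f; rewrite !endoDE eval_atD xx yy. Qed.
Lemma intertwinedM x y x' y' :
  intertwined x x' -> intertwined y y' -> intertwined (x * y) (x' * y').
Proof. by move=> xx yy f; rewrite !endoME xx yy. Qed.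
Lemma intertwined0 : intertwined 0 0.
Proof. by move=> f; apply/funext => i; exact: horner0. Qed.
Lemma intertwined1 : intertwined 1 1.
Proof. by []. Qed.
Lemma intertwinedN x x' : intertwined x x' -> intertwined (- x) (- x').
Proof.
move=> xx f; rewrite !endoNE -xx; apply/funext => i.
exact: hornerN.
Qed.

Lemma intertwined_pointwise D (D_lin : linear D) :
  intertwined (pointwise (map_poly_add (lin_mapD D_lin))) (pointwise (lin_mapD D_lin)).
Proof. by move=> f; apply/funext => i; exact: horner_map_linear. Qed.

Lemma eval_kronecker : eval_at (@kronecker {poly SU2}) = @kronecker SU2.
Proof.
apply/funext => i; rewrite /eval_at /kronecker; case: ifP => _; last exact: horner0.
exact: hornerC.
Qed.

Lemma intertwined_constant_term x x' : intertwined x x' ->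
  (constant_term x).[c%:A] = constant_term x'.
Proof.
move=> /(_ (@kronecker {poly SU2})); rewrite eval_kronecker => E.
by rewrite /constant_term -E.
Qed.

Variable mu : C.
Hypothesis mu1 : mu * mu^* = 1.

Lemma intertwined_mon k n : intertwined (mon (ptwist mu) k n) (mon (twist mu) k.[c%:A] n).
Proof.
move=> f; apply/funext => i; rewrite /eval_at !monE hornerM_SU2.
congr (_ * _); apply: horner_map_linear; exact: twist_linear.
Qed.

Lemma eval_path_z i : (path_z C i).[c%:A] = (path_r C i).[c] *: path_u C i.
Proof. by rewrite /path_z hornerM_SU2 horner_lift_poly hornerC -scalerAl mul1r. Qed.
Lemma eval_path_zs i : (path_zs C i).[c%:A] = (path_r' C i).[c] *: path_u' C i.
Proof. by rewrite /path_zs hornerM_SU2 horner_lift_poly hornerC -scalerAl mul1r. Qed.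
Lemma eval_scalar_poly a : (scalar_poly a : {poly SU2}).[c%:A] = a%:A.
Proof. exact: hornerC. Qed.

End Evaluation.

Section Endpoints.
Variables (C : numClosedFieldType) (mu : C).
Hypothesis mu1 : mu * mu^* = 1.
Local Notation SU2 := (SU2 C).
Local Notation U := (SU2_mx C).
Local Notation S7 := (S7 mu).
Local Notation monp := (mon (ptwist mu)).
Local Notation mono := (mon (twist mu)).
Variable pi : S7 -> endo (int -> {poly SU2}).
Hypothesis pi1 : pi 1 = 1.
Hypothesis piM : {morph pi : x y / x * y}.
Hypothesis pil : forall c x y, pi (c *: x + y) = monp (scalar_poly c) 0 * pi x + pi y.
Hypothesis pi_gen : forall i, pi (z mu i) = monp (path_z C i) (1 - zwt i) /\
  pi (star (z mu i)) = monp (path_zs C i) (- (1 - zwt i)).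

Let monoM := monM (twist_mul mu1) (twist_comp mu1).
Let monoD := monD (twist_add mu1).
Let mono1 := mon1 (twist_one mu1).
Let mono0 := mon0 (twist_add mu1).

(** At y = 0 the block with coefficients u_00, u_10 vanishes and the Laurent
    operators have constant coefficients, which derivations of SU(2) kill. *)
Lemma endpoint0 p : exists2 x', intertwined 0 (pi p) x' &
  forall D (dD : derivation D), (forall i t, D (twist mu i t) = twist mu i (D t)) ->
  com (pointwise (lin_mapD dD.1)) x' = 0.
Proof.
have const_mon (k : SU2) (n : int) D (dD : derivation D) :
    (forall i t, D (twist mu i t) = twist mu i (D t)) -> D k = 0 ->
    com (pointwise (lin_mapD dD.1)) (mono k n) = 0.
  by move=> Dt Dk; rewrite comE pointwise_mon ?Dk ?mono0 //; exact: dD.2.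
have D_scalar D (c : C) : derivation D -> D c%:A = 0.
  by move=> dD; rewrite (lin_mapZ _ _ dD.1) derivation1 // scaler0.
elim/S7_star_ind: p => [|c x y [x' xx Dx] [y' yy Dy]|x y [x' xx Dx] [y' yy Dy]|i|i].
- exists 1; first by rewrite pi1; exact: intertwined1.
  by move=> D dD _; rewrite comE mulr1 mul1r subrr.
- exists (mono c%:A 0 * x' + y').
    rewrite pil; apply: intertwinedD => //; apply: intertwinedM => //.
    by rewrite -[c%:A](eval_scalar_poly 0); exact: intertwined_mon.
  move=> D dD Dt; rewrite comDr comM Dx // Dy // const_mon ?D_scalar //.
  by rewrite mul0r mulr0 !addr0.
- exists (x' * y'); first by rewrite piM; exact: intertwinedM.
  by move=> D dD Dt; rewrite comM Dx // Dy // mul0r mulr0 addr0.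
- exists (mono (path_z C i).[0%:A] (1 - zwt i)).
    by rewrite (pi_gen i).1; exact: intertwined_mon.
  move=> D dD Dt; apply: const_mon => //; rewrite eval_path_z (lin_mapZ _ _ dD.1).
  elim/ord4P: i; rewrite /path_r /path_u /= ?hornerX ?scale0r ?derivation1 ?scaler0 //.
  by rewrite horner0 scale0r.
- exists (mono (path_zs C i).[0%:A] (- (1 - zwt i))).
    by rewrite (pi_gen i).2; exact: intertwined_mon.
  move=> D dD Dt; apply: const_mon => //; rewrite eval_path_zs (lin_mapZ _ _ dD.1).
  elim/ord4P: i; rewrite /path_r' /path_u' /= ?hornerM ?hornerX ?mul0r ?scale0r
    ?derivation1 ?scaler0 //.
  by rewrite horner0 scale0r.
Qed.

(** Restriction to the fibre of the bundle over the pole x = 1, where the second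
    block vanishes. *)
Definition fibre_gen (i : 'I_4) : SU2 :=
  if i == 0 then U 0 0 else if i == 1 then U 1 0 else 0.
Definition fibre : S7 -> SU2 := pres_lift fibre_gen.

Let starU00 : star (U 0 0) = U 1 1. Proof. by rewrite U0 U11. Qed.
Let starU10 : star (U 1 0) = - U 0 1. Proof. by rewrite U10 U0 starN starK. Qed.

Let fibre_sat : satisfies (S7_pres mu) fibre_gen.
Proof.
have g0 (i : 'I_4) : (i < 2)%N = false -> fibre_gen i = 0 by elim/ord4P: i.
have l1 (i j : 'I_4) : (i < 2)%N -> (j < 2)%N -> lambda' mu i j = 1.
  by rewrite /lambda' => -> ->.
apply: S7_satisfies => [i j|i j|i j|].
- have [i2|/negbTE/g0->] := boolP (i < 2)%N; last by rewrite mulr0 mul0r scaler0.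
  have [j2|/negbTE/g0->] := boolP (j < 2)%N; last by rewrite mulr0 mul0r scaler0.
  by rewrite l1 // scale1r SU2_mulC.
- have [i2|/negbTE/g0->] := boolP (i < 2)%N; last by rewrite star0 mulr0 mul0r scaler0.
  have [j2|/negbTE/g0->] := boolP (j < 2)%N; last by rewrite mulr0 mul0r scaler0.
  by rewrite l1 // scale1r SU2_mulC.
- have [i2|/negbTE/g0->] := boolP (i < 2)%N; last by rewrite star0 mulr0 mul0r scaler0.
  have [j2|/negbTE/g0->] := boolP (j < 2)%N; last by rewrite star0 mulr0 mul0r scaler0.
  by rewrite l1 // scale1r SU2_mulC.
rewrite sum4 /fibre_gen /= starU00 starU10 mul0r !addr0 mulrN.
by rewrite [U 1 0 * _]SU2_mulC [LHS](SU2_minor C 0 1) /eps /= scale1r.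
Qed.

Lemma fibre_linear : linear fibre. Proof. exact: (pres_lift_linear fibre_sat). Qed.
Lemma fibre_monoid : monoid_morphism fibre. Proof. exact: (pres_lift_monoid fibre_sat). Qed.
Lemma fibre_z i : fibre (z mu i) = fibre_gen i. Proof. exact: (pres_lift_gen fibre_sat). Qed.
Lemma fibre_star x : fibre (star x) = star (fibre x).
Proof. exact: (pres_lift_star fibre_sat). Qed.

Lemma endpoint1 p : intertwined 1 (pi p) (mono (fibre p) 0).
Proof.
have [f1 fM] := fibre_monoid; have fl := fibre_linear.
elim/S7_star_ind: p => [|c x y xx yy|x y xx yy|i|i].
- by rewrite pi1 f1 mono1; exact: intertwined1.
- have -> : mono (fibre (c *: x + y)) 0 = mono c%:A 0 * mono (fibre x) 0 + mono (fibre y) 0.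
    by rewrite monoM addr0 oppr0 (twist_id mu) mulr_algl -monoD fl.
  rewrite pil; apply: intertwinedD => //; apply: intertwinedM => //.
  by rewrite -[c%:A](eval_scalar_poly 1); exact: intertwined_mon.
- have -> : mono (fibre (x * y)) 0 = mono (fibre x) 0 * mono (fibre y) 0.
    by rewrite monoM addr0 oppr0 (twist_id mu) fM.
  by rewrite piM; exact: intertwinedM.
- have -> : mono (fibre (z mu i)) 0 = mono (path_z C i).[1%:A] (1 - zwt i).
    rewrite fibre_z eval_path_z /fibre_gen /path_r /path_u.
    elim/ord4P: i; rewrite /= ?hornerX ?scale1r ?subrr //.
      by rewrite hornerD hornerN hornerX hornerC subrr scale0r !mono0.
    by rewrite horner0 scale0r !mono0.
  by rewrite (pi_gen i).1; exact: intertwined_mon.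
- have -> : mono (fibre (star (z mu i))) 0 = mono (path_zs C i).[1%:A] (- (1 - zwt i)).
    rewrite fibre_star fibre_z eval_path_zs /fibre_gen /path_r' /path_u'.
    have h1 : ('X * (3 - 2 * 'X)).[1] = 1 :> C.
      by rewrite -!polyC_natr !hornerE; ring.
    elim/ord4P: i; rewrite /= ?h1 ?scale1r ?subrr ?starU00 ?starU10 //.
      by rewrite hornerM hornerD hornerN hornerX hornerC subrr mul0r scale0r star0 !mono0.
    by rewrite horner0 scale0r star0 !mono0.
  by rewrite (pi_gen i).2; exact: intertwined_mon.
Qed.

End Endpoints.

Section FibreColinear.
Variables (C : numClosedFieldType) (mu : C).
Local Notation SU2 := (SU2 C).
Local Notation U := (SU2_mx C).
Local Notation S7 := (S7 mu).
Local Notation rho := (coact (S7_comodule mu)).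
Local Notation ep := (@SU2_counit C).

(** The fibre map puts (z^1, z^2) into the first column of U, while the coaction
    multiplies rows; the two actions match up to transposition. *)
Definition transpose : SU2 -> SU2 := pres_lift (fun b => U b 0).

Let sat : satisfies (SU2_pres C) (fun b => U b 0).
Proof.
apply: SU2_satisfies; first exact: SU2_mulC.
rewrite sum2 U0 U10 starN starK mulrNN [star _ * _]SU2_mulC -(sum2 (fun b => w C b * star (w C b))).
exact: SU2_sum.
Qed.

Lemma transposeU i j : transpose (U i j) = U j i.
Proof.
have tw b : transpose (w C b) = U b 0 := pres_lift_gen sat b.
have ts t : transpose (star t) = star (transpose t) := pres_lift_star sat t.
have tl : linear transpose := pres_lift_linear sat.
elim/ord2P: i; first by rewrite U0 tw.
elim/ord2P: j; rewrite ?U10 ?U11.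
  by rewrite -scaleN1r (lin_mapZ _ _ tl) ts tw U10 U0 starN starK
     scaleN1r opprK.
by rewrite ts tw U0.
Qed.

Lemma fibre_zb b j : fibre (zb mu b j) = if b == 0 then U j 0 else 0.
Proof. by rewrite fibre_z; elim/ord2P: b; elim/ord2P: j. Qed.

(** The fibre is one orbit, so a function is determined there by the coaction
    and its value at the base point. *)
Lemma fibre_coact p : fibre p = tlift (fun q t => ep (fibre q) *: transpose t) (rho p).
Proof.
have [f1 fM] := @fibre_monoid C mu; have fl := @fibre_linear C mu.
have tl : linear transpose := pres_lift_linear sat.
have [t1 tM] : monoid_morphism transpose := pres_lift_monoid sat.
have bl : bilin (fun (q : S7) (t : SU2) => ep (fibre q) *: transpose t).
  split=> [t c q q'|q c t t'] /=.
    by rewrite fl linearP scalerDl scalerA.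
  by rewrite tl scalerDr !scalerA mulrC.
have ts t : transpose (star t) = star (transpose t) := pres_lift_star sat t.
have Tm := tlift_monoid bl.
have idx (i : 'I_4) : exists b j, i = block_index b j.
  by case: (@split_ordP 2 2 i) => j ->; [exists 0, j|exists 1, j].
have epd (b : bool) (j : 'I_2) (F : 'I_2 -> SU2) :
    \sum_k ep (if b then U k 0 else 0) *: F k = if b then F 0 else 0.
  rewrite sum2; case: b; rewrite ?SU2_counitE /=.
    by rewrite scale1r scale0r addr0.
  by rewrite linear0 !scale0r addr0.
apply: (presented_ext (f := fibre (mu := mu))
  (g := tlift (fun q t => ep (fibre q) *: transpose t) \o rho)) => //.
- apply: comp_linear; first exact: ctlift_linear bl.
  exact: lrmorph_linear.
- apply: comp_monoid; last exact: lrmorph_monoid.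
  apply: Tm; first by rewrite f1 t1 rmorph1 scale1r.
  by move=> a a' b b'; rewrite fM tM rmorphM -scalerAl -scalerAr scalerA.
- move=> i; have [b [j ->]] := idx i; rewrite -[pres_gen _ _]/(zb mu b j) /=.
  rewrite rho_zb (@lin_map_sum _ _ _ _ _ _ (ctlift_linear bl)) fibre_zb.
  under eq_bigr => k _ do rewrite (ctliftE bl) fibre_zb transposeU.
  by rewrite epd.
- move=> i; have [b [j ->]] := idx i; rewrite -[pres_gen _ _]/(zb mu b j) /=.
  rewrite -[S7_coact _]/(rho _) rho_star rho_zb star_sum fibre_star fibre_zb.
  rewrite (@lin_map_sum _ _ _ _ _ _ (ctlift_linear bl)).
  under eq_bigr => k _.
    rewrite pure_star (ctliftE bl) fibre_star fibre_zb ts transposeU SU2_counit_star.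
    over.
  rewrite sum2; case: (b == 0); rewrite ?SU2_counitE ?linear0 ?rmorph0 ?rmorph1 ?star0.
    by rewrite scale1r scale0r addr0.
  by rewrite !scale0r addr0.
Qed.

(** Along the fibre an equivariant vector is a constant row times the transpose
    of U, hence the vector fields act on it by constant matrices. *)
Lemma fibre_derivation (Phi : 'I_2 -> S7) (xi : 'I_2 -> 'I_2 -> C) D :
  derivation D -> (forall i j, D (U i j) = \sum_k xi k i *: U k j) ->
  (forall j, rho (Phi j) = \sum_k Phi k ⊗ U k j) ->
  forall j, D (fibre (Phi j)) = \sum_k xi k j *: fibre (Phi k).
Proof.
move=> [Dl _] DU co j.
have bl : bilin (fun (q : S7) (t : SU2) => ep (fibre q) *: transpose t).
  have tl : linear transpose := pres_lift_linear sat.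
  split=> [t c q q'|q c t t'] /=.
    by rewrite (@fibre_linear C mu) linearP scalerDl scalerA.
  by rewrite tl scalerDr !scalerA mulrC.
have E k : fibre (Phi k) = \sum_c ep (fibre (Phi c)) *: U k c.
  rewrite fibre_coact co (@lin_map_sum _ _ _ _ _ _ (ctlift_linear bl)).
  by apply: eq_bigr => c _; rewrite (ctliftE bl) transposeU.
rewrite E (@lin_map_sum _ _ _ _ _ _ Dl).
under eq_bigr => c _ do rewrite (lin_mapZ _ _ Dl) DU scaler_sumr.
rewrite exchange_big; apply: eq_bigr => k _.
rewrite [in RHS]E scaler_sumr; apply: eq_bigr => c _.
by rewrite !scalerA mulrC.
Qed.

End FibreColinear.

(** * The degree of a matrix of Laurent operators *)

Lemma com_scalar_mx (R : pzRingType) (a : R) (X : 'M[R]_2) i j :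
  com (a%:M : 'M_2) X i j = com a (X i j).
Proof.
rewrite !comE !mxE !sum2 !mxE.
by elim/ord2P: i; elim/ord2P: j; rewrite /= ?mulr1n ?mulr0n ?mul0r ?mulr0 ?addr0 ?add0r.
Qed.

Section Degree.
Variables (C : numClosedFieldType) (mu : C).
Hypothesis mu1 : mu * mu^* = 1.
Local Notation SU2 := (SU2 C).
Local Notation W := (int -> {poly SU2}).
Local Notation R := (endo W).
Local Notation M := ('M[endo W]_2).
Local Notation laur := (laurent (ptwist mu)).

Definition haar_poly : {poly SU2} -> {poly C} := map_poly (@haar C).
Let haar_add : {morph @haar C : x y / x + y}.
Proof. exact: (lin_mapD (@haar_linear C)). Qed.

Lemma haar_poly_add : {morph haar_poly : x y / x + y}.
Proof. exact: map_poly_add. Qed.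
Lemma haar_poly_twist i x : haar_poly (ptwist mu i x) = haar_poly x.
Proof.
apply/polyP => k; rewrite !(coef_map_add haar_add) (coef_map_add (twist_add mu1 i)).
exact: haar_twist mu1 i _.
Qed.
Lemma haar_poly_deriv x : haar_poly x^`() = (haar_poly x)^`().
Proof.
apply/polyP => k; rewrite coef_deriv !(coef_map_add haar_add) coef_deriv.
exact: (raddfMn (@haar C : {linear SU2 -> C^o})) _ _.
Qed.

(** Matrix trace, constant Laurent coefficient and Haar integral compose to a
    trace with values in the polynomials in y. *)
Definition degree_trace (X : M) : {poly C} := haar_poly (constant_term (\tr X)).
Definition laurent_mx (X : M) := forall i j, laur (X i j).

Lemma degree_traceE X : degree_trace X =
  haar_poly (constant_term (X 0 0)) + haar_poly (constant_term (X 1 1)).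
Proof. by rewrite /degree_trace /mxtrace sum2 constant_termD haar_poly_add. Qed.

Lemma degree_traceD : {morph degree_trace : X Y / X + Y}.
Proof. by move=> X Y; rewrite /degree_trace raddfD /= constant_termD haar_poly_add. Qed.

Lemma laurent_mxD X Y : laurent_mx X -> laurent_mx Y -> laurent_mx (X + Y).
Proof. by move=> LX LY i j; rewrite mxE; exact: Laurent_add. Qed.
Lemma laurent_mxN X : laurent_mx X -> laurent_mx (- X).
Proof. by move=> LX i j; rewrite mxE; apply: laurentN => //; exact: ptwist_add. Qed.
Lemma laurent_mxM X Y : laurent_mx X -> laurent_mx Y -> laurent_mx (X * Y).
Proof.
move=> LX LY i j; rewrite mxE sum2.
by apply: Laurent_add; apply: laurentM => //; [exact: ptwist_mul|exact: ptwist_comp|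
  exact: ptwist_mul|exact: ptwist_comp].
Qed.

Lemma degree_trace_cyclic X Y : laurent_mx X -> laurent_mx Y ->
  degree_trace (X * Y) = degree_trace (Y * X).
Proof.
move=> LX LY.
have t i j k l : haar_poly (constant_term (X i j * Y k l)) =
    haar_poly (constant_term (Y k l * X i j)).
  apply: (constant_term_trace (s := ptwist mu)) => //.
  - exact: ptwist_mul.
  - exact: ptwist_id.
  - exact: ptwist_comp.
  - exact: haar_poly_add.
  - by move=> x y; rewrite (poly_mulC (@SU2_mulC C)).
  - exact: haar_poly_twist.
rewrite !degree_traceE !mxE !sum2 !constant_termD !haar_poly_add !t.
by rewrite addrACA.
Qed.

Section Derivative.
Variable D : {poly SU2} -> {poly SU2}.
Hypothesis D_add : {morph D : x y / x + y}.
Hypothesis D_mul : forall x y, D (x * y) = x * D y + D x * y.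
Hypothesis D_twist : forall i x, D (ptwist mu i x) = ptwist mu i (D x).

Lemma laurent_mx_com X : laurent_mx X -> laurent_mx (com (pointwise D_add)%:M X).
Proof.
by move=> LX i j; rewrite com_scalar_mx comE; exact: laurent_pointwise.
Qed.

Lemma degree_trace_com X : degree_trace (com (pointwise D_add)%:M X) =
  haar_poly (D (constant_term (X 0 0))) + haar_poly (D (constant_term (X 1 1))).
Proof.
by rewrite degree_traceE !com_scalar_mx !comE !constant_term_pointwise.
Qed.
End Derivative.

Section HatDerivation.
Variable D : SU2 -> SU2.
Hypothesis dD : derivation D.
Hypothesis D_haar : forall t, haar (D t) = 0.
Hypothesis D_twist : forall i t, D (twist mu i t) = twist mu i (D t).

(** The derivation as an operator on sequences of polynomials in y, acting on
    their coefficients. *)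
Definition hat : R := pointwise (map_poly_add (lin_mapD dD.1)).

Lemma hat_mul x y : map_poly D (x * y) = x * map_poly D y + map_poly D x * y.
Proof. exact: map_poly_leibniz (lin_mapD dD.1) dD.2 x y. Qed.
Lemma hat_twist i x : map_poly D (ptwist mu i x) = ptwist mu i (map_poly D x).
Proof.
apply/polyP => k.
rewrite !(coef_map_add (lin_mapD dD.1)) !(coef_map_add (twist_add mu1 i)).
by rewrite (coef_map_add (lin_mapD dD.1)) D_twist.
Qed.

Lemma laurent_mx_hat X : laurent_mx X -> laurent_mx (com hat%:M X).
Proof. by apply: laurent_mx_com; [exact: hat_mul|exact: hat_twist]. Qed.

Lemma degree_trace_hat X : degree_trace (com hat%:M X) = 0.
Proof.
have z x : haar_poly (map_poly D x) = 0.
  apply/polyP => k; rewrite (coef_map_add haar_add) (coef_map_add (lin_mapD dD.1)).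
  by rewrite D_haar coef0.
by rewrite degree_trace_com ?z ?addr0 //; exact: hat_mul.
Qed.

End HatDerivation.

Definition hat_y : R := pointwise (@derivD SU2).

Lemma laurent_mx_hat_y X : laurent_mx X -> laurent_mx (com hat_y%:M X).
Proof.
apply: laurent_mx_com => [x y|i x]; first by rewrite derivM addrC.
exact: map_poly_deriv (twist_add mu1 i) x.
Qed.

Lemma degree_trace_hat_y X : degree_trace (com hat_y%:M X) = (degree_trace X)^`().
Proof.
rewrite degree_trace_com => [|x y]; last by rewrite derivM addrC.
by rewrite !haar_poly_deriv -derivD -degree_traceE.
Qed.

Lemma com_hat_y D (dD : derivation D) : com hat_y (hat dD) = 0.
Proof.
apply: endo_ext => f; apply/funext => i; rewrite comE.
rewrite -[LHS]/((map_poly D (f i))^`() - map_poly D (f i)^`()).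
by rewrite (map_poly_deriv (lin_mapD dD.1)) subrr.
Qed.

Lemma com_hat D E (dD : derivation D) (dE : derivation E) (f : W) i k :
  ((com (hat dD) (hat dE) : R) f i)`_k = D (E (f i)`_k) - E (D (f i)`_k).
Proof.
rewrite comE -[(_ - _ : R) f i]/(map_poly D (map_poly E (f i)) - map_poly E (map_poly D (f i))).
by rewrite coefB !(coef_map_add (lin_mapD dD.1), coef_map_add (lin_mapD dE.1)).
Qed.

End Degree.

Section Intertwining.
Variables (C : numClosedFieldType) (c : C).
Local Notation SU2 := (SU2 C).

Definition intertwined_mx (X : 'M[endo (int -> {poly SU2})]_2)
    (X' : 'M[endo (int -> SU2)]_2) :=
  forall i j, intertwined c (X i j) (X' i j).

Lemma intertwined_mxM X Y X' Y' : intertwined_mx X X' -> intertwined_mx Y Y' ->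
  intertwined_mx (X * Y) (X' * Y').
Proof.
move=> XX YY i j; rewrite !mxE !sum2.
by apply: intertwinedD; apply: intertwinedM.
Qed.
Lemma intertwined_mxB X Y X' Y' : intertwined_mx X X' -> intertwined_mx Y Y' ->
  intertwined_mx (X - Y) (X' - Y').
Proof.
by move=> XX YY i j; rewrite !mxE; apply/intertwinedD => //; exact: intertwinedN.
Qed.
Lemma intertwined_mx_com X Y X' Y' : intertwined_mx X X' -> intertwined_mx Y Y' ->
  intertwined_mx (com X Y) (com X' Y').
Proof.
move=> XX YY; rewrite !comE.
by apply: intertwined_mxB; apply: intertwined_mxM.
Qed.
Lemma intertwined_mx_scalar x x' : intertwined c x x' -> intertwined_mx x%:M x'%:M.
Proof.
by move=> xx i j; rewrite !mxE; case: (i == j); rewrite ?mulr0n; [|exact: intertwined0].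
Qed.
Lemma intertwined_mx_gauge F G x F' G' x' : intertwined_mx F F' -> intertwined_mx G G' ->
  intertwined c x x' -> intertwined_mx (gauge F G x%:M) (gauge F' G' x'%:M).
Proof.
move=> FF GG xx; apply: intertwined_mxM => //; apply: intertwined_mx_com => //.
exact: intertwined_mx_scalar.
Qed.

Lemma degree_trace_eval X X' : intertwined_mx X X' ->
  (degree_trace X).[c] = haar (constant_term (X' 0 0) + constant_term (X' 1 1)).
Proof.
move=> XX; have H p : (haar_poly p).[c] = haar p.[c%:A].
  have := @horner_map_linear C C^o (@haar C) p c (@haar_linear C).
  by rewrite -[c%:A in LHS]/(c * 1) mulr1.
by rewrite degree_traceE hornerD !H !(intertwined_constant_term (XX _ _)) linearD.
Qed.

End Intertwining.

Section ConstantMatrices.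
Variables (C : numClosedFieldType) (mu : C).
Hypothesis mu1 : mu * mu^* = 1.
Local Notation SU2 := (SU2 C).
Local Notation mono := (mon (twist mu)).

Definition mono_mx (A : 'M[SU2]_2) : 'M[endo (int -> SU2)]_2 := \matrix_(i, j) mono (A i j) 0.

Lemma mono_mxM A B : mono_mx (A * B) = mono_mx A * mono_mx B.
Proof.
apply/matrixP => i j; rewrite !mxE !sum2 (monD (twist_add mu1)) !mxE.
by rewrite !(monM (twist_mul mu1) (twist_comp mu1)) addr0 oppr0 !(twist_id mu).
Qed.
Lemma mono_mx1 : mono_mx 1 = 1.
Proof.
apply/matrixP => i j; rewrite !mxE; case: (i == j); first exact: (mon1 (twist_one mu1)).
exact: (mon0 (twist_add mu1)).
Qed.
Lemma mono_mxB A B : mono_mx (A - B) = mono_mx A - mono_mx B.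
Proof.
apply/matrixP => i j; rewrite !mxE (monD (twist_add mu1)).
by rewrite (monN (twist_add mu1)).
Qed.

Lemma com_mono_mx D (dD : derivation D) :
  (forall i t, D (twist mu i t) = twist mu i (D t)) -> forall A,
  com (pointwise (lin_mapD dD.1))%:M (mono_mx A) = mono_mx (map_mx D A).
Proof.
move=> Dt A; apply/matrixP => i j; rewrite com_scalar_mx !mxE comE pointwise_mon //.
exact: dD.2.
Qed.

End ConstantMatrices.

(** * Absence of a cleaving map *)

Section SL2.
Variable C : numClosedFieldType.
Local Notation SU2 := (SU2 C).
Local Notation U := (SU2_mx C).

(** [D] is the invariant vector field of the Lie algebra element [X]. *)
Definition generates (X : 'M[C]_2) (D : SU2 -> SU2) :=
  derivation D /\ forall i j, D (U i j) = \sum_k X k i *: U k j.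

Lemma generates_ex (X : 'M[C]_2) : \tr X = 0 ->
  exists2 D, generates X D & forall t, haar (D t) = 0.
Proof.
rewrite /mxtrace sum2 => /SU2_derivation_ex[D [dD DU Dh]].
by exists D.
Qed.

Lemma generates_uniq X D E : generates X D -> generates X E -> D =1 E.
Proof.
by move=> [dD DU] [dE EU]; apply: derivation_ext => // i j; rewrite DU EU.
Qed.

Lemma generates_com X Y D E : generates X D -> generates Y E ->
  generates (X * Y - Y * X) (fun t => D (E t) - E (D t)).
Proof.
move=> [dD DU] [dE EU]; split; first exact: derivation_comm.
have two (A B : 'M[C]_2) F G : derivation F -> (forall i j, F (U i j) = \sum_k A k i *: U k j) ->
    (forall i j, G (U i j) = \sum_k B k i *: U k j) ->
    forall i j, F (G (U i j)) = \sum_k (A * B) k i *: U k j.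
  move=> dF FU GU i j; rewrite GU (@lin_map_sum _ _ _ _ _ _ dF.1).
  under eq_bigr => k _ do rewrite (lin_mapZ _ _ dF.1) FU scaler_sumr.
  rewrite exchange_big; apply: eq_bigr => l _.
  have -> : (A * B) l i = \sum_k A l k * B k i by rewrite mxE.
  rewrite scaler_suml.
  by apply: eq_bigr => k _; rewrite scalerA mulrC.
move=> i j; rewrite (two X Y) // (two Y X) // -sumrB; apply: eq_bigr => k _.
by rewrite -scalerBl !mxE.
Qed.

Lemma generatesD X Y D E : generates X D -> generates Y E ->
  generates (X + Y) (fun t => D t + E t).
Proof.
move=> [[Dl DM] DU] [[El EM] EU]; split; first split=> [a x y|x y].
- by rewrite Dl El scalerDr addrACA.
- by rewrite DM EM mulrDr mulrDl addrACA.
move=> i j; rewrite DU EU -big_split /=; apply: eq_bigr => k _.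
by rewrite [(X + Y) k i]mxE scalerDl.
Qed.

Lemma generatesN X D : generates X D -> generates (- X) (fun t => - D t).
Proof.
move=> [[Dl DM] DU]; split; first split=> [a x y|x y].
- by rewrite Dl opprD scalerN.
- by rewrite DM opprD mulrN mulNr.
move=> i j; rewrite DU -sumrN; apply: eq_bigr => k _.
by rewrite [(- X) k i]mxE scaleNr.
Qed.

Definition mat_e : 'M[C]_2 := delta_mx 0 1.
Definition mat_f : 'M[C]_2 := delta_mx 1 0.
Definition mat_h : 'M[C]_2 := \matrix_(i, j) if i == j then (if i == 0 then 1 else -1) else 0.

Let mx2 (A B : 'M[C]_2) : A 0 0 = B 0 0 -> A 0 1 = B 0 1 -> A 1 0 = B 1 0 -> A 1 1 = B 1 1 -> A = B.
Proof. by move=> *; apply/matrixP => i j; elim/ord2P: i; elim/ord2P: j. Qed.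

Lemma mat_ef : mat_e * mat_f - mat_f * mat_e = mat_h.
Proof. by apply: mx2; rewrite !mxE !sum2 !mxE /=; ring. Qed.
Lemma mat_he : mat_h * mat_e - mat_e * mat_h = mat_e + mat_e.
Proof. by apply: mx2; rewrite !mxE !sum2 !mxE /=; ring. Qed.
Lemma mat_hf : mat_h * mat_f - mat_f * mat_h = - (mat_f + mat_f).
Proof. by apply: mx2; rewrite !mxE !sum2 !mxE /=; ring. Qed.
Lemma mat_hh : mat_h * mat_h = 1.
Proof. by apply: mx2; rewrite !mxE !sum2 !mxE /=; ring. Qed.
Lemma mat_e_tr : \tr mat_e = 0. Proof. by rewrite /mxtrace sum2 !mxE /= addr0. Qed.
Lemma mat_f_tr : \tr mat_f = 0. Proof. by rewrite /mxtrace sum2 !mxE /= addr0. Qed.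
Lemma mat_h_tr : \tr mat_h = 0. Proof. by rewrite /mxtrace sum2 !mxE /= subrr. Qed.

End SL2.

Section NotCleft.
Variables (C : numClosedFieldType) (mu : C).
Hypothesis mu1 : mu * mu^* = 1.
Local Notation SU2 := (SU2 C).
Local Notation U := (SU2_mx C).
Local Notation S7 := (S7 mu).
Local Notation rho := (coact (S7_comodule mu)).

Lemma const_poly (p : {poly C}) : p^`() = 0 -> forall a b, p.[a] = p.[b].
Proof.
move=> dp; suff -> : p = (p`_0)%:P by move=> a b; rewrite !hornerC.
apply/polyP => -[|i]; rewrite coefC //=.
have := congr1 (fun q : {poly C} => q`_i) dp; rewrite coef_deriv coef0.
by move/eqP; rewrite mulrn_eq0 => /eqP.
Qed.

(** The degree of the frame along the path is a constant polynomial in y, which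
    is 0 at one end and 2 at the other. *)
Theorem S7_no_equivariant_frame (Phi Psi : 'M[S7]_2) :
  Phi * Psi = 1 -> Psi * Phi = 1 ->
  (forall i j, rho (Phi i j) = \sum_k Phi i k ⊗ U k j) -> False.
Proof.
move=> PP PP' co.
have [pi [pi1 piM pil pi_gen piL]] := S7_rep_ex (ptwist_add mu1) (ptwist_mul mu1)
  (ptwist_one mu1) (ptwist_id mu1) (ptwist_comp mu1) mu1 (poly_mulC (@SU2_mulC C))
  (ptwist_scalar mu1) (path_z_wt mu1) (path_zs_wt mu1) (path_sum C).
have [De Ge he] := generates_ex (mat_e_tr C).
have [Df Gf hf] := generates_ex (mat_f_tr C).
have [Dh Gh hh] := generates_ex (mat_h_tr C).
have tw (X : 'M[C]_2) D : generates X D -> forall i t, D (twist mu i t) = twist mu i (D t).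
  by move=> [dD DU]; apply: (twist_derivation mu1 dD DU).
have te := tw _ _ Ge; have tf := tw _ _ Gf; have th := tw _ _ Gh.
pose F : 'M[endo (int -> {poly SU2})]_2 := map_mx pi Phi.
pose G : 'M[endo (int -> {poly SU2})]_2 := map_mx pi Psi.
pose e := hat Ge.1; pose f := hat Gf.1; pose h := hat Gh.1.
pose w := gauge F G h%:M * com (gauge F G e%:M) (gauge F G f%:M).
have piD x y : pi (x + y) = pi x + pi y.
  have sp1 : scalar_poly (1 : C) = 1 by exact: rmorph1.
  have sm1 : mon (ptwist mu) (scalar_poly 1) 0 = 1 by rewrite sp1 (mon1 (ptwist_one mu1)).
  by rewrite -[x in LHS]scale1r pil [X in X * _]sm1 mul1r.
have pi0 : pi 0 = 0 by apply: (addIr (pi 0)); rewrite -piD !add0r.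
have piMM (A B : 'M[S7]_2) : A * B = 1 -> map_mx pi A * map_mx pi B = 1.
  move=> AB; apply/matrixP => i j; rewrite !mxE sum2 !mxE -!piM -piD.
  have /matrixP/(_ i j) := AB; rewrite !mxE sum2 => ->.
  by case: (i == j); rewrite ?pi1 ?pi0.
have FG : F * G = 1 by exact: piMM.
have GF : G * F = 1 by exact: piMM.
have LF : laurent_mx mu F by move=> i j; rewrite mxE.
have LG : laurent_mx mu G by move=> i j; rewrite mxE.
have dw : (degree_trace w)^`() = 0.
  rewrite -degree_trace_hat_y.
  have hatE D (dD : derivation D) (v : int -> {poly SU2}) l k :
      (hat dD v l)`_k = D (v l)`_k.
    by rewrite -[hat _ v l]/(map_poly _ (v l)) (coef_map_add (lin_mapD dD.1)).
  have comE' (X Y : 'M[C]_2) D E (GD : generates X D) (GE : generates Y E) K (dK : derivation K) :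
      generates (X * Y - Y * X) K ->
      com ((hat GD.1)%:M : 'M_2) (hat GE.1)%:M = (hat dK)%:M.
    move=> GK; apply/matrixP => i j; rewrite com_scalar_mx !mxE; case: (i == j); last first.
      by rewrite !mulr0n comE mulr0 mul0r subr0.
    rewrite !mulr1n; apply: endo_ext => v; apply/funext => l; apply/polyP => k.
    by rewrite com_hat (generates_uniq (generates_com GD GE) GK); symmetry; exact: hatE.
  have com0 D (dD : derivation D) : com (hat_y C)%:M (hat dD)%:M = 0 :> 'M_2.
    apply/matrixP => i j; rewrite com_scalar_mx !mxE; case: (i == j).
      by rewrite !mulr1n com_hat_y.
    by rewrite !mulr0n comE mulr0 mul0r subr0.
  apply: (@degree_stationary _ e%:M f%:M h%:M _ F G _ _ _ _ _ _ FG GF _ _ (laurent_mx mu)) => //.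
  - by apply: comE'; rewrite mat_ef.
  - have GK : generates (mat_h C * mat_e C - mat_e C * mat_h C) (fun t => De t + De t).
      by rewrite mat_he; exact: generatesD.
    rewrite (comE' _ _ _ _ Gh Ge _ GK.1 GK) -raddfD; congr (_%:M).
    apply: endo_ext => v; apply/funext => l; apply/polyP => k.
    by rewrite [LHS]hatE -[RHS]/((e v l + e v l)`_k) coefD [(e _ _)`__]hatE.
  - have GK : generates (mat_h C * mat_f C - mat_f C * mat_h C) (fun t => - (Df t + Df t)).
      by rewrite mat_hf; apply: generatesN; exact: generatesD.
    have dK := GK.1; rewrite (comE' _ _ _ _ Gh Gf _ dK GK) -raddfD -raddfN; congr (_%:M).
    apply: endo_ext => v; apply/funext => l; apply/polyP => k.
    rewrite [LHS]hatE -[RHS]/((- (f v l + f v l))`_k) coefN coefD.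
    by rewrite [(f _ _)`__]hatE.
  - exact: com0.
  - exact: com0.
  - exact: com0.
  - exact: degree_traceD.
  - exact: laurent_mxD.
  - exact: laurent_mxN.
  - exact: laurent_mxM.
  - exact: degree_trace_cyclic.
  - by move=> X LX; apply: laurent_mx_hat.
  - by move=> X LX; apply: laurent_mx_hat.
  - by move=> X LX; apply: laurent_mx_hat.
  - exact: laurent_mx_hat_y.
  - by move=> X LX; apply: degree_trace_hat.
  - by move=> X LX; apply: degree_trace_hat.
  - by move=> X LX; apply: degree_trace_hat.
(* The forms vanish at y = 0, where the frame is killed by the vector fields. *)
have w0 : (degree_trace w).[0] = 0.
  have ep := endpoint0 mu1 pi1 piM pil pi_gen.
  pose x' p := s2val (cid2 (ep p)).
  have x'P p : intertwined 0 (pi p) (x' p) := s2valP (cid2 (ep p)).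
  have x'D p := s2valP' (cid2 (ep p)).
  pose F0 := \matrix_(i, j) x' (Phi i j); pose G0 := \matrix_(i, j) x' (Psi i j).
  have FF : intertwined_mx 0 F F0 by move=> i j; rewrite !mxE.
  have GG : intertwined_mx 0 G G0 by move=> i j; rewrite !mxE.
  pose pt D (dD : derivation D) : endo (int -> SU2) := pointwise (lin_mapD dD.1).
  have Fc D (dD : derivation D) : (forall i t, D (twist mu i t) = twist mu i (D t)) ->
      com (pt D dD)%:M F0 = 0.
    by move=> Dt; apply/matrixP => i j; rewrite com_scalar_mx !mxE; exact: x'D.
  have ww : intertwined_mx 0 w (gauge F0 G0 (pt _ Gh.1)%:M *
      com (gauge F0 G0 (pt _ Ge.1)%:M) (gauge F0 G0 (pt _ Gf.1)%:M)).
    by apply: intertwined_mxM; last apply: intertwined_mx_com;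
      apply: (intertwined_mx_gauge FF GG); exact: intertwined_pointwise.
  rewrite (degree_trace_eval ww) /gauge Fc // mulr0 mul0r.
  rewrite !mxE /constant_term endo0E addr0.
  exact: (linear0 (@haar C)).
(* At y = 1 the forms are the constant matrices of e, f and h themselves. *)
have w1 : (degree_trace w).[1] = 2.
  have ep := endpoint1 mu1 pi1 piM pil pi_gen.
  pose f1 : 'M[SU2]_2 := map_mx (fibre (mu := mu)) Phi.
  pose g1 : 'M[SU2]_2 := map_mx (fibre (mu := mu)) Psi.
  pose F1 := mono_mx mu f1; pose G1 := mono_mx mu g1.
  have FF : intertwined_mx 1 F F1 by move=> i j; rewrite !mxE.
  have GG : intertwined_mx 1 G G1 by move=> i j; rewrite !mxE.
  have gf : g1 * f1 = 1.
    have [fib1 fibM] := @fibre_monoid C mu; have fl := @fibre_linear C mu.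
    apply/matrixP => i j; rewrite !mxE sum2 !mxE -!fibM -(lin_mapD fl).
    have /matrixP/(_ i j) := PP'; rewrite !mxE sum2 => ->.
    by case: (i == j); rewrite ?fib1 ?(lin_map0 fl).
  pose emb (X : 'M[C]_2) := mono_mx mu (map_mx (in_alg SU2) X).
  have embM X Y : emb (X * Y) = emb X * emb Y.
    by rewrite /emb map_mxM mono_mxM.
  have embB X Y : emb (X - Y) = emb X - emb Y.
    by rewrite /emb map_mxB mono_mxB.
  pose pt D (dD : derivation D) : endo (int -> SU2) := pointwise (lin_mapD dD.1).
  have gaugeE (X : 'M[C]_2) D (GD : generates X D) : gauge F1 G1 (pt D GD.1)%:M = emb X.
    rewrite /gauge com_mono_mx //; last exact: tw GD.
    have -> : map_mx D f1 = f1 * map_mx (in_alg SU2) X.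
      apply/matrixP => i j; rewrite !mxE.
      rewrite (fibre_derivation GD.1 GD.2 (co i)).
      by apply: eq_bigr => k _; rewrite !mxE mulr_algr.
    by rewrite -mono_mxM // mulrA gf mul1r.
  have ww : intertwined_mx 1 w (emb (mat_h C) * com (emb (mat_e C)) (emb (mat_f C))).
    rewrite -(gaugeE _ _ Gh) -(gaugeE _ _ Ge) -(gaugeE _ _ Gf).
    by apply: intertwined_mxM; last apply: intertwined_mx_com;
      apply: (intertwined_mx_gauge FF GG); exact: intertwined_pointwise.
  rewrite (degree_trace_eval ww) comE -!embM -embB mat_ef -embM mat_hh.
  rewrite /emb map_mx1 mono_mx1 // !mxE /= (linearD (@haar C)).
  have h1 : @haar C (constant_term 1) = 1 by exact: haar1.
  by rewrite [X in X + _]h1 [X in _ + X]h1.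
have := const_poly dw 0 1; rewrite w0 w1 => /eqP.
by rewrite eq_sym pnatr_eq0.
Qed.

(** Colinearity makes the image of U an equivariant frame, inverted by the image
    of U under the convolution inverse. *)
Theorem S7_not_cleft : ~ cleft (S7_comodule mu).
Proof.
move=> [phi [phi1 [psi conv] phico]].
pose Phi : 'M[S7]_2 := \matrix_(i, j) phi (U i j).
pose Psi : 'M[S7]_2 := \matrix_(i, j) psi (U i j).
have bl (u v : {linear SU2 -> S7}) : bilin (fun a b => u a * v b).
  split=> [y c x x'|x c y y'] /=; first by rewrite linearP mulrDl -scalerAl.
  by rewrite linearP mulrDr -scalerAr.
have convU (u v : {linear SU2 -> S7}) i j :
    convolution (SU2_hopf C) u v (U i j) = \sum_k u (U i k) * v (U k j).
  rewrite /convolution SU2_comul_lr (@lin_map_sum _ _ _ _ _ _ (ctlift_linear (bl u v))).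
  by apply: eq_bigr => k _; rewrite (ctliftE (bl u v)).
apply: (@S7_no_equivariant_frame Phi Psi).
- apply/matrixP => i j; rewrite !mxE.
  transitivity (convolution (SU2_hopf C) phi psi (U i j)).
    by rewrite convU; apply: eq_bigr => k _; rewrite !mxE.
  by rewrite [LHS](conv (U i j)).1 [counit _ _]SU2_counitE scaler_nat.
- apply/matrixP => i j; rewrite !mxE.
  transitivity (convolution (SU2_hopf C) psi phi (U i j)).
    by rewrite convU; apply: eq_bigr => k _; rewrite !mxE.
  by rewrite [LHS](conv (U i j)).2 [counit _ _]SU2_counitE scaler_nat.
- move=> i j; rewrite mxE phico SU2_comul_lr.
  have pl : linear phi by move=> c x y; rewrite linearP.
  have il : linear (idfun : SU2 -> SU2) by [].
  rewrite (@lin_map_sum _ _ _ _ _ _ (ctens_map_linear pl il)).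
  apply: eq_bigr => k _; rewrite (ctens_mapE pl il).
  by have -> : Phi i k = phi (U i k) by rewrite mxE.
Qed.

End NotCleft.

Lemma exp_ipi_unitary (R : realType) (theta : R) :
  exp_ipi theta * (exp_ipi theta)^* = 1.
Proof.
apply/eqP; rewrite /exp_ipi eq_complex /= mulrN opprK -!expr2 cos2Dsin2 eqxx /=.
by rewrite mulrN addrC mulrC subrr.
Qed.

Theorem theorem10 (R : realType) (theta : R) :
  [/\ hopf_galois (S7_comodule (exp_ipi theta)) (S4_incl (exp_ipi theta)),
      faithfully_flat (S4_incl (exp_ipi theta)) &
      ~ cleft (S7_comodule (exp_ipi theta))].
Proof.
have mu1 := exp_ipi_unitary theta.
split; [exact: S7_hopf_galois|exact: S7_faithfully_flat|exact: S7_not_cleft].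
Qed.
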